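(* Let $d\in\mathbb{N}\cup\{\infty\}$ and let $V$ and $W$ be varieties in $\mathbb{B}_d$ such that either $V$ and $W$ have the same affine codimension or $d<\infty$. Then every completely isometric (algebra) isomorphism $\varphi:\mathcal{M}_V\to\mathcal{M}_W$ arises as composition $\varphi(f)=f\circ F$ $(f\in\mathcal{M}_V)$, where $F$ is an automorphism of $\mathbb{B}_d$ mapping $W$ onto $V$.
   Context: $d$ is a positive integer or $\infty=\aleph_0$; $\mathbb{C}^\infty$ means $\ell^2$, and $\mathbb{B}_d$ is the open unit ball of $\mathbb{C}^d$. The Drury-Arveson space $H^2_d$ is the reproducing kernel Hilbert space on $\mathbb{B}_d$ with kernel functions $k_\lambda(z)=\frac{1}{1-\langle z,\lambda\rangle}$, $z,\lambda\in\mathbb{B}_d$. A variety in $\mathbb{B}_d$ is the common zero set in $\mathbb{B}_d$ of a family of functions in $H^2_d$. For a variety $V$, $\mathcal{F}_V=\overline{\mathrm{span}}\{k_\lambda:\lambda\in V\}\subseteq H^2_d$, regarded as a reproducing kernel Hilbert space of functions on $V$, and $\mathcal{M}_V=\mathrm{Mult}(\mathcal{F}_V)$ is its multiplier algebra: the functions $f$ on $V$ with $fh\in\mathcal{F}_V$ for all $h\in\mathcal{F}_V$. Each $f\in\mathcal{M}_V$ is identified with the bounded multiplication operator $M_f\in B(\mathcal{F}_V)$, and $\mathcal{M}_V$ carries the resulting operator norm and matrix norms. An isomorphism of $\mathcal{M}_V$ and $\mathcal{M}_W$ is onto. An automorphism of $\mathbb{B}_d$ is a biholomorphism of $\mathbb{B}_d$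 onto itself. For $S\subseteq\mathbb{C}^d$, the affine span is $\mathrm{aff}(S)=\lambda+\mathrm{span}(S-\lambda)$ for any $\lambda\in S$; the affine codimension of $S$ is the dimension of the quotient space $\mathbb{C}^d/\overline{\mathrm{aff}(S)-\lambda}$ for any $\lambda\in\mathrm{aff}(S)$ (independent of $\lambda$). *)

(* Defs.v *)
From HB Require Import structures.
From mathcomp Require Import all_boot all_order all_algebra.
From mathcomp Require Import complex.
From mathcomp Require Import all_classical all_reals all_analysis.
From mathcomp Require Import ring lra.

Set Implicit Arguments.
Unset Strict Implicit.
Unset Printing Implicit Defensive.

Import Order.TTheory GRing.Theory Num.Theory.
Import numFieldNormedType.Exports.

Local Open Scope classical_set_scope.
Local Open Scope ring_scope.
Local Open Scope complex_scope.

HB.instance Definition _ (R : realType) := NormedModule.copy R[i] R[i]^o.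

Section RealNorm.
Variables (R : realType).

(* Norms of [normedModType R[i]] live in R[i]; this is the same norm in R. *)
Definition rnorm (E : normedModType R[i]) (x : E) : R := complex.Re `|x|.

Lemma ge0_ReK (z : R[i]) : 0 <= z -> (complex.Re z)%:C = z.
Proof. by case: z => a b; rewrite lecE /= => /andP[/eqP-> _]. Qed.

Lemma rnormE (E : normedModType R[i]) (x : E) : (rnorm x)%:C = `|x|.
Proof. by apply: ge0_ReK; exact: normr_ge0. Qed.

Lemma rnorm_ge0 (E : normedModType R[i]) (x : E) : 0 <= rnorm x.
Proof. by rewrite -lecR rnormE; exact: normr_ge0. Qed.

Lemma ler_rnormD (E : normedModType R[i]) (x y : E) :
  rnorm (x + y) <= rnorm x + rnorm y.
Proof. by rewrite -lecR rmorphD /= !rnormE ler_normD. Qed.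

Lemma rnormZ (E : normedModType R[i]) (a : R[i]) (x : E) :
  rnorm (a *: x) = rnorm a * rnorm x.
Proof. by apply: complexI; rewrite rmorphM /= !rnormE normrZ. Qed.

Lemma rnorm0_eq0 (E : normedModType R[i]) (x : E) : rnorm x = 0 -> x = 0.
Proof. by move=> x0; apply/normr0_eq0; rewrite -rnormE x0. Qed.

Lemma rnorm_sqr (z : R[i]) :
  rnorm z ^+ 2 = complex.Re z ^+ 2 + complex.Im z ^+ 2.
Proof.
by rewrite /rnorm normc_def /= sqr_sqrtr // addr_ge0 ?sqr_ge0.
Qed.

Lemma sqrtr_minkowski2 (p q a b : R) : 0 <= p -> 0 <= q -> 0 <= a -> 0 <= b ->
  Num.sqrt ((p + q) ^+ 2 + (a + b) ^+ 2) <=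
  Num.sqrt (p ^+ 2 + a ^+ 2) + Num.sqrt (q ^+ 2 + b ^+ 2).
Proof.
move=> p0 q0 a0 b0; have := le_normcD (p +i* a) (q +i* b).
by rewrite /=.
Qed.

Lemma cvg_complex (T : Type) (F : set_system T) (FF : Filter F)
    (u v : T -> R) (a b : R) :
  u @ F --> a -> v @ F --> b -> (fun t => u t +i* v t) @ F --> a +i* b.
Proof.
move=> ua vb; apply/cvgrPdist_le => e e0.
have eE : (complex.Re e)%:C = e by apply: ge0_ReK; apply: ltW.
have r0 : 0 < complex.Re e by rewrite -ltcR eE.
near=> t.
rewrite -eE -rnormE lecR -(@ler_pXn2r _ 2) ?nnegrE ?rnorm_ge0 ?ltW //.
rewrite rnorm_sqr /=.
have h1 : `|a - u t| <= complex.Re e / 2.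
  near: t; move/cvgrPdist_le: ua; apply; exact: divr_gt0.
have h2 : `|b - v t| <= complex.Re e / 2.
  near: t; move/cvgrPdist_le: vb; apply; exact: divr_gt0.
rewrite -(real_normK (num_real (a - u t))) -(real_normK (num_real (b - v t))).
have := normr_ge0 (a - u t); have := normr_ge0 (b - v t).
nra.
Unshelve. all: by end_near. Qed.

End RealNorm.

(* The inner product is linear in its first variable. *)
HB.mixin Record isHilbert (R : realType) E of CompleteNormedModule R[i] E := {
  hdot : {dot E for @conjc R};
  hdot_norm : forall x : E, hdot x x = `|x| ^+ 2
}.

#[short(type="hilbertType")]
HB.structure Definition Hilbert (R : realType) :=
  {E of CompleteNormedModule R[i] E & isHilbert R E}.

Section SquareSummable.
Variables (R : realType) (d : option nat).
Implicit Types (x y : nat -> R[i]).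

(* A dimension is an option nat, None standing for the infinite dimension aleph_0.
   Coordinates are indexed from 0. *)
Definition in_dim (n : nat) : bool := if d is Some m then (n < m)%N else true.

Definition sqnorms x : R^nat := series (fun n => rnorm (x n) ^+ 2).

Definition square_summable : {pred nat -> R[i]} :=
  fun x => `[< (forall n, ~~ in_dim n -> x n = 0) /\ cvgn (sqnorms x) >].

Lemma sqnorms_ge0 x N : 0 <= sqnorms x N.
Proof. by apply: sumr_ge0 => n _; rewrite sqr_ge0. Qed.

Lemma nondecreasing_sqnorms x : nondecreasing_seq (sqnorms x).
Proof. by apply: nondecreasing_series => n _ _; rewrite sqr_ge0. Qed.

Lemma cvg_sqnorms x (M : R) : (forall N, sqnorms x N <= M) -> cvgn (sqnorms x).
Proof.
move=> xM; apply: nondecreasing_is_cvgn; first exact: nondecreasing_sqnorms.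
by exists M => _ [N _ <-].
Qed.

Lemma lim_sqnorms_le x (M : R) : (forall N, sqnorms x N <= M) ->
  limn (sqnorms x) <= M.
Proof.
by move=> xM; apply: limr_le; [exact: cvg_sqnorms xM | exact: nearW].
Qed.

Lemma le_lim_sqnorms x N : cvgn (sqnorms x) -> sqnorms x N <= limn (sqnorms x).
Proof.
by move=> cx; apply: nondecreasing_cvgn_le; first exact: nondecreasing_sqnorms.
Qed.

Lemma lim_sqnorms_ge0 x : cvgn (sqnorms x) -> 0 <= limn (sqnorms x).
Proof. by move=> cx; exact: le_trans (sqnorms_ge0 x 0) (le_lim_sqnorms 0 cx). Qed.

Lemma sqnorms_minkowski x y N :
  Num.sqrt (sqnorms (x + y) N) <=
  Num.sqrt (sqnorms x N) + Num.sqrt (sqnorms y N).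
Proof.
elim: N => [|N IH]; first by rewrite /sqnorms /series /= !big_geq // sqrtr0 addr0.
rewrite /sqnorms !seriesSr -/(sqnorms _) -/(sqnorms x) -/(sqnorms y) /=.
set P := sqnorms x N in IH *; set Q := sqnorms y N in IH *.
have P0 : 0 <= P by exact: sqnorms_ge0.
have Q0 : 0 <= Q by exact: sqnorms_ge0.
rewrite -{1}(sqr_sqrtr P0) -{1}(sqr_sqrtr Q0).
apply: le_trans (sqrtr_minkowski2 _ _ _ _); rewrite ?rnorm_ge0 ?sqrtr_ge0 //.
rewrite ler_sqrt ?addr_ge0 ?sqr_ge0 //; apply: lerD.
  rewrite -(sqr_sqrtr (sqnorms_ge0 (x + y) N)).
  by rewrite ler_pXn2r ?nnegrE ?addr_ge0 ?sqrtr_ge0.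
rewrite ler_pXn2r ?nnegrE ?addr_ge0 ?rnorm_ge0 //; exact: ler_rnormD.
Qed.

Lemma sqnormsZ (a : R[i]) x N :
  sqnorms (a *: x) N = rnorm a ^+ 2 * sqnorms x N.
Proof.
rewrite /sqnorms /series /= mulr_sumr; apply: eq_bigr => n _.
by rewrite rnormZ exprMn.
Qed.

Lemma sqnormsD_bound x y N : cvgn (sqnorms x) -> cvgn (sqnorms y) ->
  sqnorms (x + y) N <=
  (Num.sqrt (limn (sqnorms x)) + Num.sqrt (limn (sqnorms y))) ^+ 2.
Proof.
move=> cx cy; rewrite -(sqr_sqrtr (sqnorms_ge0 (x + y) N)).
rewrite ler_pXn2r ?nnegrE ?addr_ge0 ?sqrtr_ge0 //.
apply: le_trans (sqnorms_minkowski x y N) _.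
by apply: lerD; rewrite ler_sqrt ?lim_sqnorms_ge0 // le_lim_sqnorms.
Qed.

Lemma square_summable_submod_closed : submod_closed square_summable.
Proof.
split=> [|a x y /asboolP[x0 cx] /asboolP[y0 cy]]; apply/asboolP.
  split=> //; apply: (@cvg_sqnorms _ 0) => N.
  rewrite /sqnorms /series /= big1 // => n _.
  by rewrite -[(_ : nat -> R[i]) n](scale0r (0 : R[i])) rnormZ
     /rnorm normr0 mul0r expr0n.
split=> [n nd|]; first by rewrite /= /GRing.add /GRing.scale /= x0 // y0 // scaler0 addr0.
have cax : cvgn (sqnorms (a *: x)).
  apply: (@cvg_sqnorms _ (rnorm a ^+ 2 * limn (sqnorms x))) => N.
  by rewrite sqnormsZ ler_wpM2l ?sqr_ge0 // le_lim_sqnorms.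
by apply: (@cvg_sqnorms _ _) => N; exact: sqnormsD_bound.
Qed.

HB.instance Definition _ := GRing.isSubmodClosed.Build _ _ square_summable
  square_summable_submod_closed.

(* C^m for d = Some m (sequences vanishing from index m on), l^2 for d = None. *)
Record cspace := CSpace { coord :> nat -> R[i]; _ : coord \in square_summable }.

HB.instance Definition _ := [isSub for coord].
HB.instance Definition _ := [Choice of cspace by <:].
HB.instance Definition _ := [SubChoice_isSubLmodule of cspace by <:].

End SquareSummable.

Section CspaceNorm.
Variables (R : realType) (d : option nat).
Local Notation E := (cspace R d).
Implicit Types (x y : E).

Lemma coordP x : (forall n, ~~ in_dim d n -> x n = 0) /\ cvgn (sqnorms x).
Proof. by case: x => x /= /asboolP. Qed.

Lemma coordD x y n : (x + y : E) n = x n + y n. Proof. by []. Qed.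
Lemma coordZ (a : R[i]) x n : (a *: x : E) n = a * x n. Proof. by []. Qed.
Lemma coordB x y n : (x - y : E) n = x n - y n. Proof. by []. Qed.

Lemma cspaceP x y : (forall n, x n = y n) -> x = y.
Proof. by move=> xy; apply: val_inj; apply/funext. Qed.

Definition cnorm x : R := Num.sqrt (limn (sqnorms x)).

Lemma cnorm_ge0 x : 0 <= cnorm x. Proof. exact: sqrtr_ge0. Qed.

Lemma cnorm_le x (M : R) : 0 <= M ->
  (forall N, sqnorms x N <= M ^+ 2) -> cnorm x <= M.
Proof.
move=> M0 xM; rewrite -(ger0_norm M0) -sqrtr_sqr ler_sqrt ?sqr_ge0 //.
exact: lim_sqnorms_le.
Qed.

Lemma sqnorms_le x N : sqnorms x N <= cnorm x ^+ 2.
Proof.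
have [_ cx] := coordP x.
by rewrite sqr_sqrtr ?lim_sqnorms_ge0 //; exact: le_lim_sqnorms.
Qed.

Lemma cnormD x y : cnorm (x + y) <= cnorm x + cnorm y.
Proof.
have [[_ cx] [_ cy]] := (coordP x, coordP y).
apply: cnorm_le => [|N]; first by rewrite addr_ge0 ?cnorm_ge0.
exact: sqnormsD_bound.
Qed.

Lemma cnormZ (a : R[i]) x : cnorm (a *: x) = rnorm a * cnorm x.
Proof.
have [_ cx] := coordP x.
rewrite /cnorm (_ : limn (sqnorms (a *: x : E)) = rnorm a ^+ 2 * limn (sqnorms x)).
  by rewrite sqrtrM ?sqr_ge0 // sqrtr_sqr ger0_norm ?rnorm_ge0.
rewrite (_ : sqnorms _ = (rnorm a ^+ 2) *: sqnorms x); first exact: limZl_tmp.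
by apply/funext => N; exact: sqnormsZ.
Qed.

Lemma rnorm_coord_le x n : rnorm (x n) <= cnorm x.
Proof.
rewrite -(@ler_pXn2r _ 2) ?nnegrE ?rnorm_ge0 ?cnorm_ge0 //.
apply: le_trans (sqnorms_le x n.+1).
by rewrite /sqnorms seriesSr /= lerDr sqnorms_ge0.
Qed.

Lemma cnorm0_eq0 x : cnorm x = 0 -> x = 0.
Proof.
move=> x0; apply: cspaceP => n; apply: rnorm0_eq0; apply/eqP.
by rewrite eq_le rnorm_ge0 andbT -x0 rnorm_coord_le.
Qed.

Let normC x : R[i] := (cnorm x)%:C.

Let normCD x y : normC (x + y) <= normC x + normC y.
Proof. by rewrite /normC -rmorphD lecR cnormD. Qed.

Let normCZ (a : R[i]) x : normC (a *: x) = `|a| * normC x.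
Proof. by rewrite /normC cnormZ rmorphM /= rnormE. Qed.

Let normC0_eq0 x : normC x = 0 -> x = 0.
Proof. by move=> x0; apply: cnorm0_eq0; exact: complexI. Qed.

HB.instance Definition _ := Lmodule_isNormed.Build R[i] E
  normCD normCZ normC0_eq0.

Lemma cspace_normE x : `|x| = (Num.sqrt (limn (sqnorms x)))%:C.
Proof. by []. Qed.

Lemma cspace_complete (F : set_system E) : ProperFilter F -> cauchy F -> cvg F.
Proof.
move=> FF /cauchyP Fc.
have posE (e : R) : 0 < e -> 0 < e%:C by rewrite ltcR.
have part (p : R[i] -> R) : (forall a b, p (a - b) = p a - p b) ->
    (forall a, `|p a| <= rnorm a) ->
    forall n, cvg ((fun x : E => p (x n)) @ F).
  move=> pB ple n; apply: R_complete; apply/cauchyP => _/posnumP[e].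
  have [x Fx] : exists x, F (ball x e%:num%:C) by apply: Fc; rewrite ltcR.
  exists (p (x n)).
  suff: F [set y : E | ball (p (x n)) e%:num (p (y n))] by [].
  apply: filterS Fx => y; rewrite -!ball_normE /= => xy; rewrite -pB.
  apply: le_lt_trans (ple _) _; rewrite -coordB.
  by apply: le_lt_trans (rnorm_coord_le _ _) _; rewrite -ltcR.
have ReB (a b : R[i]) : complex.Re (a - b) = complex.Re a - complex.Re b.
  by case: a b => [? ?] [].
have ImB (a b : R[i]) : complex.Im (a - b) = complex.Im a - complex.Im b.
  by case: a b => [? ?] [].
have cRe n : cvg ((fun x : E => complex.Re (x n)) @ F).
  apply: part => // a.
  by rewrite -lecR rnormE; exact: normc_ge_Re.
have cIm n : cvg ((fun x : E => complex.Im (x n)) @ F).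
  apply: part => // -[a b].
  rewrite -(@ler_pXn2r _ 2) ?nnegrE ?rnorm_ge0 //.
  by rewrite real_normK ?num_real // rnorm_sqr /= lerDr sqr_ge0.
pose u n := lim ((fun x : E => complex.Re (x n)) @ F) +i*
            lim ((fun x : E => complex.Im (x n)) @ F).
have u_lim (x : E) (e : R) N : 0 < e -> F (ball x e%:C) ->
    sqnorms (coord x - u) N <= e ^+ 2.
  move=> e0 Fx.
  have: (fun y : E => sqnorms (coord x - coord y) N) @ F -->
        sqnorms (coord x - u) N.
    rewrite /sqnorms /series /=; apply: cvg_big => [|k _]; first exact: add_continuous.
    under eq_fun do rewrite rnorm_sqr ReB ImB.
    rewrite rnorm_sqr ReB ImB.
    have cr : (fun y : E => complex.Re (x k) - complex.Re (y k)) @ F -->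
        complex.Re (x k) - complex.Re (u k).
      by apply: cvgB; [exact: cvg_cst | exact: cRe].
    have ci : (fun y : E => complex.Im (x k) - complex.Im (y k)) @ F -->
        complex.Im (x k) - complex.Im (u k).
      by apply: cvgB; [exact: cvg_cst | exact: cIm].
    by apply: cvgD; rewrite expr2; [exact: (cvgM cr cr) | exact: (cvgM ci ci)].
  move=> /cvgr_to_le; apply; apply: filterS Fx => y.
  rewrite -ball_normE /= -rnormE ltcR => xy.
  apply: le_trans (sqnorms_le (x - y) N) _.
  by rewrite ler_pXn2r ?nnegrE ?cnorm_ge0 ?ltW.
have uP : u \in square_summable d.
  have [x Fx] : exists x, F (ball x (1 : R)%:C) by apply: Fc; exact: posE.
  have [x0 cx] := coordP x.
  rewrite (_ : u = coord x - (coord x - u)); last by rewrite opprB addrC subrK.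
  apply: rpredB; first exact: (valP x).
  apply/asboolP; split=> [n nd|].
    rewrite /= /u; apply/eqP; rewrite subr_eq0 x0 //; apply/eqP.
    have -> : (fun y : E => complex.Re (y n)) = cst 0.
      by apply/funext => y; have [-> //] := coordP y.
    have -> : (fun y : E => complex.Im (y n)) = cst 0.
      by apply/funext => y; have [-> //] := coordP y.
    by rewrite !lim_cst.
  by apply: cvg_sqnorms => N; exact: (u_lim x 1 N).
apply/cvg_ex; exists (CSpace uP); apply/cvgrPdist_lt => e e0.
have eE : (complex.Re e)%:C = e by apply: ge0_ReK; exact: ltW.
have r0 : 0 < complex.Re e / 2 by rewrite divr_gt0 // -ltcR eE.
have [x Fx] : exists x, F (ball x (complex.Re e / 2)%:C) by apply: Fc; exact: posE.
apply: filterS (Fx) => y; rewrite -ball_normE /= => xy.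
rewrite -eE -(subrKA x) (splitr (complex.Re e)) rmorphD /=.
apply: le_lt_trans (ler_normD _ _) _; apply: ler_ltD => //.
rewrite distrC -rnormE lecR; apply: cnorm_le; first exact: ltW.
by move=> N; exact: u_lim.
Qed.

HB.instance Definition _ := Uniform_isComplete.Build E cspace_complete.

End CspaceNorm.

Section CspaceDot.
Variables (R : realType) (d : option nat).
Local Notation E := (cspace R d).
Implicit Types (x y z : E).

Definition cdot x y : R[i] := limn (series (fun n => x n * (y n)^*)).

Let term x y n := x n * (y n)^*.

Let cvg_part (p : R[i] -> R) x y :
  (forall a b : R[i], `|p (a * b^*)| <= rnorm a ^+ 2 + rnorm b ^+ 2) ->
  cvgn (series (p \o term x y)).
Proof.
move=> pM; apply: normed_cvg.
apply: (@series_le_cvg _ _ (fun n => rnorm (x n) ^+ 2 + rnorm (y n) ^+ 2)).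
- by move=> n; exact: normr_ge0.
- by move=> n; rewrite addr_ge0 ?sqr_ge0.
- by move=> n; exact: pM.
- by apply: is_cvg_seriesD; [have [] := coordP x | have [] := coordP y].
Qed.

Let cvg_Re x y : cvgn (series (@complex.Re R \o term x y)).
Proof.
apply: cvg_part => -[a b] [a' b']; rewrite !rnorm_sqr /= ler_norml.
have := (sqr_ge0 (a - a'), sqr_ge0 (a + a'), sqr_ge0 (b - b'), sqr_ge0 (b + b')).
have := (sqr_ge0 (a - b'), sqr_ge0 (a + b'), sqr_ge0 (b - a'), sqr_ge0 (b + a')).
by move=> [[[? ?] ?] ?] [[[? ?] ?] ?]; apply/andP; split; nra.
Qed.

Let cvg_Im x y : cvgn (series (@complex.Im R \o term x y)).
Proof.
apply: cvg_part => -[a b] [a' b']; rewrite !rnorm_sqr /= ler_norml.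
have := (sqr_ge0 (a - a'), sqr_ge0 (a + a'), sqr_ge0 (b - b'), sqr_ge0 (b + b')).
have := (sqr_ge0 (a - b'), sqr_ge0 (a + b'), sqr_ge0 (b - a'), sqr_ge0 (b + a')).
by move=> [[[? ?] ?] ?] [[[? ?] ?] ?]; apply/andP; split; nra.
Qed.

Let series_complex x y N : series (term x y) N =
  series (@complex.Re R \o term x y) N +i* series (@complex.Im R \o term x y) N.
Proof.
elim: N => [|N IH]; first by rewrite /series /= !big_geq.
by rewrite !seriesSr IH /=; case: (term x y N).
Qed.

Lemma cvg_cdot x y : series (term x y) @ \oo --> cdot x y.
Proof.
suff h : series (term x y) @ \oo --> limn (series (@complex.Re R \o term x y)) +i*
    limn (series (@complex.Im R \o term x y)) by apply: cvgP h.
rewrite (_ : series _ = (fun N => series (@complex.Re R \o term x y) N +i*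
    series (@complex.Im R \o term x y) N)); last first.
  by apply/funext => N; exact: series_complex.
by apply: cvg_complex; [exact: cvg_Re | exact: cvg_Im].
Qed.

Lemma cdotE x y : cdot x y = limn (series (@complex.Re R \o term x y)) +i*
  limn (series (@complex.Im R \o term x y)).
Proof.
rewrite /cdot; apply: cvg_lim => //.
rewrite (_ : series _ = (fun N => series (@complex.Re R \o term x y) N +i*
    series (@complex.Im R \o term x y) N)); last first.
  by apply/funext => N; exact: series_complex.
by apply: cvg_complex; [exact: cvg_Re | exact: cvg_Im].
Qed.

Lemma cdotC x y : cdot x y = (-1) ^+ false * (cdot y x)^*.
Proof.
rewrite expr0 mul1r !cdotE /=; congr (_ +i* _).
  congr (limn (series _)); apply/funext => n.
  by rewrite /term /=; case: (x n) (y n) => [a b] [a' b'] /=; ring.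
rewrite -lim_seriesN; last exact: cvg_Im.
congr (limn (series _)); apply/funext => n.
by rewrite /term /= /GRing.opp /=; case: (x n) (y n) => [a b] [a' b'] /=; ring.
Qed.

Lemma cdot_linearl y : scalar (cdot^~ y).
Proof.
move=> a x z; apply: cvg_lim => //.
rewrite (_ : series _ = (fun N => a * series (term x y) N + series (term z y) N)).
  apply: cvgD; last exact: cvg_cdot.
  by apply: cvgM; [exact: cvg_cst | exact: cvg_cdot].
apply/funext => N; elim: N => [|N IH].
  by rewrite /series /= !big_geq // mulr0 addr0.
by rewrite !seriesSr IH /term coordD coordZ; ring.
Qed.

Lemma cdot_linearr x : linear_for (@conjc R \; *%R) (cdot x).
Proof.
move=> a y z; rewrite cdotC cdot_linearl !expr0 !mul1r rmorphD rmorphM /=.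
by rewrite [cdot x y]cdotC [cdot x z]cdotC !expr0 !mul1r.
Qed.

Lemma cdot_norm x : cdot x x = `|x| ^+ 2.
Proof.
have [_ cx] := coordP x.
rewrite cspace_normE -rmorphXn /= sqr_sqrtr ?lim_sqnorms_ge0 // cdotE.
congr (_ +i* _).
  congr (limn (series _)); apply/funext => n.
  by rewrite /term /= rnorm_sqr; case: (x n) => a b /=; ring.
rewrite (_ : series _ = cst 0) ?lim_cst //; apply/funext => N.
rewrite /series /= big1 // => n _; rewrite /term.
by case: (x n) => a b /=; ring.
Qed.

Lemma cdot_gt0 x : x != 0 -> 0 < cdot x x.
Proof. by move=> x0; rewrite cdot_norm exprn_gt0 // normr_gt0. Qed.

HB.instance Definition _ := bilinear_isBilinear.Build R[i] E E R[i]
  *%R (@conjc R \; *%R) cdot (cdot_linearl, cdot_linearr).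
HB.instance Definition _ := isHermitianSesquilinear.Build R[i] E false
  (@conjc R) cdot cdotC.
HB.instance Definition _ := isDotProduct.Build R[i] E cdot cdot_gt0.

HB.instance Definition _ := isHilbert.Build R E cdot_norm.

End CspaceDot.

Section LinearGeometry.
Variables (R : realType).

Definition lspan (E : lmodType R[i]) (A : set E) : set E :=
  [set x | exists n (c : 'I_n -> R[i]) (a : 'I_n -> E),
    (forall i, A (a i)) /\ x = \sum_i c i *: a i].

Definition aff (E : lmodType R[i]) (S : set E) : set E :=
  [set x | exists l u, [/\ S l, lspan [set s - l | s in S] u & x = l + u]].

(* dim (E / M) = n, for a subspace M: the e_i are a basis modulo M. *)
Definition quotient_dim (E : lmodType R[i]) (M : set E) (n : nat) : Prop :=
  exists e : 'I_n -> E,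
    forall x, exists! c : 'rV[R[i]]_n, M (x - \sum_i c 0 i *: e i).

(* None stands for an infinite-dimensional quotient. The choice of l in aff S is
   irrelevant; quantifying universally only matters for S = set0, where the
   codimension is otherwise undefined. *)
Definition affine_codim (E : normedModType R[i]) (S : set E) (k : option nat) :=
  forall l, aff S l ->
    let M := closure [set x - l | x in aff S] in
    if k is Some n then quotient_dim M n else forall n, ~ quotient_dim M n.

Definition same_affine_codim (E : normedModType R[i]) (S T : set E) : Prop :=
  exists k, affine_codim S k /\ affine_codim T k.

End LinearGeometry.

Section ReproducingKernel.
Variables (R : realType) (X : Type).

(* A Hilbert space of functions on X (through the injection rkhs_fun) whose
   reproducing kernel is K; it is determined by K. *)
Record rkhs (K : X -> X -> R[i]) := RKHS {
  rkhs_space :> hilbertType R;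
  rkhs_fun : {linear rkhs_space -> (X -> R[i])};
  rkhs_fun_inj : injective rkhs_fun;
  rkhs_kernel : X -> rkhs_space;
  rkhs_kernelE : forall y, rkhs_fun (rkhs_kernel y) = K^~ y;
  rkhs_reproducing : forall h y, rkhs_fun h y = hdot h (rkhs_kernel y)
}.

Arguments rkhs_fun {K r}.
Arguments rkhs_kernel {K} r.

Variables (K : X -> X -> R[i]) (H : rkhs K).

(* V is the common zero set of a family of functions in H. *)
Definition variety (V : set X) : Prop :=
  exists S : set H, V = [set x | forall h, S h -> rkhs_fun h x = 0].

(* Regarded as functions on V: the restriction map to V is injective on it. *)
Definition kernel_span (V : set X) : set H :=
  closure (lspan (rkhs_kernel H @` V)).

Definition multiplier (V : set X) : set (V -> R[i]) :=
  [set f | forall h, kernel_span V h -> exists2 g, kernel_span V g &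
    forall v : V, rkhs_fun g (val v) = f v * rkhs_fun h (val v)].

Arguments multiplier V _ : clear implicits.

(* g is the image of h under the matrix of multiplication operators by the A i j,
   acting on the n-fold direct sum of kernel_span V. *)
Definition mult_graph (V : set X) n (A : 'M[V -> R[i]]_n) (h g : 'I_n -> H) :=
  [/\ forall i, kernel_span V (h i), forall i, kernel_span V (g i) &
      forall i (v : V), rkhs_fun (g i) (val v) =
        \sum_j A i j v * rkhs_fun (h j) (val v)].

Definition mult_norm (V : set X) n (A : 'M[V -> R[i]]_n) : \bar R :=
  ereal_sup [set x | exists h g, [/\ mult_graph A h g,
    \sum_j rnorm (h j) ^+ 2 <= 1 &
    x = (Num.sqrt (\sum_i rnorm (g i) ^+ 2))%:E]].

Definition algebra_isomorphism (V W : set X)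
    (phi : (V -> R[i]) -> (W -> R[i])) : Prop :=
  [/\ set_bij (multiplier V) (multiplier W) phi,
      forall (a : R[i]) f g, multiplier V f -> multiplier V g ->
        phi (a *: f + g) = a *: phi f + phi g &
      forall f g, multiplier V f -> multiplier V g ->
        phi (f * g) = phi f * phi g].

Definition completely_isometric (V W : set X)
    (phi : (V -> R[i]) -> (W -> R[i])) : Prop :=
  forall n (A : 'M[V -> R[i]]_n), (forall i j, multiplier V (A i j)) ->
    mult_norm (map_mx phi A) = mult_norm A.

End ReproducingKernel.

Arguments rkhs_fun {R X K r}.
Arguments rkhs_kernel {R X K} r.
Arguments variety {R X K} H V.
Arguments kernel_span {R X K} H V.
Arguments multiplier {R X K} H V _.
Arguments mult_graph {R X K} H {V n} A h g.
Arguments mult_norm {R X K} H {V n} A.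
Arguments algebra_isomorphism {R X K} H {V W} phi.
Arguments completely_isometric {R X K} H {V W} phi.

Section Ball.
Variables (R : realType) (d : option nat).

Record unit_ball := UnitBall { ball_pt :> cspace R d; _ : `|ball_pt| < 1 }.

HB.instance Definition _ := [isSub for ball_pt].
HB.instance Definition _ := [Choice of unit_ball by <:].

Definition da_kernel (z l : unit_ball) : R[i] :=
  (1 - hdot (z : cspace R d) (l : cspace R d))^-1.

Definition drury_arveson := rkhs da_kernel.

(* Extension by 0 outside the ball, which is open. *)
Definition ball_extension (F : unit_ball -> unit_ball) (z : cspace R d) :=
  oapp (fun b : unit_ball => ball_pt (F b)) 0 (insub z).

Definition holomorphic (F : unit_ball -> unit_ball) : Prop :=
  forall z : unit_ball, differentiable (ball_extension F) (ball_pt z).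

Definition ball_automorphism (F : unit_ball -> unit_ball) : Prop :=
  exists G : unit_ball -> unit_ball,
    [/\ cancel F G, cancel G F, holomorphic F & holomorphic G].

End Ball.

(* Main.v *)
(* Write K for the kernel on V. A function f is a contractive multiplier iff
   (1 - f f^* ) K is positive, and likewise for matrices, so phi preserves such
   positivity statements in both directions.

   The images F_i = phi(z_i) of the coordinates form a contractive row, which yields a
   map F from W to the ball (V being more than one point). After moving F(w) to 0 by an
   involution of the ball, which only rescales the kernel, a multiplier f with
   (<z,z'> - f f^* ) K >= 0 factors as f = sum_i z_i g_i with (g_i) a contractive
   column (Leech's theorem, by a lurking isometry on finite sets and an ultrafilter
   limit). This gives phi(f)(w) = 0: no weak-* continuity of phi is available, but the
   error left by the partial sums extends (F_i) to a longer contractive row, and hence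
   is phi(m) with 1 - m m^* K >= 0, so that m = 0. For F(w) = v in V it follows
   that phi(f)(w) = f(v); and F(w) lies in V because otherwise a function in H^2_d
   vanishing on V but not at F(w) would make a nonzero constant a possible f.

   So phi is composition with a bijection F : W -> V. Moving w0 and F(w0) to 0, the
   contractive coordinate rows and a Schur complement at 0 show that F preserves inner
   products. Equal codimensions (or d finite) let F extend to a unitary U: complete
   both spans by Gram-Schmidt. Then theta_{F(w0)} o U o theta_{w0} is the automorphism;
   theta_l(z) is a scalar multiple of an invertible linear map applied to z - l, hence
   the linear span of theta_l(V) has the codimension of the affine span of V. *)
From HB Require Import structures.
Require Import Defs.
From mathcomp Require Import all_boot all_order all_algebra.
From mathcomp Require Import complex.
From mathcomp Require Import all_classical all_reals all_analysis.
From mathcomp Require Import ring lra.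

Set Implicit Arguments.
Unset Strict Implicit.
Unset Printing Implicit Defensive.

Import Order.TTheory GRing.Theory Num.Theory.
Import numFieldNormedType.Exports.

Local Open Scope classical_set_scope.
Local Open Scope ring_scope.
Local Open Scope complex_scope.

(** Operators enter only where multipliers are translated into kernels. The adjoint of
    multiplication by [f] sends the kernel function at [v] to [conj (f v)] times itself, so norm
    inequalities become positivity conditions on finite families, stable under sums, Schur products,
    Schur complements and pointwise limits. A multiplier is only known to preserve [kernel_span], so
    its boundedness has to come from the uniform boundedness principle. The identity
    [K (1 - <z, w>) = 1] drives the algebra. Read as [1 = (1 - <z, w>) K], it shows that the full
    coordinate row leaves just the constant kernel 1, and that a Schur complement at a point where
    [f] vanishes and the kernel is 1 turns [1 - f conj f] into [<z, w> - f conj f]. Two obstacles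
    shape the argument. For infinite [d] the rows and columns are infinite while [phi] acts on
    finite matrices, so limits are taken among kernels. For a variety with at most one point the
    coordinates are constant and cannot produce [F]; that case is settled separately, from the fact
    that [phi] fixes constants. *)

Local Notation "x ^*" := (conjc x) : ring_scope.

(** * Complex Hilbert spaces *)

Section RealNormExtra.
Variables (R : realType) (F : normedModType R[i]).
Implicit Types x y : F.

Lemma rnorm0 : rnorm (0 : F) = 0.
Proof. by rewrite /rnorm normr0. Qed.

Lemma rnormN x : rnorm (- x) = rnorm x.
Proof. by rewrite /rnorm normrN. Qed.

Lemma rnormB x y : rnorm (x - y) = rnorm (y - x).
Proof. by rewrite -rnormN opprB. Qed.

Lemma ler_rnormB x y z : rnorm (x - z) <= rnorm (x - y) + rnorm (y - z).
Proof. apply: le_trans (ler_rnormD _ _); by rewrite addrA subrK. Qed.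

End RealNormExtra.

Section ComplexBasics.
Variables (R : realType).
Implicit Types (a b z w : R[i]).

Lemma conjcM z w : (z * w)^* = z^* * w^*.
Proof. exact: rmorphM. Qed.

Lemma conjcD z w : (z + w)^* = z^* + w^*.
Proof. exact: rmorphD. Qed.

Lemma conjcN z : (- z)^* = - z^*.
Proof. exact: rmorphN. Qed.

Lemma conjcB z w : (z - w)^* = z^* - w^*.
Proof. exact: rmorphB. Qed.

Lemma conjcV z : (z^-1)^* = (z^*)^-1.
Proof. exact: fmorphV. Qed.

Lemma conjc_sum I r (P : pred I) (F : I -> R[i]) :
  (\sum_(i <- r | P i) F i)^* = \sum_(i <- r | P i) (F i)^*.
Proof. exact: rmorph_sum. Qed.

Lemma mulcJ z : z * z^* = (rnorm z ^+ 2)%:C.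
Proof. by rewrite rmorphXn /= rnormE; case: z => a b; rewrite sqr_normc. Qed.

Lemma rnormM z w : rnorm (z * w) = rnorm z * rnorm w.
Proof. exact: rnormZ. Qed.

Lemma rnormJ z : rnorm z^* = rnorm z.
Proof. by case: z => a b; rewrite /rnorm !normc_def /= sqrrN. Qed.

Lemma rnorm_real (x : R) : rnorm (x%:C) = `|x|.
Proof. by rewrite /rnorm normc_def /= expr0n addr0 sqrtr_sqr. Qed.

Lemma rnorm1 : rnorm (1 : R[i]) = 1.
Proof. by rewrite rnorm_real normr1. Qed.

Lemma ler_Re_rnorm z : complex.Re z <= rnorm z.
Proof.
apply: le_trans (ler_norm _) _; rewrite -lecR rnormE; exact: normc_ge_Re.
Qed.

Lemma Re_real (x : R) : complex.Re (x%:C) = x. Proof. by []. Qed.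

Lemma ReM_real (x : R) z : complex.Re (x%:C * z) = x * complex.Re z.
Proof. by case: z => a b /=; rewrite mul0r subr0. Qed.

Lemma ReD z w : complex.Re (z + w) = complex.Re z + complex.Re w.
Proof. by case: z w => [? ?] [? ?]. Qed.

Lemma ReN z : complex.Re (- z) = - complex.Re z.
Proof. by case: z => [? ?]. Qed.

Lemma ReJ z : complex.Re z^* = complex.Re z.
Proof. by case: z. Qed.

(** A linear term cannot be absorbed by a quadratic one near 0: at [t = - e conj z] with
    [e = 1 / (1 + |M|)] the linear part [- 2 e |z|^2] wins. Minimality and positivity conditions are
    turned into equations this way. *)
Lemma Re_lin_ge0_eq0 z (M : R) :
  (forall t : R[i], 0 <= 2 * complex.Re (t * z) + rnorm t ^+ 2 * M) -> z = 0.
Proof.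
move=> h; apply: rnorm0_eq0; apply/eqP; rewrite eq_le rnorm_ge0 andbT leNgt.
apply/negP => z0.
have M0 : 0 <= `|M| by [].
have e0 : 0 < (1 + `|M|)^-1 by rewrite invr_gt0; lra.
have := h (- ((1 + `|M|)^-1)%:C * z^*).
rewrite -mulrA [z^* * z]mulrC mulcJ mulNr -rmorphM ReN Re_real.
rewrite !mulNr rnormN rnormM rnormJ rnorm_real (ger0_norm (ltW e0)).
set e := (1 + `|M|)^-1 in e0 *; set r := rnorm z in z0 *.
have eM : e * (1 + `|M|) = 1 by rewrite mulVf //; lra.
have := ler_norm M; have r2 : 0 < r ^+ 2 by apply: exprn_gt0.
move=> hM; have : (e * r) ^+ 2 * M <= e * r ^+ 2.
  have -> : (e * r) ^+ 2 * M = e * r ^+ 2 * (e * M) by ring.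
  rewrite -[leRHS]mulr1; apply: ler_wpM2l; first by apply: mulr_ge0; apply: ltW.
  rewrite -eM ler_pM2l //; lra.
have : 0 < e * r ^+ 2 by apply: mulr_gt0.
lra.
Qed.

End ComplexBasics.

Section InnerProduct.
Variables (R : realType) (E : hilbertType R).
Implicit Types (x y z : E) (a : R[i]).

Lemma dotC x y : hdot x y = (hdot y x)^*.
Proof. by rewrite (hermC hdot) expr0 mul1r. Qed.

Lemma dotDl x y z : hdot (x + y) z = hdot x z + hdot y z.
Proof. exact: linearDl. Qed.

Lemma dotZl a x y : hdot (a *: x) y = a * hdot x y.
Proof. exact: linearZl_LR. Qed.

Lemma dotDr x y z : hdot x (y + z) = hdot x y + hdot x z.
Proof. exact: linearDr. Qed.

Lemma dotZr a x y : hdot x (a *: y) = a^* * hdot x y.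
Proof. exact: linearZr_LR. Qed.

Lemma dotNl x y : hdot (- x) y = - hdot x y.
Proof. exact: linearNl. Qed.

Lemma dotNr x y : hdot x (- y) = - hdot x y.
Proof. exact: linearNr. Qed.

Lemma dotBl x y z : hdot (x - y) z = hdot x z - hdot y z.
Proof. by rewrite dotDl dotNl. Qed.

Lemma dotBr x y z : hdot x (y - z) = hdot x y - hdot x z.
Proof. by rewrite dotDr dotNr. Qed.

Lemma dot0l x : hdot 0 x = 0 :> R[i].
Proof. exact: linear0l. Qed.

Lemma dot0r x : hdot x 0 = 0 :> R[i].
Proof. exact: linear0r. Qed.

Lemma dot_suml I r (P : pred I) (F : I -> E) y :
  hdot (\sum_(i <- r | P i) F i) y = \sum_(i <- r | P i) hdot (F i) y.
Proof. exact: linear_sumlz. Qed.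

Lemma dot_sumr I r (P : pred I) (F : I -> E) y :
  hdot y (\sum_(i <- r | P i) F i) = \sum_(i <- r | P i) hdot y (F i).
Proof. exact: linear_sumr. Qed.

Lemma dot_rnorm x : hdot x x = (rnorm x ^+ 2)%:C.
Proof. by rewrite hdot_norm -rnormE rmorphXn. Qed.

Lemma rnorm_dot x : rnorm x ^+ 2 = complex.Re (hdot x x).
Proof. by rewrite dot_rnorm. Qed.

Lemma sqr_rnormD x y :
  rnorm (x + y) ^+ 2 = rnorm x ^+ 2 + 2 * complex.Re (hdot x y) + rnorm y ^+ 2.
Proof.
rewrite !rnorm_dot dotDl !dotDr [hdot y x]dotC !ReD ReJ; ring.
Qed.

Lemma sqr_rnormB x y :
  rnorm (x - y) ^+ 2 = rnorm x ^+ 2 - 2 * complex.Re (hdot x y) + rnorm y ^+ 2.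
Proof. rewrite sqr_rnormD dotNr ReN rnormN; ring. Qed.

Lemma parallelogram x y :
  rnorm (x + y) ^+ 2 + rnorm (x - y) ^+ 2 = 2 * (rnorm x ^+ 2 + rnorm y ^+ 2).
Proof. rewrite sqr_rnormD sqr_rnormB; ring. Qed.

Lemma cauchy_schwarz x y : rnorm (hdot x y) <= rnorm x * rnorm y.
Proof.
rewrite -(@ler_pXn2r _ 2) ?nnegrE ?mulr_ge0 ?rnorm_ge0 //.
have [->|y0] := eqVneq y 0.
  by rewrite dot0r !rnorm0 mulr0.
have ny : 0 < rnorm y.
  rewrite lt_neqAle rnorm_ge0 andbT; apply: contra y0 => /eqP h.
  by apply/eqP; exact: rnorm0_eq0.
(* The vector is [|y|^2] times the component of [x] orthogonal to [y], which avoids a division. *)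
have := sqr_ge0 (rnorm ((rnorm y ^+ 2)%:C *: x - hdot x y *: y)).
rewrite sqr_rnormB !rnormZ dotZl dotZr.
have -> : (rnorm y ^+ 2)%:C * ((hdot x y)^* * hdot x y) =
    ((rnorm y ^+ 2) * (rnorm (hdot x y) ^+ 2))%:C.
  by rewrite [_^* * _]mulrC mulcJ -rmorphM.
rewrite Re_real rnorm_real ger0_norm ?sqr_ge0 // => h.
have y2 : 0 < rnorm y ^+ 2 by apply: exprn_gt0.
rewrite -(ler_pM2l y2); nra.
Qed.

Lemma dot_ext0 x : (forall y, hdot y x = 0) -> x = 0.
Proof.
move=> h; apply: rnorm0_eq0; apply/eqP; rewrite -(@eqrXn2 _ 2) ?rnorm_ge0 //.
by rewrite rnorm_dot h expr0n.
Qed.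

End InnerProduct.

Section Convergence.
Variables (R : realType) (E : completeNormedModType R[i]).
Implicit Types (x y : E) (A : set E).

Lemma closure_rnormP A x :
  closure A x <-> forall e : R, 0 < e -> exists2 a, A a & rnorm (x - a) < e.
Proof.
split=> [cA e e0|h B].
  have /cA[a [Aa]] : nbhs x (ball x e%:C).
    by apply: nbhsx_ballx; rewrite ltcR.
  by rewrite -ball_normE /= -rnormE ltcR => xa; exists a.
move=> /nbhs_ballP[e /= e0 eB].
have eE : (complex.Re e)%:C = e by apply: ge0_ReK; exact: ltW.
have /h[a Aa xa] : 0 < complex.Re e by rewrite -ltcR eE.
exists a; split=> //; apply: eB.
by rewrite -ball_normE /= -rnormE -eE ltcR.
Qed.

Lemma sub_closure_rnorm A x : A x -> closure A x.
Proof. exact: subset_closure. Qed.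

Definition tends (u : nat -> E) x := forall e : R, 0 < e ->
  exists N, forall n, (N <= n)%N -> rnorm (x - u n) < e.

Lemma complete_rnorm (u : nat -> E) :
  (forall e : R, 0 < e -> exists N, forall m n, (N <= m)%N -> (N <= n)%N ->
     rnorm (u m - u n) < e) -> exists x, tends u x.
Proof.
move=> hu.
have : cvg (u @ \oo).
  apply: cauchy_cvg; apply/cauchyP => e e0.
  have eE : (complex.Re e)%:C = e by apply: ge0_ReK; exact: ltW.
  have /hu[N hN] : 0 < complex.Re e by rewrite -ltcR eE.
  exists (u N); exists N => // n /= Nn.
  by rewrite -ball_normE /= -rnormE -eE ltcR; apply: hN.
move=> /cvg_ex[x /cvgrPdist_lt h]; exists x => e e0.
have /h[N _ hN] : 0 < e%:C by rewrite ltcR.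
by exists N => n /hN /=; rewrite -rnormE ltcR.
Qed.

Definition subspace (S : set E) :=
  S 0 /\ forall (a : R[i]) x y, S x -> S y -> S (a *: x + y).

Lemma subspaceD S x y : subspace S -> S x -> S y -> S (x + y).
Proof. by move=> [_ h] Sx Sy; rewrite -(scale1r x); apply: h. Qed.

Lemma subspaceZ S (a : R[i]) x : subspace S -> S x -> S (a *: x).
Proof. by move=> [h0 h] Sx; rewrite -(addr0 (a *: x)); apply: h. Qed.

Lemma subspaceB S x y : subspace S -> S x -> S y -> S (x - y).
Proof.
by move=> sS Sx Sy; rewrite -scaleN1r; apply: subspaceD => //; apply: subspaceZ.
Qed.

Lemma subspace_sum S I r (P : pred I) (F : I -> E) : subspace S ->
  (forall i, P i -> S (F i)) -> S (\sum_(i <- r | P i) F i).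
Proof.
move=> sS h; elim/big_ind: _ => //; first by case: sS.
by move=> x y; exact: subspaceD.
Qed.

Lemma lspan_sub (A S : set E) : subspace S -> A `<=` S -> lspan A `<=` S.
Proof.
move=> sS AS _ [n [c [a [Aa ->]]]]; apply: subspace_sum => // i _.
by apply: subspaceZ => //; apply: AS.
Qed.

Lemma sub_lspan (A : set E) : A `<=` lspan A.
Proof.
move=> x Ax; exists 1%N, (fun=> 1), (fun=> x); split=> //.
by rewrite big_ord1 scale1r.
Qed.

Lemma lspan_finite (A : set E) (J : finType) (c : J -> R[i]) (a : J -> E) :
  (forall j, A (a j)) -> lspan A (\sum_j c j *: a j).
Proof.
move=> Aa; exists #|J|, (c \o enum_val), (a \o enum_val); split=> [i|].
  exact: Aa.
rewrite (reindex (@enum_val J predT)) //=; apply: onW_bij; exact: enum_val_bij.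
Qed.

Lemma subspace_lspan (A : set E) : subspace (lspan A).
Proof.
split; first by exists 0%N, (fun=> 0), (fun=> 0); split=> [[]//|]; rewrite big_ord0.
move=> t _ _ [n [c [a [Aa ->]]]] [m [c' [a' [Aa' ->]]]].
have := @lspan_finite A ('I_n + 'I_m)%type
  (fun k => match k with inl i => t * c i | inr i => c' i end)
  (fun k => match k with inl i => a i | inr i => a' i end).
rewrite big_sumType /= scaler_sumr.
under eq_bigr do rewrite -scalerA.
by apply=> -[].
Qed.

Lemma subspace_closure (S : set E) : subspace S -> subspace (closure S).
Proof.
move=> sS; split; first by apply: subset_closure; case: sS.
move=> t x y /closure_rnormP cx /closure_rnormP cy; apply/closure_rnormP => e e0.
have t0 : 0 < 1 + rnorm t by have := rnorm_ge0 t; lra.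
have e1 : 0 < e / 2 / (1 + rnorm t) by rewrite !divr_gt0.
have [a Sa xa] := cx _ e1.
have [b Sb yb] := cy (e / 2) ltac:(by rewrite divr_gt0).
exists (t *: a + b); first by case: sS => _; apply.
have -> : t *: x + y - (t *: a + b) = t *: (x - a) + (y - b).
  by rewrite scalerBr opprD addrACA.
apply: le_lt_trans (ler_rnormD _ _) _; rewrite rnormZ.
have : rnorm t * rnorm (x - a) <= e / 2.
  have : (1 + rnorm t) * rnorm (x - a) <= e / 2.
    by rewrite mulrC -ler_pdivlMr // ltW.
  have := rnorm_ge0 (x - a); lra.
lra.
Qed.

Lemma closure_subspace_sub (S T : set E) : S `<=` closure T -> closure S `<=` closure T.
Proof. by move=> h x /(closure_subset h); rewrite -(closure_id _).1 //; exact: closed_closure. Qed.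

End Convergence.

Section Riesz.
Variables (R : realType) (E : hilbertType R).
Implicit Types (x y : E).

(* The functional is given by its graph [P]; the representing vector minimises
   [|x|^2 - 2 Re u] over the graph. *)
Lemma riesz (P : E -> R[i] -> Prop) (M : R) :
  P 0 0 ->
  (forall a x y u v, P x u -> P y v -> P (a *: x + y) (a * u + v)) ->
  (forall x u, P x u -> rnorm u <= M * rnorm x) ->
  exists2 g, closure [set x | exists u, P x u] g &
    forall x u, P x u -> hdot x g = u.
Proof.
move=> P0 PL PM.
pose J x u : R := rnorm x ^+ 2 - 2 * complex.Re u.
pose S := [set j | exists x u, P x u /\ j = J x u].
have Sinf : has_inf S.
  split; first by exists (J 0 0), 0, 0.
  (* Since [Re u <= M |x|], the value is at least [|x|^2 - 2 M |x| >= - M^2]. *)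
  exists (- M ^+ 2) => _ [x [u [Pxu ->]]].
  have := PM _ _ Pxu; have := ler_Re_rnorm u; have := sqr_ge0 (rnorm x - M).
  rewrite /J; nra.
pose m := inf S.
have mJ x u : P x u -> m <= J x u.
  by move=> Pxu; apply: ge_inf; [case: Sinf | exists x, u].
have ex n : exists xu : E * R[i], P xu.1 xu.2 /\ J xu.1 xu.2 < m + n.+1%:R^-1.
  have n0 : 0 < n.+1%:R^-1 :> R by rewrite invr_gt0 ltr0Sn.
  have [_ [x [u [Pxu ->]]] h] := inf_adherent n0 Sinf.
  by exists (x, u).
have [s hs] := choice ex.
pose x n := (s n).1; pose u n := (s n).2.
have Ps n : P (x n) (u n) by case: (hs n).
have Js n : J (x n) (u n) < m + n.+1%:R^-1 by case: (hs n).
(* Midpoints stay in the graph, so the parallelogram law makes a minimising sequence Cauchy. *)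
have dist n k : rnorm (x n - x k) ^+ 2 <= 2 * (n.+1%:R^-1 + k.+1%:R^-1).
  have := mJ _ _ (PL (2^-1)%:C _ _ _ _ (PL 1 _ _ _ _ (Ps n) (Ps k)) P0).
  rewrite !addr0 scale1r mul1r /J rnormZ rnorm_real ReM_real ReD.
  rewrite ger0_norm ?invr_ge0 // exprMn.
  have := parallelogram (x n) (x k).
  have := Js n; have := Js k; rewrite /J.
  move: (n.+1%:R^-1) (k.+1%:R^-1) => p q; lra.
have invn (e : R) : 0 < e -> exists N, forall n, (N <= n)%N -> (n.+1%:R^-1 : R) < e.
  move=> e0; have /cvgrPdist_lt/(_ e e0) [N _ hN] := @cvg_harmonic R.
  exists N => n /hN /=; rewrite sub0r normrN ger0_norm // invr_ge0 //.
have [g hg] : exists g, tends x g.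
  apply: complete_rnorm => e e0.
  have [N hN] := invn (e ^+ 2 / 4) ltac:(by rewrite divr_gt0 ?exprn_gt0).
  exists N => a b /hN ha /hN hb.
  rewrite -(@ltr_pXn2r _ 2) ?nnegrE ?rnorm_ge0 ?(ltW e0) //.
  have := dist a b; move: (a.+1%:R^-1) (b.+1%:R^-1) ha hb => p q; lra.
exists g.
  apply/closure_rnormP => e /hg[N hN]; exists (x N); first by exists (u N).
  exact: hN.
move=> p l Pp; apply/eqP; rewrite -subr_eq0; apply/eqP.
apply: (@Re_lin_ge0_eq0 _ _ (rnorm p ^+ 2)) => t.
(* The limit [g] need not lie in the graph, so the perturbation by [t *: p] is made at [x n], at the
   cost of [n.+1%:R^-1], and the limit is taken afterwards. *)
have key n : 0 <= n.+1%:R^-1 + 2 * complex.Re (t * (hdot p (x n) - l)) +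
    rnorm t ^+ 2 * rnorm p ^+ 2.
  have := mJ _ _ (PL t _ _ _ _ Pp (Ps n)); have := Js n.
  rewrite /J [t *: p + _]addrC sqr_rnormD rnormZ exprMn [hdot (x n) _]dotC ReJ dotZl.
  rewrite mulrBr !ReD ReN; move: (n.+1%:R^-1) => q; lra.
apply/ler_addgt0Pr => e e0.
have q0 : 0 < 1 + 2 * rnorm t * rnorm p.
  by have := mulr_ge0 (rnorm_ge0 t) (rnorm_ge0 p); lra.
have [N1 h1] := invn (e / 2) ltac:(by rewrite divr_gt0).
have [N2 h2] := hg (e / 2 / (1 + 2 * rnorm t * rnorm p)) ltac:(by rewrite !divr_gt0).
pose n := maxn N1 N2.
have := key n; have := h1 n (leq_maxl _ _); have := h2 n (leq_maxr _ _).
rewrite ltr_pdivlMr // => hh2 hh1 hk.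
have : complex.Re (t * hdot p (x n)) <=
    complex.Re (t * hdot p g) + rnorm t * rnorm p * rnorm (g - x n).
  rewrite -lerBlDl -ReN -ReD -mulrBr -dotBr.
  apply: le_trans (ler_Re_rnorm _) _; rewrite rnormM -mulrA ler_wpM2l ?rnorm_ge0 //.
  by rewrite [rnorm (g - _)]rnormB; exact: cauchy_schwarz.
have := rnorm_ge0 (g - x n); move: hk; rewrite !mulrBr !ReD !ReN.
have e1 := mulr_ge0 (mulr_ge0 (rnorm_ge0 t) (rnorm_ge0 p)) (rnorm_ge0 (g - x n)).
move: (n.+1%:R^-1) hh1 => q; lra.
Qed.

Lemma projection (S : set E) h : subspace S ->
  exists2 g, closure S g & forall x, S x -> hdot x g = hdot x h.
Proof.
move=> [S0 SL].
have [|||g cg hg] := @riesz (fun x u => S x /\ u = hdot x h) (rnorm h).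
- by rewrite dot0l.
- by move=> a x y _ _ [Sx ->] [Sy ->]; rewrite dotDl dotZl; split=> //; apply: SL.
- by move=> x _ [_ ->]; rewrite mulrC cauchy_schwarz.
exists g; first by apply: closure_subset cg => x [u []].
by move=> x Sx; apply: hg.
Qed.

Lemma dot_closure0 (S : set E) y : (forall x, S x -> hdot x y = 0) ->
  forall x, closure S x -> hdot x y = 0.
Proof.
move=> h x /closure_rnormP cx; apply: rnorm0_eq0; apply/eqP.
rewrite eq_le rnorm_ge0 andbT; apply/ler_addgt0Pr => e e0; rewrite add0r.
have y0 : 0 < 1 + rnorm y by have := rnorm_ge0 y; lra.
have [a Sa xa] := cx (e / (1 + rnorm y)) ltac:(by rewrite divr_gt0).
rewrite -[hdot x y]subr0 -(h a Sa) -dotBl.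
apply: le_trans (cauchy_schwarz _ _) _; move: xa; rewrite ltr_pdivlMr // => xa.
have := rnorm_ge0 (x - a); lra.
Qed.

Lemma closure_ext0 (S : set E) y : closure S y ->
  (forall x, S x -> hdot x y = 0) -> y = 0.
Proof.
move=> cy h; apply: rnorm0_eq0; apply/eqP; rewrite -(@eqrXn2 _ 2) ?rnorm_ge0 //.
by rewrite rnorm_dot (dot_closure0 h cy) expr0n.
Qed.

Lemma closure_ext (S : set E) y z : subspace S -> closure S y -> closure S z ->
  (forall x, S x -> hdot x y = hdot x z) -> y = z.
Proof.
move=> sS cy cz h; apply/eqP; rewrite -subr_eq0; apply/eqP.
apply: (@closure_ext0 S); first by apply: (@subspaceB _ _ (closure S)) => //; apply: subspace_closure.
by move=> x Sx; rewrite dotBr h // subrr.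
Qed.

Lemma dot_lspan0 (A : set E) y : (forall x, A x -> hdot x y = 0) ->
  forall x, lspan A x -> hdot x y = 0.
Proof.
move=> h _ [n [c [a [Aa ->]]]]; rewrite dot_suml big1 // => i _.
by rewrite dotZl h // mulr0.
Qed.

Lemma projection_rest (A : set E) h : exists2 g, closure (lspan A) g &
  forall x, A x -> hdot x (h - g) = 0.
Proof.
have [g cg hg] := projection h (subspace_lspan A); exists g => // x Ax.
by rewrite dotBr hg ?subrr //; apply: sub_lspan.
Qed.

End Riesz.

(** * Positive kernels and multipliers *)

Section PositiveKernels.
Variable (R : realType).
Local Notation C := R[i].

(** With an arbitrary finite index type and repetitions of points allowed, points can be adjoined
    ([J + 'I_1]) and index sets multiplied ([J * 'I_n]) freely. *)
Definition psd (X : Type) (L : X -> X -> C) : Prop :=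
  forall (J : finType) (x : J -> X) (c : J -> C),
    0 <= \sum_j \sum_k c j * (c k)^* * L (x j) (x k).

Lemma ge0_complexP (z : C) : 0 <= z <-> complex.Im z = 0 /\ 0 <= complex.Re z.
Proof.
case: z => a b; rewrite lecE /=; split; first by move=> /andP[/eqP-> ->].
by move=> [-> ->]; rewrite eqxx.
Qed.

Lemma eq_psd X (L L' : X -> X -> C) : (forall x y, L x y = L' x y) ->
  psd L -> psd L'.
Proof.
move=> e h J x c; under eq_bigr do under eq_bigr do rewrite -e; exact: h.
Qed.

Lemma psd_comp X Y (h : Y -> X) (L : X -> X -> C) : psd L ->
  psd (fun x y => L (h x) (h y)).
Proof. by move=> pL J x c; exact: (pL J (h \o x)). Qed.

Lemma psdD X (L L' : X -> X -> C) : psd L -> psd L' ->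
  psd (fun x y => L x y + L' x y).
Proof.
move=> h h' J x c.
under eq_bigr do (under eq_bigr do rewrite mulrDr; rewrite big_split /=).
by rewrite big_split addr_ge0 ?h ?h'.
Qed.

Lemma psd_congr X (a : X -> C) (L : X -> X -> C) : psd L ->
  psd (fun x y => a x * (a y)^* * L x y).
Proof.
move=> h J x c; have := h J x (fun j => c j * a (x j)); congr (_ <= _).
apply: eq_bigr => j _; apply: eq_bigr => k _; rewrite conjcM; ring.
Qed.

Lemma psdZ X (t : C) (L : X -> X -> C) : 0 <= t -> psd L ->
  psd (fun x y => t * L x y).
Proof.
move=> t0 h J x c.
under eq_bigr do under eq_bigr do rewrite mulrCA.
by under eq_bigr do rewrite -mulr_sumr; rewrite -mulr_sumr mulr_ge0.
Qed.

Lemma psd_sum X I (r : seq I) (L : I -> X -> X -> C) :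
  (forall i, psd (L i)) -> psd (fun x y => \sum_(i <- r) L i x y).
Proof.
move=> h; elim: r => [|i r IH].
  move=> J x c; rewrite big1 // => j _; rewrite big1 // => k _.
  by rewrite big_nil mulr0.
by apply: eq_psd (psdD (h i) IH) => x y; rewrite big_cons.
Qed.

Lemma psd_gram X (E : hilbertType R) (p : X -> E) :
  psd (fun x y => hdot (p x) (p y)).
Proof.
move=> J x c.
have -> : \sum_j \sum_k c j * (c k)^* * hdot (p (x j)) (p (x k)) =
    hdot (\sum_j c j *: p (x j)) (\sum_j c j *: p (x j)).
  rewrite dot_suml; apply: eq_bigr => j _; rewrite dot_sumr; apply: eq_bigr => k _.
  by rewrite dotZl dotZr mulrA.
by rewrite dot_rnorm lecR sqr_ge0.
Qed.

Lemma psd_gramC X (E : hilbertType R) (p : X -> E) :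
  psd (fun x y => hdot (p y) (p x)).
Proof.
move=> J x c.
have -> : \sum_j \sum_k c j * (c k)^* * hdot (p (x k)) (p (x j)) =
    hdot (\sum_j (c j)^* *: p (x j)) (\sum_j (c j)^* *: p (x j)).
  rewrite dot_suml exchange_big; apply: eq_bigr => j _.
  rewrite dot_sumr; apply: eq_bigr => k _.
  by rewrite dotZl dotZr conjcK mulrA [(c j)^* * _]mulrC.
by rewrite dot_rnorm lecR sqr_ge0.
Qed.

Lemma psd_rank1 X (a : X -> C) : psd (fun x y => a x * (a y)^*).
Proof.
move=> J x c; have -> : \sum_j \sum_k c j * (c k)^* * (a (x j) * (a (x k))^*) =
   (\sum_j c j * a (x j)) * (\sum_j c j * a (x j))^*.
  rewrite mulr_suml; apply: eq_bigr => j _; rewrite conjc_sum mulr_sumr.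
  by apply: eq_bigr => k _; rewrite [in RHS]conjcM; ring.
by rewrite mulcJ lecR sqr_ge0.
Qed.

Lemma psd_diag_ge0 X (L : X -> X -> C) x : psd L -> 0 <= L x x.
Proof.
move=> h; have := h 'I_1 (fun=> x) (fun=> 1).
by rewrite !big_ord1 conjc1 !mul1r.
Qed.

Lemma psd2 X (L : X -> X -> C) x y (s t : C) : psd L ->
  0 <= s * s^* * L x x + s * t^* * L x y + t * s^* * L y x + t * t^* * L y y.
Proof.
move=> h; have := h bool (fun b => if b then x else y) (fun b => if b then s else t).
by rewrite !big_bool /= !addrA.
Qed.

(** Over the complex numbers positivity forces symmetry: the coefficients [(1, 1)] and [(1, i)] give
    the two equations, as both forms and the diagonal entries are real. *)
Lemma psd_herm X (L : X -> X -> C) x y : psd L -> L x y = (L y x)^*.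
Proof.
move=> h; have := psd2 x y 1 1 h; have := psd2 x y 1 'i h.
have := psd_diag_ge0 x h; have := psd_diag_ge0 y h.
move: (L x x) (L y y) (L x y) (L y x) => [a a'] [b b'] [u u'] [v v'].
move=> /ge0_complexP/= [hb _] /ge0_complexP/= [ha _].
move=> /ge0_complexP/= [h1 _] /ge0_complexP/= [h2 _].
by congr (_ +i* _); lra.
Qed.

(** On the pair [x, y] with coefficients [1, conj t] the form is linear plus quadratic in [t], so
    [Re_lin_ge0_eq0] applies. This is the equality case behind the rigidity arguments below. *)
Lemma psd_diag0 X (L : X -> X -> C) x y : psd L -> L x x = 0 -> L x y = 0.
Proof.
move=> h x0; have yr := psd_diag_ge0 y h.
apply: (@Re_lin_ge0_eq0 _ _ (complex.Re (L y y))) => t.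
have := psd2 x y 1 t^* h; rewrite x0 (psd_herm y x h).
move: yr; move: (L x y) (L y y) t => [u u'] [b b'] [s s'].
move=> /ge0_complexP/= [-> _] /ge0_complexP/= [_].
by rewrite rnorm_sqr /=; lra.
Qed.

(** Completing the square: adjoining [x0] with the minimising coefficient [- S / L x0 x0] turns the
    form of [L] into that of the Schur complement. *)
Lemma psd_schur X (L : X -> X -> C) x0 : psd L -> L x0 x0 != 0 ->
  psd (fun x y => L x y - L x x0 * L x0 y / L x0 x0).
Proof.
move=> h n0 J x c.
pose S := \sum_j c j * L (x j) x0.
pose t := - S / L x0 x0.
have := h (J + 'I_1)%type (fun k => if k is inl j then x j else x0)
  (fun k => if k is inl j then c j else t).
rewrite big_sumType /= big_ord1 /=.
under eq_bigr do rewrite big_sumType /= big_ord1 /=.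
rewrite big_split big_sumType /= big_ord1 /=.
have L0 : (L x0 x0)^* = L x0 x0 by rewrite -psd_herm.
have -> : \sum_i c i * t^* * L (x i) x0 = t^* * S.
  by rewrite mulr_sumr; apply: eq_bigr => i _; ring.
have -> : \sum_i t * (c i)^* * L x0 (x i) = t * S^*.
  rewrite conjc_sum mulr_sumr; apply: eq_bigr => i _.
  by rewrite conjcM (psd_herm x0) //; ring.
have -> : \sum_j \sum_k c j * (c k)^* * (L (x j) (x k) - L (x j) x0 * L x0 (x k) / L x0 x0)
   = \sum_j \sum_k c j * (c k)^* * L (x j) (x k) - S * S^* / L x0 x0.
  rewrite /S conjc_sum mulr_suml mulr_suml -sumrB; apply: eq_bigr => j _.
  rewrite mulr_sumr mulr_suml -sumrB; apply: eq_bigr => k _.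
  by rewrite [(c k * _)^*]conjcM -psd_herm //; ring.
congr (_ <= _); rewrite -addrA; congr (_ + _).
rewrite /t; have -> : (- S / L x0 x0)^* = - S^* / L x0 x0.
  by rewrite conjcM conjcV L0 rmorphN.
by field.
Qed.

(** Cholesky elimination. A point whose pivot in the residual is 0 has a null row by [psd_diag0];
    otherwise the residual column divided by the root of the pivot is a new factor, and [psd_schur]
    keeps the residual positive. *)
Lemma psd_factor_seq (J : choiceType) (L : J -> J -> C) (s : seq J) : psd L ->
  exists m (g : 'I_m -> J -> C),
    psd (fun j k => L j k - \sum_a g a j * (g a k)^*) /\
    forall j k, j \in s -> L j k = \sum_a g a j * (g a k)^*.
Proof.
move=> pL; elim: s => [|j0 s [m [g [pg g0]]]].
  exists 0%N, (fun=> fun=> 0); split=> //.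
  by apply: eq_psd pL => j k; rewrite big_ord0 subr0.
pose M j k := L j k - \sum_a g a j * (g a k)^*.
have [M0|M0] := eqVneq (M j0 j0) 0.
  exists m, g; split=> // j k; rewrite inE => /orP[/eqP->|/g0//].
  by apply/eqP; rewrite -subr_eq0; apply/eqP; exact: (psd_diag0 k pg M0).
have Mge : 0 <= M j0 j0 by exact: (psd_diag_ge0 j0 pg).
have [r r0 rM] : exists2 r : R, 0 < r & M j0 j0 = (r ^+ 2)%:C.
  move: Mge M0; case: (M j0 j0) => a b; rewrite lecE /= => /andP[/eqP-> a0] n0.
  have a1 : 0 < a by rewrite lt_neqAle a0 andbT eq_sym; apply: contra n0 => /eqP->.
  by exists (Num.sqrt a); rewrite ?sqrtr_gt0 // sqr_sqrtr.
pose u j := M j j0 / r%:C.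
exists m.+1, (fun a => if unlift ord0 a is Some b then g b else u).
have E j k : \sum_(a < m.+1) (if unlift ord0 a is Some b then g b else u) j *
    ((if unlift ord0 a is Some b then g b else u) k)^* =
    M j j0 * M j0 k / M j0 j0 + \sum_a g a j * (g a k)^*.
  rewrite big_ord_recl unlift_none; congr (_ + _).
    have aux (x y z : C) : y^* = z -> x / r%:C * (y / r%:C)^* = x * z / (r ^+ 2)%:C.
      move=> <-; rewrite conjcM conjcV conjc_real rmorphXn /=.
      by have r1 : r%:C != 0; [rewrite fmorph_eq0 gt_eqF | field].
    by rewrite rM; apply: aux; apply/esym; exact: (psd_herm j0 k pg).
  by apply: eq_bigr => a _; rewrite liftK.
split.
  by apply: eq_psd (psd_schur pg M0) => j k; rewrite E /M; ring.
move=> j k; rewrite E inE => /orP[/eqP->|js].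
  by rewrite [_ * M j0 k]mulrC mulfK // /M subrK.
have -> : M j j0 = 0 by rewrite /M (g0 j) // subrr.
by rewrite !mul0r add0r g0.
Qed.

Lemma psd_factor (J : finType) (L : J -> J -> C) : psd L ->
  exists m (g : 'I_m -> J -> C), forall j k, L j k = \sum_a g a j * (g a k)^*.
Proof.
move=> /(psd_factor_seq (enum J))[m [g [_ h]]]; exists m, g => j k.
by apply: h; rewrite mem_enum.
Qed.

(** Schur product theorem: on finitely many points [L] is a sum of rank-one kernels, so the product
    is a sum of congruences of [L']. *)
Lemma psdM X (L L' : X -> X -> C) : psd L -> psd L' ->
  psd (fun x y => L x y * L' x y).
Proof.
move=> h h' J x c.
have [m [g hg]] := psd_factor (psd_comp x h).
have := @psd_sum J 'I_m (index_enum _)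
   (fun a j k => g a j * (g a k)^* * L' (x j) (x k)) _ J id c.
move=> /(_ (fun a => psd_congr (g a) (psd_comp x h'))); congr (_ <= _).
apply: eq_bigr => j _; apply: eq_bigr => k _; congr (_ * _).
by rewrite hg mulr_suml.
Qed.

End PositiveKernels.

(** * The uniform boundedness principle *)

Section UniformBoundedness.
Variables (R : realType) (E : hilbertType R).

(* Gliding hump. *)
Lemma uniform_boundedness (S T : set E) : subspace S -> T `<=` closure S ->
  (forall h, closure S h -> exists M : R, forall t, T t -> rnorm (hdot h t) <= M) ->
  exists M : R, forall t, T t -> rnorm t <= M.
Proof.
move=> sS TS hT; apply: contrapT => nb.
(* After weighting by [q n = 3 ^- n] this leaves more than [2 n], of which later steps can destroy
   at most half. *)
have big n : exists t, T t /\ 2 * n%:R * 3 ^+ n < rnorm t.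
  apply: contrapT => nt; apply: nb; exists (2 * n%:R * 3 ^+ n) => t Tt.
  by rewrite leNgt; apply/negP => lt; apply: nt; exists t.
have [t ht] := choice big.
have t0 n : 0 < rnorm (t n).
  by case: (ht n) => _; apply: le_lt_trans; rewrite !mulr_ge0 ?exprn_ge0.
pose q n : R := (3 ^+ n)^-1.
have q0 n : 0 < q n by rewrite invr_gt0 exprn_gt0.
have qS n : q n.+1 = q n / 3 by rewrite /q exprS invfM mulrC.
pose w n : E := (q n / rnorm (t n))%:C *: t n.
have wn n : rnorm (w n) = q n.
  by rewrite rnormZ rnorm_real ger0_norm ?divr_ge0 ?ltW // divfK ?gt_eqF.
have wt n : rnorm (hdot (w n) (t n)) = q n * rnorm (t n).
  rewrite dotZl dot_rnorm -rmorphM rnorm_real ger0_norm.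
    by rewrite expr2 mulrA divfK ?gt_eqF.
  by rewrite mulr_ge0 ?divr_ge0 ?sqr_ge0 ?ltW.
(* The pairings of [h + w n] and [h - w n] with [t n] differ by [2 q n |t n|] in modulus, so one of
   them has modulus at least [q n |t n|]. *)
pose step n h := if `[< q n * rnorm (t n) <= rnorm (hdot (h + w n) (t n)) >]
  then h + w n else h - w n.
have stepP n h : q n * rnorm (t n) <= rnorm (hdot (step n h) (t n)) /\
    rnorm (step n h - h) <= q n.
  rewrite /step; case: asboolP => [le|/negP].
    by split=> //; rewrite addrAC subrr add0r wn.
  rewrite -ltNge => lt; split; last by rewrite addrAC subrr add0r rnormN wn.
  have : rnorm (hdot (h + w n) (t n) + - hdot (h - w n) (t n)) =
      2 * (q n * rnorm (t n)).
    rewrite -dotBl opprB addrC addrA subrK -mulr2n -scaler_nat dotZl.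
    by rewrite rnormM wt -(rmorph_nat (real_complex R)) rnorm_real ger0_norm.
  have := ler_rnormD (hdot (h + w n) (t n)) (- hdot (h - w n) (t n)).
  rewrite rnormN; lra.
pose h := fix h n := if n is m.+1 then step m (h m) else 0.
have clS : subspace (closure S) by apply: subspace_closure.
have hS n : closure S (h n).
  elim: n => [|n IH] /=; first by case: clS.
  have wS : closure S (w n) by apply: (@subspaceZ _ _ (closure S)) => //; apply: TS; case: (ht n).
  by rewrite /step; case: asboolP => _; [apply: (@subspaceD _ _ (closure S))|apply: (@subspaceB _ _ (closure S))].
have tail n k : rnorm (h (n + k)%N - h n) <= 3 / 2 * (q n - q (n + k)%N).
  elim: k => [|k IH]; first by rewrite addn0 !subrr rnorm0 mulr0.
  rewrite addnS; apply: le_trans (ler_rnormB _ (h (n + k)%N) _) _.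
  have [_] := stepP (n + k)%N (h (n + k)%N).
  rewrite -[step _ _]/(h (n + k).+1) qS; lra.
have tailn n m : (n <= m)%N -> rnorm (h m - h n) <= 3 / 2 * q n.
  by move=> /subnKC <-; have := tail n (m - n)%N; have := q0 (n + (m - n))%N; lra.
have qlim (e : R) : 0 < e -> exists N, q N < e.
  move=> e0; have := @cvg_geometric R 1 3^-1.
  rewrite ger0_norm ?invr_ge0 // invf_lt1 // => /(_ ltac:(lra)).
  move=> /cvgrPdist_lt/(_ e e0)[N _ /(_ N (leqnn N))] /=.
  rewrite sub0r normrN mul1r exprVn -/(q N) => lt; exists N.
  exact: le_lt_trans (ler_norm _) lt.
have [g hg] : exists g, tends h g.
  apply: complete_rnorm => e e0.
  have [N hN] := qlim (e / 3) ltac:(by rewrite divr_gt0).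
  exists N => a b ha hb; apply: le_lt_trans (ler_rnormB _ (h N) _) _.
  by have := tailn _ _ ha; have := tailn _ _ hb; rewrite [rnorm (h N - _)]rnormB; lra.
have gS : closure S g.
  have -> : closure S = closure (closure S).
    by apply/closure_id; exact: closed_closure.
  by apply/closure_rnormP => e /hg[N hN]; exists (h N) => //; apply: hN.
(* All later displacements add up to at most [q n.+1 + q n.+2 + ... = q n / 2]. *)
have gn n : rnorm (g - h n.+1) <= q n / 2.
  apply/ler_addgt0Pr => e /hg[N hN].
  have := hN (maxn N n.+1) (leq_maxl _ _).
  have := tailn n.+1 (maxn N n.+1) (leq_maxr _ _).
  have := ler_rnormB g (h (maxn N n.+1)) (h n.+1).
  rewrite qS; lra.
have [M hM] := hT g gS.
pose n := Num.bound M; have Mn : M < n%:R.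
  by apply: le_lt_trans (ler_norm M) _; have := archi_boundP (normr_ge0 M);
     rewrite /n /Num.bound normr_id.
have [Tn tn] := ht n.
have := hM _ Tn.
have [] := stepP n (h n); rewrite -[step _ _]/(h n.+1) => lo _.
have := cauchy_schwarz (g - h n.+1) (t n).
have := ler_wpM2r (ltW (t0 n)) (gn n).
have := ler_rnormB (hdot (h n.+1) (t n)) (hdot (h n.+1) (t n) - hdot g (t n)) 0.
rewrite !subr0 subKr -dotBl [rnorm (hdot (h n.+1 - _) _)](_ : _ = rnorm (hdot (g - h n.+1) (t n))); last first.
  by rewrite -rnormN -dotNl opprB.
have : n%:R < q n * rnorm (t n) / 2.
  have q3 : q n * 3 ^+ n = 1 by rewrite mulVf // expf_neq0.
  have := tn; rewrite -(ltr_pM2l (q0 n)) mulrCA q3; lra.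
lra.
Qed.

End UniformBoundedness.

(** * Multipliers and their matrix norms as positivity of kernels *)

Section Multipliers.
Variables (R : realType).
Local Notation C := R[i].

(* [(1 - A A^* ) k >= 0], i.e. the multiplication operator of [A] is a contraction. *)
Definition contr (X : Type) (k : X -> X -> C) n (A : 'M[X -> C]_n) : Prop :=
  psd (fun p q : X * 'I_n =>
    ((p.2 == q.2)%:R - \sum_c A p.2 c p.1 * (A q.2 c q.1)^*) * k p.1 q.1).

(** The kernel form of: multiplication by [f] has norm at most [|M|]. *)
Definition bdd (X : Type) (k : X -> X -> C) (f : X -> C) : Prop :=
  exists M : R, psd (fun x y => ((M ^+ 2)%:C - f x * (f y)^*) * k x y).

Variables (X : Type) (K : X -> X -> C) (H : rkhs K).

Lemma kernel_dot x y : K x y = hdot (rkhs_kernel H y) (rkhs_kernel H x).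
Proof. by rewrite -rkhs_reproducing rkhs_kernelE. Qed.

Lemma psd_kernel : psd K.
Proof.
by apply: eq_psd (psd_gramC (rkhs_kernel H)) => x y; rewrite -kernel_dot.
Qed.

Variable (V : set X).
Local Notation kV := (fun v w : V => K (val v) (val w)).
Local Notation k := (fun v : V => rkhs_kernel H (val v)).

Lemma kernel_span_subspace : subspace (kernel_span H V).
Proof. by apply: subspace_closure; apply: subspace_lspan. Qed.

Lemma lspan_kernel (J : finType) (v : J -> V) (c : J -> C) :
  lspan (rkhs_kernel H @` V) (\sum_j c j *: k (v j)).
Proof.
apply: (@lspan_finite _ _ _ _ c (fun j => k (v j))) => j.
by exists (val (v j)) => //; apply: set_valP.
Qed.

Lemma lspan_kernelP x : lspan (rkhs_kernel H @` V) x ->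
  exists n (v : 'I_n -> V) (c : 'I_n -> C), x = \sum_j c j *: k (v j).
Proof.
move=> [n [c [a [ha ->]]]].
have /choice[v hv] : forall i, exists v : V, k v = a i.
  by move=> i; have [y Vy <-] := ha i; exists (SigSub (mem_set Vy)).
by exists n, v, c; apply: eq_bigr => j _; rewrite -hv.
Qed.

Lemma kernel_span_eq (g h : H) : kernel_span H V g -> kernel_span H V h ->
  (forall v : V, rkhs_fun g (val v) = rkhs_fun h (val v)) -> g = h.
Proof.
move=> cg ch e; apply: (closure_ext (subspace_lspan _) cg ch) => x.
move=> /lspan_kernelP[n [v [c ->]]]; rewrite !dot_suml; apply: eq_bigr => j _.
by rewrite !dotZl dotC -rkhs_reproducing e rkhs_reproducing -dotC.
Qed.

(** Positivity bounds the adjoint, defined on combinations of kernel functions, by [|M|]. Then [f h]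
    is the Riesz representative of [x |-> <adjoint x, h>]; as [riesz] accepts a graph, the adjoint
    need not first be shown independent of the chosen combination. *)
Lemma bdd_multiplier (f : V -> C) : bdd kV f -> multiplier H V f.
Proof.
move=> [M hM] h ch.
have nx (J : finType) (v : J -> V) (t : J -> C) :
    rnorm (\sum_l (t l * (f (v l))^*) *: k (v l)) <=
    `|M| * rnorm (\sum_l t l *: k (v l)).
  rewrite -(@ler_pXn2r _ 2) ?nnegrE ?mulr_ge0 ?rnorm_ge0 // exprMn real_normK ?num_real //.
  have := hM J v (fun j => (t j)^*).
  have -> : \sum_j \sum_l (t j)^* * ((t l)^*)^* *
      (((M ^+ 2)%:C - f (v j) * (f (v l))^*) * kV (v j) (v l)) =
      (M ^+ 2)%:C * hdot (\sum_l t l *: k (v l)) (\sum_l t l *: k (v l)) -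
      hdot (\sum_l (t l * (f (v l))^*) *: k (v l)) (\sum_l (t l * (f (v l))^*) *: k (v l)).
    rewrite !dot_suml mulr_sumr -sumrB exchange_big; apply: eq_bigr => j _.
    rewrite !dot_sumr mulr_sumr -sumrB; apply: eq_bigr => l _.
    rewrite !dotZl !dotZr conjcM !conjcK -kernel_dot; ring.
  by rewrite !dot_rnorm -rmorphM -rmorphB /= lecR subr_ge0.
pose P (x : H) (a : C) := exists (J : finType) (v : J -> V) (t : J -> C),
  x = \sum_l t l *: k (v l) /\ a = hdot (\sum_l (t l * (f (v l))^*) *: k (v l)) h.
have [|||g cg hg] := @riesz _ _ P (`|M| * rnorm h).
- exists void, (of_void V), (of_void C).
  by rewrite !big1 ?dot0l // => -[].
- move=> a _ _ _ _ [J [v [t [-> ->]]]] [J' [v' [t' [-> ->]]]].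
  exists (J + J')%type, (fun i => match i with inl j => v j | inr j => v' j end),
    (fun i => match i with inl j => a * t j | inr j => t' j end).
  rewrite !big_sumType /= dotDl scaler_sumr -dotZl scaler_sumr.
  by split; congr (_ + _); [|congr (hdot _ h)]; apply: eq_bigr => i _; rewrite scalerA ?mulrA.
- move=> _ _ [n [v [t [-> ->]]]]; apply: le_trans (cauchy_schwarz _ _) _.
  by rewrite mulrAC ler_wpM2r ?rnorm_ge0.
exists g.
  apply: closure_subset cg => x [a [n [v [t [-> _]]]]]; exact: lspan_kernel.
move=> v; rewrite !rkhs_reproducing dotC.
rewrite (hg _ (hdot ((f v)^* *: k v) h)).
  by rewrite dotZl conjcM conjcK -dotC.
by exists 'I_1, (fun=> v), (fun=> 1); rewrite !big_ord1 scale1r mul1r.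
Qed.

(** [T] is the image under the adjoint of the unit ball of finite combinations. It is weakly
    bounded, since pairing with [h] amounts to pairing [f h] with a vector of norm at most 1;
    uniform boundedness then yields [M]. *)
Lemma multiplier_bdd (f : V -> C) : multiplier H V f -> bdd kV f.
Proof.
move=> mf.
pose T := [set y : H | exists (J : finType) (v : J -> V) (t : J -> C),
  rnorm (\sum_l t l *: k (v l)) <= 1 /\ y = \sum_l (t l * (f (v l))^*) *: k (v l)].
have adj (h g : H) (J : finType) (v : J -> V) (t : J -> C) :
    (forall v : V, rkhs_fun g (val v) = f v * rkhs_fun h (val v)) ->
    hdot h (\sum_l (t l * (f (v l))^*) *: k (v l)) = hdot g (\sum_l t l *: k (v l)).
  move=> e; rewrite !dot_sumr; apply: eq_bigr => l _.
  by rewrite !dotZr -!rkhs_reproducing e conjcM conjcK mulrA.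
have [||h ch|M hM] := @uniform_boundedness R H (lspan (rkhs_kernel H @` V)) T.
- exact: subspace_lspan.
- by move=> _ [n [v [t [_ ->]]]]; apply: subset_closure; apply: lspan_kernel.
- have [g cg hg] := mf h ch; exists (rnorm g) => _ [n [v [t [le1 ->]]]].
  rewrite (adj _ _ _ _ _ hg); apply: le_trans (cauchy_schwarz _ _) _.
  by rewrite ler_piMr ?rnorm_ge0.
have M0 : 0 <= M.
  apply: le_trans (hM 0 _); first exact: rnorm_ge0.
  by exists void, (of_void V), (of_void C); rewrite !big1 ?rnorm0 // => -[].
have key (J : finType) (v : J -> V) (t : J -> C) :
    rnorm (\sum_l (t l * (f (v l))^*) *: k (v l)) <= M * rnorm (\sum_l t l *: k (v l)).
  set x := \sum_l t l *: _; set y := \sum_l _.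
  (* Normalisation is impossible for [x = 0]; there [<y, y> = <f y, x> = 0] by [adj]. *)
  have [x0|xn0] := eqVneq (rnorm x) 0.
    rewrite x0 mulr0; suff -> : y = 0 by rewrite rnorm0.
    have cy : closure (lspan (rkhs_kernel H @` V)) y.
      by apply: subset_closure; apply: lspan_kernel.
    have [g cg hg] := mf y cy.
    apply: rnorm0_eq0; apply/eqP; rewrite -(@eqrXn2 _ 2) ?rnorm_ge0 //.
    by rewrite rnorm_dot (adj _ _ _ _ _ hg) -/x (rnorm0_eq0 x0) dot0r expr0n.
  have xp : 0 < rnorm x by rewrite lt_neqAle eq_sym xn0 rnorm_ge0.
  have Tx : T ((rnorm x)^-1%:C *: y).
    exists J, v, (fun l => (rnorm x)^-1%:C * t l); split.
      under eq_bigr do rewrite -scalerA.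
      by rewrite -scaler_sumr -/x rnormZ rnorm_real ger0_norm ?invr_ge0 ?rnorm_ge0 // mulVf.
    by rewrite scaler_sumr; apply: eq_bigr => l _; rewrite scalerA mulrA.
  have := hM _ Tx; rewrite rnormZ rnorm_real ger0_norm ?invr_ge0 ?rnorm_ge0 // mulrC.
  by rewrite ler_pdivrMr.
exists M => J x c.
have := key J x (fun j => (c j)^*).
rewrite -(@ler_pXn2r _ 2) ?nnegrE ?mulr_ge0 ?rnorm_ge0 // exprMn -subr_ge0 -lecR.
rewrite rmorphB rmorphM /= -!dot_rnorm; congr (_ <= _).
rewrite !dot_suml mulr_sumr -sumrB [RHS]exchange_big; apply: eq_bigr => j _.
rewrite !dot_sumr mulr_sumr -sumrB; apply: eq_bigr => l _.
rewrite !dotZl !dotZr conjcM !conjcK -kernel_dot; ring.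
Qed.

End Multipliers.

Section MultiplierNorm.
Variables (R : realType) (X : Type) (K : X -> X -> R[i]) (H : rkhs K) (V : set X).
Local Notation C := R[i].
Local Notation kV := (fun v w : V => K (val v) (val w)).
Local Notation k := (fun v : V => rkhs_kernel H (val v)).

Lemma Re_sum I r (P : pred I) (F : I -> C) :
  complex.Re (\sum_(i <- r | P i) F i) = \sum_(i <- r | P i) complex.Re (F i).
Proof. by elim/big_rec2: _ => // i x y _ <-; rewrite ReD. Qed.

Lemma sum_delta (I : finType) (a b : I) :
  \sum_i (a == i)%:R * (b == i)%:R = (a == b)%:R :> C.
Proof.
rewrite (bigD1 a) //= eqxx mul1r big1 => [|i ia].
  by rewrite addr0 eq_sym.
by rewrite eq_sym (negbTE ia) mul0r.
Qed.

Section Forms.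
Variables (n : nat) (A : 'M[V -> C]_n) (J : finType) (x : J -> V * 'I_n) (c : J -> C).

(** [y] is the vector of the [n]-fold sum encoded by the coefficients [c], and [z] below is its
    image under the adjoint of multiplication by [A]. *)
Let y i : H := \sum_j ((x j).2 == i)%:R * (c j)^* *: k (x j).1.
Let z b : H := \sum_j (c j)^* * (A (x j).2 b (x j).1)^* *: k (x j).1.

Lemma contr_form : \sum_j \sum_l c j * (c l)^* *
    ((((x j).2 == (x l).2)%:R - \sum_b A (x j).2 b (x j).1 * (A (x l).2 b (x l).1)^*)
      * kV (x j).1 (x l).1) =
  (\sum_i rnorm (y i) ^+ 2 - \sum_b rnorm (z b) ^+ 2)%:C.
Proof.
rewrite rmorphB !rmorph_sum /=.
under [X in _ = X - _]eq_bigr do rewrite -dot_rnorm /y dot_suml.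
under [X in _ = _ - X]eq_bigr do rewrite -dot_rnorm /z dot_suml.
rewrite [X in _ = X - _]exchange_big [X in _ = _ - X]exchange_big -sumrB /=.
rewrite exchange_big; apply: eq_bigr => l _.
under [X in _ = X - _]eq_bigr do rewrite dot_sumr.
under [X in _ = _ - X]eq_bigr do rewrite dot_sumr.
rewrite [X in _ = X - _]exchange_big [X in _ = _ - X]exchange_big -sumrB /=.
apply: eq_bigr => j _.
have -> : \sum_i hdot (((x l).2 == i)%:R * (c l)^* *: k (x l).1)
    (((x j).2 == i)%:R * (c j)^* *: k (x j).1) =
    c j * (c l)^* * ((x j).2 == (x l).2)%:R * kV (x j).1 (x l).1.
  rewrite eq_sym -sum_delta mulr_sumr mulr_suml; apply: eq_bigr => i _.
  by rewrite dotZl dotZr !conjcM conjcK -kernel_dot conjc_nat; ring.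
have -> : \sum_i hdot ((c l)^* * (A (x l).2 i (x l).1)^* *: k (x l).1)
    ((c j)^* * (A (x j).2 i (x j).1)^* *: k (x j).1) =
    c j * (c l)^* * (\sum_b A (x j).2 b (x j).1 * (A (x l).2 b (x l).1)^*) *
    kV (x j).1 (x l).1.
  rewrite mulr_sumr mulr_suml; apply: eq_bigr => i _.
  by rewrite dotZl dotZr !conjcM !conjcK -kernel_dot; ring.
ring.
Qed.

Lemma graph_form (h g : 'I_n -> H) : mult_graph H A h g ->
  \sum_i hdot (g i) (y i) = \sum_b hdot (h b) (z b).
Proof.
case=> _ _ hg.
rewrite /y /z; under eq_bigr do rewrite dot_sumr.
under [RHS]eq_bigr do rewrite dot_sumr.
rewrite exchange_big [RHS]exchange_big /=; apply: eq_bigr => j _.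
rewrite (bigD1 (x j).2) //= big1 => [|i ij]; last first.
  by rewrite eq_sym (negbTE ij) mul0r scale0r dot0r.
rewrite addr0 eqxx mul1r dotZr conjcK -rkhs_reproducing hg mulr_sumr.
apply: eq_bigr => b _; rewrite dotZr conjcM !conjcK -rkhs_reproducing; ring.
Qed.

End Forms.

(** For a combination [y] of kernel functions close to [g], with [z] its image under the adjoint,
    [|g|^2] is nearly [2 Re <g, y> - |y|^2 = 2 Re <h, z> - |y|^2], at most [|h|^2 + |z|^2 - |y|^2];
    contractivity gives [|z| <= |y|]. *)
Lemma contr_graph_le n (A : 'M[V -> C]_n) h g : contr kV A -> mult_graph H A h g ->
  \sum_i rnorm (g i) ^+ 2 <= \sum_i rnorm (h i) ^+ 2.
Proof.
move=> cA hg; have [ch cg _] := hg.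
apply/ler_addgt0Pr => e e0.
(* There are [n] errors of size [e / n.+1]; the successor also covers the empty matrix. *)
have e1 : 0 < Num.sqrt (e / n.+1%:R) by rewrite sqrtr_gt0 divr_gt0 // ltr0Sn.
have ex i : exists y : H, lspan (rkhs_kernel H @` V) y /\
    rnorm (g i - y) ^+ 2 <= e / n.+1%:R.
  have /closure_rnormP/(_ _ e1)[y sy gy] := cg i; exists y; split=> //.
  rewrite -[leRHS]sqr_sqrtr; last by rewrite divr_ge0 ?ltW // ltr0Sn.
  by rewrite ler_pXn2r ?nnegrE ?rnorm_ge0 ?ltW.
have [y hy] := choice ex.
have ex2 i : exists m : {m : nat & ('I_m -> V) * ('I_m -> C)}%type,
    y i = \sum_j (projT2 m).2 j *: k ((projT2 m).1 j).
  have [[m [v [c ->]]] _] := (lspan_kernelP (hy i).1, tt).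
  by exists (existT _ m (v, c)).
have [m hm] := choice ex2.
pose J : finType := {i : 'I_n & 'I_(projT1 (m i))}.
pose x (p : J) : V * 'I_n := ((projT2 (m (tag p))).1 (tagged p), tag p).
pose c (p : J) := ((projT2 (m (tag p))).2 (tagged p))^*.
have yE i : \sum_j ((x j).2 == i)%:R * (c j)^* *: k (x j).1 = y i.
  rewrite hm.
  rewrite -(@sig_big_dep _ _ _ _ (fun i => 'I_(projT1 (m i))) xpredT (fun _ _ => true)
     (fun l j => (l == i)%:R * (((projT2 (m l)).2 j)^*)^* *: k ((projT2 (m l)).1 j))).
  rewrite (bigD1 i) //= [X in _ + X]big1 => [|l li].
    by rewrite addr0; apply: eq_bigr => j _; rewrite eqxx mul1r conjcK.
  by apply: big1 => j _; rewrite (negbTE li) mul0r scale0r.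
pose z b : H := \sum_j (c j)^* * (A (x j).2 b (x j).1)^* *: k (x j).1.
have := cA J x c; rewrite contr_form lecR subr_ge0.
under [leRHS]eq_bigr do rewrite yE.
rewrite -[leLHS]/(\sum_b rnorm (z b) ^+ 2) => zy.
have := graph_form x c hg; under eq_bigr do rewrite yE.
rewrite -[RHS]/(\sum_b hdot (h b) (z b)) => /(congr1 (@complex.Re R)).
rewrite !Re_sum => gz.
have h1 : \sum_i rnorm (g i) ^+ 2 <= n%:R * (e / n.+1%:R) +
    2 * \sum_i complex.Re (hdot (g i) (y i)) - \sum_i rnorm (y i) ^+ 2.
  have -> : n%:R * (e / n.+1%:R) = \sum_(i < n) (e / n.+1%:R).
    by rewrite sumr_const card_ord mulr_natl.
  rewrite -addrA mulr_sumr -sumrB -big_split /=; apply: ler_sum => i _.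
  have := (hy i).2; rewrite sqr_rnormB; move: (e / n.+1%:R) => q; lra.
have h2 : 2 * \sum_i complex.Re (hdot (h i) (z i)) <=
    \sum_i rnorm (h i) ^+ 2 + \sum_i rnorm (z i) ^+ 2.
  rewrite mulr_sumr -big_split /=; apply: ler_sum => i _.
  have := sqr_ge0 (rnorm (h i - z i)); rewrite sqr_rnormB; lra.
have h3 : n%:R * (e / n.+1%:R) <= e.
  by rewrite mulrA ler_pdivrMr ?ltr0Sn // mulrC ler_pM2l // ler_nat.
move: (n%:R * _) h1 h3 => q; rewrite gz => h1 h3; lra.
Qed.

Lemma mult_norm_le1P n (A : 'M[V -> C]_n) : (forall i j, multiplier H V (A i j)) ->
  (mult_norm H A <= 1)%E <-> contr kV A.
Proof.
move=> mA; split=> [le1 J x c|cA]; last first.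
  apply: ge_ereal_sup => _ [h [g [hg h1 ->]]]; rewrite lee_fin.
  rewrite -sqrtr1 ler_sqrt //; exact: le_trans (contr_graph_le cA hg) h1.
(* Homogeneity: the supremum only involves [|h| <= 1], so [h] is normalised, and [h = 0] is treated
   apart. *)
have le2 h g : mult_graph H A h g ->
    \sum_i rnorm (g i) ^+ 2 <= \sum_i rnorm (h i) ^+ 2.
  move=> hg; have [ch cg hgE] := hg.
  set s := \sum_i rnorm (h i) ^+ 2.
  have s0 : 0 <= s by apply: sumr_ge0 => i _; exact: sqr_ge0.
  have [s00|sn0] := eqVneq s 0.
    have h0 i : h i = 0.
      apply: rnorm0_eq0; apply/eqP; rewrite -sqrf_eq0.
      by move/eqP: s00; rewrite psumr_eq0 => [/allP/(_ i)|? _]; rewrite ?mem_index_enum ?sqr_ge0 //; apply.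
    rewrite s00 big1 // => i _; suff -> : g i = 0 by rewrite rnorm0 expr0n.
    apply: (kernel_span_eq (cg i)); first by have [] := kernel_span_subspace H V.
    move=> v; rewrite hgE raddf0 big1 // => j _.
    by rewrite h0 raddf0 mulr0.
  have sp : 0 < s by rewrite lt_neqAle eq_sym sn0.
  have r0 : 0 < Num.sqrt s by rewrite sqrtr_gt0.
  pose r := (Num.sqrt s)^-1.
  have rp : 0 <= r by rewrite invr_ge0 ltW.
  have r2 : r ^+ 2 = s^-1 by rewrite exprVn sqr_sqrtr.
  have nr (w : H) : rnorm (r%:C *: w) ^+ 2 = s^-1 * rnorm w ^+ 2.
    by rewrite rnormZ rnorm_real ger0_norm // exprMn r2.
  have : ((Num.sqrt (\sum_i rnorm (r%:C *: g i) ^+ 2))%:E <= mult_norm H A)%E.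
    apply: ereal_sup_ubound; exists (fun i => r%:C *: h i), (fun i => r%:C *: g i).
    split=> //; last by under eq_bigr do rewrite nr; rewrite -mulr_sumr mulVf.
    split=> [i|i|i v].
    - by apply: subspaceZ (ch i); exact: kernel_span_subspace.
    - by apply: subspaceZ (cg i); exact: kernel_span_subspace.
    rewrite rkhs_reproducing dotZl -rkhs_reproducing hgE mulr_sumr.
    by apply: eq_bigr => j _; rewrite [in RHS]rkhs_reproducing dotZl -rkhs_reproducing mulrCA.
  move=> /le_trans/(_ le1); rewrite lee_fin -[leRHS]sqrtr1 ler_sqrt //.
  by under eq_bigr do rewrite nr; rewrite -mulr_sumr ler_pdivrMl // mulr1.
rewrite contr_form lecR subr_ge0.
set y := fun i => \sum_j ((x j).2 == i)%:R * (c j)^* *: k (x j).1.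
set z := fun b => \sum_j (c j)^* * (A (x j).2 b (x j).1)^* *: k (x j).1.
have cz b : kernel_span H V (z b).
  by apply: subset_closure; apply: lspan_kernel.
(* The image [g] of [z] under [A] exists since the entries are multipliers. Then
   [|z|^2 = Re <g, y> <= (|g|^2 + |y|^2) / 2] together with [|g| <= |z|] gives [|z| <= |y|]. *)
have ex i : exists g, kernel_span H V g /\
    forall v : V, rkhs_fun g (val v) = \sum_b A i b v * rkhs_fun (z b) (val v).
  have exb b : exists g, kernel_span H V g /\
     forall v : V, rkhs_fun g (val v) = A i b v * rkhs_fun (z b) (val v).
    by have [g cg hg] := mA i b _ (cz b); exists g.
  have [g hg] := choice exb; exists (\sum_b g b); split.
    by apply: subspace_sum => [|b _]; [exact: kernel_span_subspace | case: (hg b)].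
  move=> v; rewrite linear_sum /= fct_sumE; apply: eq_bigr => b _.
  exact: (hg b).2.
have [g hg] := choice ex.
have hzg : mult_graph H A z g.
  by split=> [//|i|i v]; [case: (hg i) | case: (hg i)].
have := graph_form x c hzg; rewrite -/y -/z => /(congr1 (@complex.Re R)).
rewrite !Re_sum; under [X in _ = X]eq_bigr do rewrite -rnorm_dot.
move=> e; have := le2 _ _ hzg.
have : 2 * \sum_i complex.Re (hdot (g i) (y i)) <=
    \sum_i rnorm (g i) ^+ 2 + \sum_i rnorm (y i) ^+ 2.
  rewrite mulr_sumr -big_split /=; apply: ler_sum => i _.
  have := sqr_ge0 (rnorm (g i - y i)); rewrite sqr_rnormB; lra.
rewrite e; lra.
Qed.

End MultiplierNorm.

(** * Leech factorisation *)

Section Coordinates.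
Variables (R : realType) (d : option nat).
Local Notation C := R[i].
Local Notation E := (cspace R d).
Implicit Types x y : E.

Lemma hdotE x y : hdot x y = cdot x y. Proof. by []. Qed.

Lemma rnorm_cspace x : rnorm x ^+ 2 = limn (sqnorms x).
Proof.
by have [_ cx] := coordP x; rewrite -[RHS]sqr_sqrtr ?lim_sqnorms_ge0.
Qed.

Lemma coord_out x n : ~~ in_dim d n -> x n = 0.
Proof. by have [h _] := coordP x; exact: h. Qed.

(** Basis vectors beyond the dimension are 0, so that [hdot x (cdelta i)] is the coordinate [x i]
    for every [i] and every dimension. *)
Let delta (i n : nat) : C := (in_dim d i && (n == i))%:R.

Lemma delta_summable i : delta i \in square_summable (R := R) d.
Proof.
apply/asboolP; split=> [n nd|].
  rewrite /delta; have [ni|] := eqVneq n i; last by rewrite andbF.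
  by rewrite -ni (negbTE nd).
apply: (@cvg_sqnorms _ _ 1) => N.
rewrite /sqnorms /series /=; have [iN|Ni] := ltnP i N.
  rewrite (bigD1_seq i) //= ?mem_index_iota ?iota_uniq // big1 => [|n ni].
    rewrite addr0 /delta eqxx andbT; case: in_dim.
      by rewrite rnorm1 expr1n.
    by rewrite rnorm0 expr0n.
  by rewrite /delta (negbTE ni) andbF rnorm0 expr0n.
rewrite big_nat big1 // => n /andP[_ nN].
by rewrite /delta ltn_eqF ?(leq_trans nN) // andbF rnorm0 expr0n.
Qed.

Definition cdelta i : E := CSpace (delta_summable i).

Lemma cdeltaE i n : cdelta i n = (in_dim d i && (n == i))%:R.
Proof. by []. Qed.

Lemma dot_cdelta x i : hdot x (cdelta i) = x i.
Proof.
rewrite hdotE; apply: cvg_lim => //; apply: cvg_near_cst.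
exists i.+1 => // N /= iN; rewrite /series /=.
rewrite (bigD1_seq i) //= ?mem_index_iota ?iota_uniq //= big1 => [|n ni].
  rewrite addr0 /delta eqxx andbT; case: (boolP (in_dim d i)) => [_|di].
    by rewrite conjC1 mulr1.
  by rewrite coord_out // mul0r.
by rewrite /delta (negbTE ni) andbF conjC0 mulr0.
Qed.

Lemma dot_cdeltal x i : hdot (cdelta i) x = (x i)^*.
Proof. by rewrite dotC dot_cdelta. Qed.

Definition tail N x : E := x - \sum_(i < N) x i *: cdelta i.

Lemma coord_sum (I : Type) (r : seq I) (P : pred I) (F : I -> E) n :
  (\sum_(i <- r | P i) F i : E) n = \sum_(i <- r | P i) F i n.
Proof. by elim/big_rec2: _ => // i x y _ <-. Qed.

Lemma tailE N x n : tail N x n = if (n < N)%N then 0 else x n.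
Proof.
rewrite /tail coordB coord_sum; under eq_bigr do rewrite coordZ cdeltaE.
case: ltnP => [nN|Nn].
  rewrite (bigD1 (Ordinal nN)) //= big1 => [|i].
    rewrite eqxx andbT addr0; case: (boolP (in_dim d n)) => dn.
      by rewrite mulr1 subrr.
    by rewrite coord_out // mul0r subrr.
  by rewrite -val_eqE /= eq_sym => /negbTE ->; rewrite andbF mulr0.
rewrite big1 ?subr0 // => i _.
by rewrite gtn_eqF ?andbF ?mulr0 // (leq_trans (ltn_ord i)).
Qed.

Lemma dot_tail N x y :
  hdot (tail N x) (tail N y) = hdot x y - \sum_(i < N) x i * (y i)^*.
Proof.
have -> : hdot (tail N x) (tail N y) = hdot (tail N x) y.
  rewrite {2}/tail dotBr dot_sumr big1 ?subr0 // => i _.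
  by rewrite dotZr dot_cdelta tailE ltn_ord mulr0.
rewrite dotBl dot_suml; congr (_ - _); apply: eq_bigr => i _.
by rewrite dotZl dot_cdeltal.
Qed.

Lemma sqr_rnorm_tail N x :
  rnorm (tail N x) ^+ 2 = rnorm x ^+ 2 - \sum_(i < N) rnorm (x i) ^+ 2.
Proof.
apply: complexI; rewrite -dot_rnorm dot_tail dot_rnorm rmorphB rmorph_sum /=.
by congr (_ - _); apply: eq_bigr => i _; rewrite mulcJ.
Qed.

Lemma cvg_tail0 x : (fun N => rnorm (tail N x) ^+ 2) @ \oo --> (0 : R).
Proof.
rewrite -(subrr (rnorm x ^+ 2)); under eq_fun do rewrite sqr_rnorm_tail.
apply: cvgB; first exact: cvg_cst.
rewrite rnorm_cspace; have [_ cx] := coordP x.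
apply: cvg_trans cx; apply: near_eq_cvg; near=> N.
by rewrite /sqnorms /series /= big_mkord.
Unshelve. all: by end_near. Qed.

Lemma rnorm_le_bound x (M : R) : 0 <= M ->
  (forall N, \sum_(i < N) rnorm (x i) ^+ 2 <= M ^+ 2) -> rnorm x <= M.
Proof.
by move=> M0 h; apply: cnorm_le => // N; rewrite /sqnorms /series /= big_mkord.
Qed.

End Coordinates.

Section GramSystem.
Variable (R : realType).
Local Notation C := R[i].

(** [q] and its Gram matrix have the same column space: a row vector annihilating the Gram matrix
    annihilates [q], because its product with [q] has norm 0. The solution [c] replaces an inverse,
    as the Gram matrix may be singular. *)
Lemma gram_solvable n r (q : 'M[C]_(n, r)) :
  exists c : 'M[C]_(n, r), (q *m (map_mx conjc q)^T) *m c = q.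
Proof.
set G := q *m _.
have : (q^T <= G^T)%MS.
  rewrite submxE; set k := cokermx G^T.
  have k0 : k^T *m G = 0 by rewrite -[G]trmxK -trmx_mul mulmx_coker trmx0.
  set w := k^T *m q.
  have w0 : w *m (map_mx conjc w)^T = 0.
    by rewrite {2}/w map_mxM trmx_mul mulmxA /w -(mulmxA k^T) -/G k0 mul0mx.
  suff -> : q^T *m k = w^T by rewrite (_ : w = 0) ?trmx0 //; apply/matrixP => i j;
    move/matrixP/(_ i i): w0; rewrite !mxE; under eq_bigr do rewrite !mxE mulcJ;
    rewrite -rmorph_sum => /complexI/eqP; rewrite psumr_eq0 => [/allP/(_ j)|l _];
    rewrite ?mem_index_enum ?sqr_ge0 // => /(_ isT); rewrite sqrf_eq0 => /eqP;
    exact: rnorm0_eq0.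
  by rewrite /w trmx_mul trmxK.
move=> /submxP[D hD]; exists D^T.
by rewrite -[RHS]trmxK hD trmx_mul trmxK.
Qed.

Lemma gram_solvable_fin (J S : finType) (q : J -> S -> C) :
  exists c : J -> S -> C,
    forall l r, \sum_k (\sum_s q l s * (q k s)^*) * c k r = q l r.
Proof.
have [c hc] := gram_solvable (\matrix_(j < #|J|, s < #|S|)
   q (enum_val j) (enum_val s)).
exists (fun j s => c (enum_rank j) (enum_rank s)) => l r.
move/matrixP/(_ (enum_rank l) (enum_rank r)): hc; rewrite !mxE !enum_rankK => <-.
rewrite (reindex (@enum_val J predT)) /=; last by apply: onW_bij; exact: enum_val_bij.
apply: eq_bigr => k _; rewrite enum_valK !mxE; congr (_ * _).
rewrite (reindex (@enum_val S predT)) /=; last by apply: onW_bij; exact: enum_val_bij.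
by apply: eq_bigr => s _; rewrite !mxE enum_rankK.
Qed.

End GramSystem.

Section FiniteLeech.
Variables (R : realType) (E : hilbertType R).
Local Notation C := R[i].

(* The contraction [T] defined by [p_l |-> q_l], where [p_l = (y_l (x) g_l)], acts on
   [h] by [(hT)_r = \sum_l <h, p_l> c_l r]. *)
Lemma lurking_contraction (J S : finType) (y : J -> E) (g q c : J -> S -> C)
    (hS : S -> E) :
  (forall l k, \sum_s q l s * (q k s)^* =
     hdot (y l) (y k) * \sum_s g l s * (g k s)^*) ->
  (forall l r, \sum_k (\sum_s q l s * (q k s)^*) * c k r = q l r) ->
  \sum_r rnorm (\sum_l (\sum_s hdot (hS s) (y l) * (g l s)^*) * c l r) ^+ 2 <=
  \sum_s rnorm (hS s) ^+ 2.
Proof.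
move=> hG hc.
(* [u = hT], while [v] and [n] are the same combination of the [p_l] and of the [q_l], so
   [|v| = |n|]. From [|u|^2 = <h, v>] and [|n|^2 = <n, u>] follow [|n| <= |u|] and then
   [|u| <= |h|]. *)
pose u r := \sum_l (\sum_s hdot (hS s) (y l) * (g l s)^*) * c l r.
pose ka l := \sum_r c l r * (u r)^*.
pose v s : E := \sum_l (ka l)^* * g l s *: y l.
pose n r := \sum_l (ka l)^* * q l r.
have uv : \sum_r u r * (u r)^* = \sum_s hdot (hS s) (v s).
  under eq_bigr do rewrite {1}/u mulr_suml.
  rewrite exchange_big /=.
  under [RHS]eq_bigr do rewrite dot_sumr.
  rewrite [RHS]exchange_big; apply: eq_bigr => l _.
  rewrite -[LHS](_ : (\sum_s hdot (hS s) (y l) * (g l s)^*) * ka l = _); last first.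
    by rewrite /ka mulr_sumr; apply: eq_bigr => r _; rewrite mulrA.
  rewrite mulr_suml; apply: eq_bigr => s _.
  by rewrite dotZr conjcM conjcK; ring.
have kq l : \sum_k (\sum_s q l s * (q k s)^*) * ka k = \sum_r q l r * (u r)^*.
  under eq_bigr do rewrite /ka mulr_sumr.
  rewrite exchange_big; apply: eq_bigr => r _.
  by rewrite -[in RHS]hc mulr_suml; apply: eq_bigr => k _; rewrite mulrA.
have nn : \sum_r n r * (n r)^* = \sum_r n r * (u r)^*.
  transitivity (\sum_l (ka l)^* * \sum_k (\sum_s q l s * (q k s)^*) * ka k).
    under eq_bigr do rewrite {1}/n mulr_suml.
    rewrite exchange_big; apply: eq_bigr => l _ /=.
    under [in RHS]eq_bigr do rewrite mulr_suml.
    rewrite exchange_big mulr_sumr; apply: eq_bigr => s _ /=.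
    rewrite [in RHS]mulr_sumr.
    rewrite [(n s)^*]conjc_sum [in LHS]mulr_sumr.
    apply: eq_bigr => k _.
    by rewrite conjcM conjcK; ring.
  under eq_bigr do rewrite kq mulr_sumr.
  rewrite exchange_big; apply: eq_bigr => r _; rewrite /n mulr_suml.
  by apply: eq_bigr => l _; rewrite mulrA.
have vn : \sum_s hdot (v s) (v s) = \sum_r n r * (n r)^*.
  have -> : \sum_r n r * (n r)^* =
      \sum_l \sum_k (ka l)^* * ka k * \sum_s q l s * (q k s)^*.
    under eq_bigr do rewrite {1}/n mulr_suml.
    rewrite exchange_big; apply: eq_bigr => l _ /=.
    under eq_bigr do rewrite [(n _)^*]conjc_sum mulr_sumr.
    rewrite exchange_big; apply: eq_bigr => k _ /=.
    rewrite mulr_sumr; apply: eq_bigr => s _; rewrite conjcM conjcK; ring.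
  under eq_bigr do rewrite dot_suml.
  rewrite exchange_big; apply: eq_bigr => l _ /=.
  under eq_bigr do rewrite dot_sumr.
  rewrite exchange_big; apply: eq_bigr => k _ /=.
  rewrite hG mulrA [in RHS]mulr_sumr; apply: eq_bigr => s _.
  by rewrite dotZl dotZr conjcM conjcK; ring.
move: uv nn vn => /(congr1 (@complex.Re R)) uv /(congr1 (@complex.Re R)) nn.
move=> /(congr1 (@complex.Re R)); move: uv nn; rewrite !Re_sum.
have mJ (z : C) : complex.Re (z * z^*) = rnorm z ^+ 2 by rewrite mulcJ.
under [\sum_r complex.Re (u r * _)]eq_bigr do rewrite mJ.
under [\sum_r complex.Re (n r * (n r)^*)]eq_bigr do rewrite mJ.
under [\sum_s complex.Re (hdot (v s) (v s))]eq_bigr do rewrite -rnorm_dot.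
move=> uv nn vn; rewrite -/(u _).
have i1 : 2 * \sum_r complex.Re (n r * (u r)^*) <=
    \sum_r rnorm (n r) ^+ 2 + \sum_r rnorm (u r) ^+ 2.
  rewrite mulr_sumr -big_split /=; apply: ler_sum => r _.
  rewrite !rnorm_sqr; move: (n r) (u r) => [a b] [a' b'] /=.
  by have := sqr_ge0 (a - a'); have := sqr_ge0 (b - b'); nra.
have i2 : 2 * \sum_s complex.Re (hdot (hS s) (v s)) <=
    \sum_s rnorm (hS s) ^+ 2 + \sum_s rnorm (v s) ^+ 2.
  rewrite mulr_sumr -big_split /=; apply: ler_sum => s _.
  have := sqr_ge0 (rnorm (hS s - v s)); rewrite sqr_rnormB; lra.
rewrite -[leLHS]/(\sum_r rnorm (u r) ^+ 2).
rewrite -nn in i1; rewrite -uv vn in i2; lra.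
Qed.

(** [u p] is the image of [t p] under the contraction; the kernel is positive because the norm
    inequality holds for every combination of the [t p]. *)
Lemma psd_lurking (J S : finType) (y : J -> E) (g q c : J -> S -> C)
    (P : Type) (t : P -> S -> E) (u : P -> S -> C) :
  (forall l k, \sum_s q l s * (q k s)^* =
     hdot (y l) (y k) * \sum_s g l s * (g k s)^*) ->
  (forall l r, \sum_k (\sum_s q l s * (q k s)^*) * c k r = q l r) ->
  (forall p r, \sum_l (\sum_s hdot (t p s) (y l) * (g l s)^*) * c l r = u p r) ->
  psd (fun p p' => \sum_s hdot (t p s) (t p' s) - \sum_r u p r * (u p' r)^*).
Proof.
move=> hG hc hu J' x xi.
pose hS s : E := \sum_p xi p *: t (x p) s.
have hv r : \sum_l (\sum_s hdot (hS s) (y l) * (g l s)^*) * c l r =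
    \sum_p xi p * u (x p) r.
  under [RHS]eq_bigr do rewrite -hu mulr_sumr.
  rewrite exchange_big; apply: eq_bigr => l _ /=.
  under [RHS]eq_bigr do rewrite mulrA mulr_sumr.
  rewrite -mulr_suml exchange_big /=; congr (_ * _); apply: eq_bigr => s _.
  rewrite dot_suml mulr_suml; apply: eq_bigr => p _.
  by rewrite dotZl mulrA.
have := lurking_contraction hS hG hc; under eq_bigr do rewrite hv.
rewrite -subr_ge0 -lecR rmorphB !rmorph_sum /=; congr (_ <= _).
under eq_bigr do rewrite -dot_rnorm dot_suml.
under [X in _ - X]eq_bigr do rewrite -mulcJ mulr_suml.
rewrite exchange_big [X in _ - X]exchange_big -sumrB; apply: eq_bigr => p _ /=.
under eq_bigr do rewrite dot_sumr.
under [X in _ - X]eq_bigr do rewrite conjc_sum mulr_sumr.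
rewrite exchange_big [X in _ - X]exchange_big -sumrB; apply: eq_bigr => p' _ /=.
rewrite mulrBr !mulr_sumr; congr (_ - _); apply: eq_bigr => s _.
  by rewrite dotZl dotZr; ring.
rewrite conjcM; ring.
Qed.

End FiniteLeech.

Section FiniteFactorization.
Variables (R : realType) (E : hilbertType R).
Local Notation C := R[i].
Variables (J : finType) (y : J -> E) (K : J -> J -> C) (f : J -> C).
Hypothesis y1 : forall j, rnorm (y j) < 1.
Hypothesis pK : psd K.
Hypothesis K1 : forall j k, K j k * (1 - hdot (y j) (y k)) = 1.
Hypothesis pf : psd (fun j k => (hdot (y j) (y k) - f j * (f k)^*) * K j k).

Variables (I : eqType) (e : I -> E).
Hypothesis delta_psd : psd (fun a b : I => (a == b)%:R - hdot (e a) (e b)).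

(* Factoring [(<y, y> - f f^* ) K] as [g g^*] gives
   [f f^* + g g^* = <y, y> (1 + g g^* )]; [B] is the transfer function of the
   contraction this identity defines. *)
Lemma finite_leech : exists B : J -> I -> C,
  psd (fun p q : J * I => ((p.2 == q.2)%:R - B p.1 p.2 * (B q.1 q.2)^*) * K p.1 q.1)
  /\ forall j, exists2 u : E, (forall i, hdot u (e i) = (B j i)^*) & hdot (y j) u = f j.
Proof.
have [m [gm hgm]] := psd_factor pf.
pose Q j k := hdot (y j) (y k).
(* [None] is the scalar coordinate, carrying the 1 of [1 + g g^*] in [ga] and [f] in [q]; the other
   coordinates form the state space. *)
pose ga j (s : option 'I_m) : C := if s is Some a then gm a j else 1.
pose q j (s : option 'I_m) : C := if s is Some a then gm a j else f j.
have big_opt (T : nmodType) (F : option 'I_m -> T) :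
    \sum_s F s = F None + \sum_a F (Some a).
  rewrite (bigD1 None) //=; congr (_ + _).
  rewrite (reindex_omap Some id) //=; first by apply: eq_bigl => a; rewrite eqxx.
  by case.
have hG l k : \sum_s q l s * (q k s)^* = Q l k * \sum_s ga l s * (ga k s)^*.
  rewrite !big_opt /ga /q -!hgm conjc1 mulr1.
  have := K1 l k; rewrite -/(Q l k) => kq.
  apply/eqP; rewrite -subr_eq0; apply/eqP; set z := f l * (f k)^*.
  transitivity ((Q l k - z) * (K l k * (1 - Q l k) - 1)); first by rewrite /Q; ring.
  by rewrite kq subrr mulr0.
have ga1 k : (ga k None)^* = 1 by exact: conjc1.
have gg l k : ga l None * (ga k None)^* = 1 by rewrite ga1 mulr1.
have [c hc] := gram_solvable_fin q.
pose cs l : 'rV[C]_m := \row_b c l (Some b).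
pose gar l : 'rV[C]_m := \row_a gm a l.
pose gc l : 'cV[C]_m := \col_a (gm a l)^*.
pose D j := \sum_l Q j l *: (gc l *m cs l).
pose de j := \sum_l (Q j l * c l None) *: gc l.
pose N j := 1%:M - D j.
have DE j a b : D j a b = \sum_l Q j l * (gm a l)^* * c l (Some b).
  rewrite summxE; apply: eq_bigr => l _.
  by rewrite !mxE big_ord1 !mxE mulrA.
have deE j a : de j a 0 = \sum_l Q j l * (gm a l)^* * c l None.
  by rewrite summxE; apply: eq_bigr => l _; rewrite !mxE; ring.
(* A row [v = v D] is reproduced by the contraction from the input [v (x) y_j] with zero scalar
   part, so [|v|^2 <= |y_j|^2 |v|^2] and [v = 0], as [|y_j| < 1]. *)
have Nu j : N j \in unitmx.
  rewrite -row_free_unit -kermx_eq0; apply/eqP/row_matrixP => i; rewrite row0.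
  set v := row i _.
  have : v *m N j = 0 by apply/sub_kermxP; exact: row_sub.
  rewrite mulmxBr mulmx1 => /eqP; rewrite subr_eq0 => /eqP vD.
  pose hS (s : option 'I_m) : E := if s is Some a then v 0 a *: y j else 0.
  have := lurking_contraction hS hG hc; rewrite !big_opt /= rnorm0 expr0n add0r.
  have -> : \sum_a rnorm (\sum_l (\sum_s hdot (hS s) (y l) * (ga l s)^*) * c l (Some a)) ^+ 2
      = \sum_a rnorm (v 0 a) ^+ 2.
    apply: eq_bigr => b _; congr (rnorm _ ^+ 2).
    rewrite [RHS](congr1 (fun w : 'rV_m => w 0 b) vD) mxE; under [RHS]eq_bigr do rewrite DE mulr_sumr.
    rewrite exchange_big; apply: eq_bigr => l _ /=.
    rewrite big_opt /= dot0l mul0r add0r mulr_suml; apply: eq_bigr => a _.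
    by rewrite dotZl !mulrA.
  under [leRHS]eq_bigr do rewrite rnormZ exprMn mulrC.
  rewrite -mulr_sumr => le.
  have v0 : \sum_a rnorm (v 0 a) ^+ 2 <= 0.
    have : rnorm (y j) ^+ 2 < 1 by rewrite expr_lt1 ?rnorm_ge0.
    have := le_trans _ le; rewrite -{1}[\sum_a _]add0r => /(_ _ (lerD (sqr_ge0 _) (lexx _))).
    set s := \sum_a _; nra.
  apply/rowP => a; rewrite [RHS]mxE; apply: rnorm0_eq0; apply/eqP; rewrite -sqrf_eq0.
  have : \sum_a rnorm (v 0 a) ^+ 2 == 0.
    by rewrite eq_le v0 sumr_ge0 // => b _; exact: sqr_ge0.
  rewrite psumr_eq0 => [/allP/(_ a)|b _]; last exact: sqr_ge0.
  by rewrite mem_index_enum; apply.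
(* [eta] is the state solving the feedback equation [etaN] for the input [e a], and [B] the
   resulting scalar output. *)
pose eta j a : 'rV[C]_m := (\sum_l hdot (e a) (y l) *: cs l) *m invmx (N j).
pose be j l := c l None + (cs l *m invmx (N j) *m de j) 0 0.
pose B j a := \sum_l hdot (e a) (y l) * be j l.
have etaN j a : eta j a = (\sum_l hdot (e a) (y l) *: cs l) + eta j a *m D j.
  have : eta j a *m N j = \sum_l hdot (e a) (y l) *: cs l by rewrite /eta mulmxKV.
  by rewrite mulmxBr mulmx1 => <-; rewrite subrK.
have BE j a : B j a = \sum_l hdot (e a) (y l) * c l None + (eta j a *m de j) 0 0.
  rewrite /B; under eq_bigr do rewrite mulrDr; rewrite big_split /=; congr (_ + _).
  rewrite /eta !mulmx_suml summxE; apply: eq_bigr => l _.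
  by rewrite -!scalemxAl [RHS]mxE.
(* The contraction sends [(e a, eta (x) y_j)] to [(B, eta)]: the state comes back unchanged. *)
pose t (p : J * I) (s : option 'I_m) : E :=
  if s is Some a then eta p.1 p.2 0 a *: y p.1 else e p.2.
pose u (p : J * I) (s : option 'I_m) : C :=
  if s is Some b then eta p.1 p.2 0 b else B p.1 p.2.
have tu p r : \sum_l (\sum_s hdot (t p s) (y l) * (ga l s)^*) * c l r = u p r.
  case: p => j a.
  transitivity (\sum_l (hdot (e a) (y l) * c l r +
      (\sum_b hdot (eta j a 0 b *: y j) (y l) * (gm b l)^*) * c l r)).
    by apply: eq_bigr => l _; rewrite big_opt ga1 mulr1 mulrDl.
  rewrite big_split /=.
  have E1 : \sum_l (\sum_b hdot (eta j a 0 b *: y j) (y l) * (gm b l)^*) * c l r =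
      \sum_b eta j a 0 b * \sum_l Q j l * (gm b l)^* * c l r.
    under [RHS]eq_bigr do rewrite mulr_sumr.
    rewrite [RHS]exchange_big; apply: eq_bigr => l _ /=.
    by rewrite mulr_suml; apply: eq_bigr => b _; rewrite dotZl !mulrA.
  rewrite E1.
  case: r {E1} => [b|]; rewrite /u /=.
    rewrite {2}etaN mxE summxE mxE; congr (_ + _).
      by apply: eq_bigr => l _; rewrite !mxE.
    by apply: eq_bigr => s _; rewrite DE.
  by rewrite BE mxE; congr (_ + _); apply: eq_bigr => s _; rewrite deE.
have pP := psd_lurking hG hc tu.
exists B; split.
  pose Et (p p' : J * I) := \sum_b eta p.1 p.2 0 b * (eta p'.1 p'.2 0 b)^*.
  have pE : psd Et by apply: psd_sum => b; exact: psd_rank1.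
  have pK' : psd (fun p p' : J * I => K p.1 p'.1) by exact: (psd_comp fst pK).
  have pd := psdM (psd_comp (@snd J I) delta_psd) pK'.
  (* The state enters with weight [(<y, y> - 1) K = - 1], which the summand [Et] cancels;
     [delta_psd] replaces the Gram matrix of the [e a] by the identity. *)
  apply: eq_psd (psdD (psdD (psdM pP pK') pE) pd) => p p'.
  rewrite !big_opt /= -/(Et p p').
  under eq_bigr do rewrite dotZl dotZr mulrA.
  rewrite -mulr_suml -/(Et p p').
  have := K1 p.1 p'.1; move: (hdot _ _) (K _ _) (Et _ _) (hdot _ _) => z k e' w h.
  transitivity (((p.2 == p'.2)%:R - B p.1 p.2 * (B p'.1 p'.2)^*) * k + e' * (1 - k * (1 - w))).
    ring.
  by rewrite h subrr mulr0 addr0.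
move=> j; exists (\sum_l (be j l)^* *: y l).
  move=> i; rewrite dot_suml /B conjc_sum; apply: eq_bigr => l _.
  by rewrite dotZl conjcM -dotC mulrC.
rewrite dot_sumr; under eq_bigr do rewrite dotZr conjcK.
(* For the input [y j] the state is the row of the factors [gm], and the output is [f j]: [eq1] and
   [eq2] are the components of [p_j T = q_j]. *)
have eq1 : \sum_l Q j l * c l None + (gar j *m de j) 0 0 = f j.
  rewrite -[RHS]/(q j None) -hc mxE.
  under [X in _ + X]eq_bigr do rewrite mxE deE mulr_sumr.
  rewrite exchange_big -big_split /=; apply: eq_bigr => l _.
  rewrite hG big_opt gg mulrDr mulr1 mulrDl; congr (_ + _).
  rewrite [in RHS]mulr_sumr [in RHS]mulr_suml; apply: eq_bigr => b _.
  rewrite /ga ?mxE; ring.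
have eq2 : \sum_l Q j l *: cs l = gar j *m N j.
  rewrite mulmxBr mulmx1; apply/eqP; rewrite -subr_eq opprK; apply/eqP/rowP => b.
  rewrite [RHS]mxE -[RHS]/(q j (Some b)) -hc !mxE summxE.
  under [X in _ + X]eq_bigr do rewrite mxE DE mulr_sumr.
  rewrite exchange_big -big_split /=; apply: eq_bigr => l _.
  rewrite hG big_opt gg mulrDr mulr1 mulrDl !mxE; congr (_ + _).
  rewrite [in RHS]mulr_sumr [in RHS]mulr_suml; apply: eq_bigr => s _.
  rewrite /ga ?mxE; ring.
rewrite -eq1 -/(Q j _); have -> : gar j *m de j = gar j *m N j *m invmx (N j) *m de j.
  by rewrite mulmxK.
rewrite -eq2 !mulmx_suml summxE -big_split; apply: eq_bigr => l _ /=.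
rewrite -!scalemxAl [X in _ = _ + X]mxE /be -/(Q j l); ring.
Qed.

End FiniteFactorization.

(** The kernel is 0 inside the dimension; beyond it the vectors [cdelta R d a] vanish and the
    identity remains, realised as a Gram matrix in the infinite-dimensional space. *)
Lemma psd_cdelta (R : realType) (d : option nat) :
  psd (fun a b : nat => (a == b)%:R - hdot (cdelta R d a) (cdelta R d b)).
Proof.
apply: eq_psd (psd_gram (fun a => if in_dim d a then 0 else cdelta R None a)) => a b.
rewrite dot_cdelta cdeltaE; case: (boolP (in_dim d a)) => da.
  by rewrite dot0l /= [b == a]eq_sym subrr.
case: (boolP (in_dim d b)) => db.
  rewrite dot0r; case: eqP => [e|_]; first by rewrite e db in da.
  by rewrite subr0.
by rewrite dot_cdelta cdeltaE /= [b == a]eq_sym subr0.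
Qed.

(** * Limits along filters and ultrafilters *)

Section Limits.
Variable (R : realType).
Local Notation C := R[i].

Lemma ultra_bounded_cvg (T : Type) (U : set_system T) (g : T -> R) (M : R) :
  UltraFilter U -> (forall t, `|g t| <= M) -> exists l : R, g @ U --> l.
Proof.
move=> UU gM; have PU : ProperFilter U := @ultra_proper _ _ UU.
have [|l [_ cl]] := @segment_compact R (- M) M (g @ U) _.
  suff : U [set t | `[- M, M]%classic (g t)] by [].
  by apply: filterE => t; have := gM t; rewrite ler_norml /= in_itv.
exists l => B lB; rewrite nbhs_filterE.
have [//|/= nB] := in_ultra_setVsetC (g @^-1` B) UU.
have [x [nx Bx]] := cl (~` B) B nB lB.
by case: nx.
Qed.

Lemma ultra_bounded_cvgC (T : Type) (U : set_system T) (g : T -> C) (M : R) :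
  UltraFilter U -> (forall t, rnorm (g t) <= M) -> exists l : C, g @ U --> l.
Proof.
move=> UU gM; have PU : ProperFilter U := @ultra_proper _ _ UU.
have [|a ha] := @ultra_bounded_cvg _ U (fun t => complex.Re (g t)) M UU.
  move=> t; apply: le_trans (gM t).
  by rewrite -lecR rnormE; exact: normc_ge_Re.
have [|b hb] := @ultra_bounded_cvg _ U (fun t => complex.Im (g t)) M UU.
  move=> t; apply: le_trans (gM t).
  rewrite -(@ler_pXn2r _ 2) ?nnegrE ?rnorm_ge0 // real_normK ?num_real //.
  by rewrite rnorm_sqr lerDr sqr_ge0.
exists (a +i* b); have := cvg_complex PU ha hb.
by rewrite (_ : (fun t => _) = g) //; apply/funext => t; case: (g t).
Qed.

Variables (T : Type) (F : set_system T) (PF : ProperFilter F).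

Lemma cvgCP (g : T -> C) (l : C) : g @ F --> l <->
  forall e : R, 0 < e -> \forall t \near F, rnorm (l - g t) < e.
Proof.
split=> [/cvgrPdist_lt h e e0|h].
  have /h : 0 < e%:C by rewrite ltcR.
  by apply: filterS => t; rewrite -rnormE ltcR.
apply/cvgrPdist_lt => e e0.
have eE : (complex.Re e)%:C = e by apply: ge0_ReK; exact: ltW.
have /h : 0 < complex.Re e by rewrite -ltcR eE.
by apply: filterS => t; rewrite -rnormE -eE ltcR.
Qed.

Lemma cvgC_near_cst (g : T -> C) (l c : C) : g @ F --> l ->
  (\forall t \near F, g t = c) -> l = c.
Proof.
move=> /cvgCP h gc; apply/eqP; rewrite -subr_eq0; apply/eqP; apply: rnorm0_eq0.
apply/eqP; rewrite eq_le rnorm_ge0 andbT; apply/ler_addgt0Pr => e /h he.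
by have [t [lt <-]] := filter_ex (filterI he gc); rewrite add0r ltW.
Qed.

Lemma cvg_conjc (g : T -> C) (l : C) : g @ F --> l ->
  (fun t => (g t)^*) @ F --> l^*.
Proof.
move=> /cvgCP h; apply/cvgCP => e /h; apply: filterS => t.
have -> : l^* - (g t)^* = (l - g t)^* by rewrite rmorphB.
by rewrite rnormJ.
Qed.

Lemma ge0_cvgC (g : T -> C) (l : C) : g @ F --> l ->
  (\forall t \near F, 0 <= g t) -> 0 <= l.
Proof.
move=> /cvgCP h g0.
have key (e : R) : 0 < e -> `|complex.Im l| <= e /\ - e <= complex.Re l.
  move=> e0; have [t [+ /ge0_complexP[im re]]] := filter_ex (filterI (h e e0) g0).
  rewrite -(@ltr_pXn2r _ 2) ?nnegrE ?rnorm_ge0 ?(ltW e0) //.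
  rewrite rnorm_sqr.
  have -> : complex.Im (l - g t) = complex.Im l.
    by move: im; case: (l) (g t) => [? ?] [? ?] /= ->; rewrite subr0.
  have -> : complex.Re (l - g t) = complex.Re l - complex.Re (g t).
    by rewrite ReD ReN.
  move=> lt.
  split.
    rewrite -(@ler_pXn2r _ 2) ?nnegrE ?(ltW e0) // real_normK ?num_real //.
    have := sqr_ge0 (complex.Re l - complex.Re (g t)); lra.
  have := sqr_ge0 (complex.Im l) => i0.
  rewrite leNgt; apply/negP => lt2.
  have : e ^+ 2 < (complex.Re l - complex.Re (g t)) ^+ 2.
    rewrite -[ltRHS]sqrrN ltr_pXn2r ?nnegrE ?(ltW e0) //; lra.
  lra.
apply/ge0_complexP; split.
  apply/eqP; rewrite -normr_le0; apply/ler_addgt0Pr => e e0; rewrite add0r.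
  by case: (key e e0).
rewrite -oppr_le0; apply/ler_addgt0Pr => e e0; rewrite add0r lerNl.
by case: (key e e0).
Qed.

Lemma cvg_sumC (I : Type) (r : seq I) (g : I -> T -> C) (l : I -> C) :
  (forall i, g i @ F --> l i) ->
  (fun t => \sum_(i <- r) g i t) @ F --> \sum_(i <- r) l i.
Proof. by move=> h; apply: cvg_big => //; exact: add_continuous. Qed.

(** Positivity of [L t] is asked only eventually, at a stage depending on the finite family, since a
    factorisation on a finite set is positive on that set alone. *)
Lemma psd_cvg (X : Type) (L : T -> X -> X -> C) (L0 : X -> X -> C) :
  (forall x y, (fun t => L t x y) @ F --> L0 x y) ->
  (forall (J : finType) (x : J -> X) (c : J -> C), \forall t \near F,
    0 <= \sum_j \sum_k c j * (c k)^* * L t (x j) (x k)) ->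
  psd L0.
Proof.
move=> hL h J x c; apply: ge0_cvgC (h J x c).
apply: cvg_sumC => j; apply: cvg_sumC => k.
by apply: cvgM; [exact: cvg_cst | exact: hL].
Qed.

End Limits.

Section ColumnBound.
Variable R : realType.
Local Notation C := R[i].

Lemma kernel_diag_gt0 (X : Type) (K : X -> X -> C) z q :
  psd K -> K z z * q = 1 -> 0 < K z z.
Proof.
move=> pK K1; rewrite lt_neqAle (psd_diag_ge0 z pK) andbT eq_sym.
by apply/eqP => h; move/eqP: K1; rewrite h mul0r eq_sym oner_eq0.
Qed.

Lemma col_bound (b : nat -> C) (k : C) N : 0 < k ->
  (forall c : 'I_N -> C, 0 <= \sum_i \sum_j c i * (c j)^* *
     (((i : nat) == j)%:R - b i * (b j)^*) * k) ->
  \sum_(i < N) rnorm (b i) ^+ 2 <= 1.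
Proof.
move=> k0 h; set S := \sum_(i < N) _.
have S0 : 0 <= S by apply: sumr_ge0 => i _; exact: sqr_ge0.
(* At these coefficients the form equals [(S - S^2) k], so [S <= 1]. *)
have := h (fun i => (b i)^*).
have -> : \sum_(i < N) \sum_(j < N) (b i)^* * ((b j)^*)^* *
    (((i : nat) == j)%:R - b i * (b j)^*) * k = (S - S ^+ 2)%:C * k.
  have SE : S%:C = \sum_(i < N) b i * (b i)^*.
    by rewrite /S rmorph_sum; apply: eq_bigr => i _; rewrite mulcJ.
  have -> : (S - S ^+ 2)%:C = S%:C - S%:C * S%:C by rewrite rmorphB rmorphXn.
  rewrite !SE mulr_suml -sumrB mulr_suml; apply: eq_bigr => i _.
  transitivity (\sum_(j < N) ((b i)^* * k * (((i : nat) == j)%:R * b j) -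
      (b i * (b i)^* * k) * (b j * (b j)^*))).
    by apply: eq_bigr => j _; rewrite conjcK; ring.
  have dl : \sum_(j < N) ((i : nat) == j)%:R * b j = b i.
    rewrite (bigD1 i) //= eqxx mul1r big1 ?addr0 // => j ji.
    by rewrite val_eqE eq_sym (negbTE ji) mul0r.
  by rewrite sumrB -!mulr_sumr dl; ring.
rewrite pmulr_lge0 // lecR; nra.
Qed.

End ColumnBound.

Section Leech.
Variables (R : realType) (d : option nat).
Local Notation C := R[i].
Local Notation E := (cspace R d).
Variables (X : choiceType) (x : X -> E) (K : X -> X -> C).
Hypothesis x1 : forall z, rnorm (x z) < 1.
Hypothesis pK : psd K.
Hypothesis K1 : forall z w, K z w * (1 - hdot (x z) (x w)) = 1.

Definition col_contr (B : X -> nat -> C) := psd (fun p q : X * nat =>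
  ((p.2 == q.2)%:R - B p.1 p.2 * (B q.1 q.2)^*) * K p.1 q.1).

(* Limit of the finite factorisations along an ultrafilter of finite sets of points. *)
Lemma leech (f : X -> C) :
  psd (fun z w => (hdot (x z) (x w) - f z * (f w)^*) * K z w) ->
  exists B : X -> nat -> C, col_contr B /\
    forall z, exists2 u : E, (forall i, u i = (B z i)^*) & hdot (x z) u = f z.
Proof.
move=> pf.
have loc (s : seq X) : exists b : X -> nat -> C,
    (forall (J : finType) (p : J -> X * nat) (c : J -> C), (forall j, (p j).1 \in s) ->
      0 <= \sum_j \sum_k c j * (c k)^* * ((((p j).2 == (p k).2)%:R -
        b (p j).1 (p j).2 * (b (p k).1 (p k).2)^*) * K (p j).1 (p k).1)) /\
    forall z, z \in s -> exists2 u : E, (forall i, u i = (b z i)^*) & hdot (x z) u = f z.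
  pose y (j : seq_sub s) := x (ssval j).
  have [B [pB hB]] := @finite_leech R E (seq_sub s) y (fun j k => K (ssval j) (ssval k))
    (fun j => f (ssval j)) (fun j => x1 _) (psd_comp (@ssval _ s) pK)
    (fun j k => K1 _ _) (psd_comp (@ssval _ s) pf) nat (cdelta R d) (@psd_cdelta R d).
  pose b z i := if insub z is Some j then B j i else 0.
  have bE z (zs : z \in s) i : b z i = B (SeqSub zs) i.
    by rewrite /b; case: insubP => [j _ jz|]; [congr B; apply: val_inj | rewrite zs].
  exists b; split=> [J p c ps|z zs].
    have := pB J (fun j => (SeqSub (ps j), (p j).2)) c; congr (_ <= _).
    by apply: eq_bigr => j _; apply: eq_bigr => k _; rewrite !bE.
  have [u hu hf] := hB (SeqSub zs); exists u; last by rewrite -hf.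
  by move=> i; rewrite bE -hu dot_cdelta.
have [b hb] := choice loc.
pose G (A : set (seq X)) := exists s0 : seq X, forall s : seq X,
  {subset s0 <= s} -> A s.
have PG : ProperFilter G.
  split; first by move=> [s0 /(_ s0)]; apply.
  split; first by exists [::].
    move=> P Q [s hs] [t ht]; exists (s ++ t) => r hr; split.
      by apply: hs => z zs; apply: hr; rewrite mem_cat zs.
    by apply: ht => z zs; apply: hr; rewrite mem_cat zs orbT.
  by move=> P Q PQ [s hs]; exists s => r /hs/PQ.
have [U [UU GU]] := ultraFilterLemma PG.
have PU : ProperFilter U := @ultra_proper _ _ UU.
have FU : Filter U by exact: PU.
have Us (s0 : seq X) : \forall s \near U, {subset s0 <= s}.
  by apply: GU; exists s0.
have Uz z : \forall s \near U, z \in s.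
  by apply: GU; exists [:: z] => s h; apply: h; rewrite mem_head.
have bb s z N : z \in s -> \sum_(i < N) rnorm (b s z i) ^+ 2 <= 1.
  move=> zs; apply: (col_bound (kernel_diag_gt0 pK (K1 z z))) => c.
  have := (hb s).1 'I_N (fun i => (z, i : nat)) c (fun=> zs); congr (_ <= _).
  by apply: eq_bigr => i _; apply: eq_bigr => j _; rewrite /= mulrA.
have b1 s z i : z \in s -> rnorm (b s z i) <= 1.
  move=> /(bb s z i.+1); rewrite big_ord_recr /= => le.
  rewrite -(@ler_pXn2r _ 2) ?nnegrE ?rnorm_ge0 // expr1n.
  have : 0 <= \sum_(j < i) rnorm (b s z j) ^+ 2 by apply: sumr_ge0 => j _; exact: sqr_ge0.
  lra.
have ex p : exists l : C, (fun s => b s p.1 p.2) @ U --> l.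
  case: p => z i /=.
  (* The bound on [b s z i] holds once [z] is in [s]; truncation makes it global without changing
     the limit. *)
  have [|l hl] := @ultra_bounded_cvgC R _ U (fun s => if z \in s then b s z i else 0) 1 UU.
    by move=> s; case: ifP => [/b1//|_]; rewrite rnorm0.
  exists l; apply: cvg_trans hl; apply: near_eq_cvg.
  by apply: filterS (Uz z) => s /= ->.
have [L hL] := choice ex.
pose B z i := L (z, i).
have hB z i : (fun s => b s z i) @ U --> B z i by exact: (hL (z, i)).
exists B; split.
  apply: (@psd_cvg R _ U PU _ (fun s (p q : X * nat) => ((p.2 == q.2)%:R -
     b s p.1 p.2 * (b s q.1 q.2)^*) * K p.1 q.1)) => [p q|J p c].
    apply: cvgM; last exact: cvg_cst.
    apply: cvgB; first exact: cvg_cst.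
    by apply: cvgM; [exact: hB | apply: cvg_conjc; exact: hB].
  apply: filterS (Us [seq (p j).1 | j : J]) => s hs; apply: (hb s).1 => j.
  by apply: hs; apply/mapP; exists j; rewrite ?mem_enum.
move=> z.
have B1 N : \sum_(i < N) rnorm (B z i) ^+ 2 <= 1.
  rewrite -lecR -subr_ge0; apply: (@ge0_cvgC R _ U PU
     (fun s => 1 - \sum_(i < N) b s z i * (b s z i)^*)).
    apply: cvgB; first exact: cvg_cst.
    rewrite rmorph_sum /=; apply: cvg_sumC => i; rewrite -mulcJ.
    by apply: cvgM; [exact: hB | apply: cvg_conjc; exact: hB].
  apply: filterS (Uz z) => s /(bb s z N).
  rewrite -lecR -subr_ge0 rmorph_sum /=; congr (_ <= _ - _).
  by apply: eq_bigr => i _; rewrite mulcJ.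
have uP : (fun i => (B z i)^*) \in square_summable d.
  apply/asboolP; split=> [n nd|].
    rewrite (cvgC_near_cst PU (hB z n) (c := 0)) ?conjc0 //.
    apply: filterS (Uz z) => s zs.
    have [u hu _] := (hb s).2 z zs; apply/eqP; rewrite -conjc_eq0 -hu.
    by rewrite coord_out.
  apply: (@cvg_sqnorms _ _ 1) => N; rewrite /sqnorms /series /= big_mkord.
  by under eq_bigr do rewrite rnormJ.
pose u : E := CSpace uP; exists u => //.
have un : rnorm u <= 1.
  by apply: rnorm_le_bound => // N; rewrite expr1n; under eq_bigr do rewrite rnormJ.
(* Only coordinates converge, so [hdot (x z) (u - us)] is cut at [N]: the head is small along the
   ultrafilter, the tail because [tail N (x z)] is small and [|u - us| <= 2]. *)
apply/eqP; rewrite -subr_eq0; apply/eqP; apply: rnorm0_eq0; apply/eqP.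
rewrite eq_le rnorm_ge0 andbT; apply/ler_addgt0Pr => e e0; rewrite add0r.
have e4 : 0 < (e / 4) ^+ 2 by rewrite exprn_gt0 // divr_gt0.
have /cvgrPdist_lt/(_ _ e4)[N _ /(_ N (leqnn N))] := cvg_tail0 (x z).
rewrite /= sub0r normrN ger0_norm ?sqr_ge0 // ltr_pXn2r ?nnegrE ?rnorm_ge0 //; last first.
  by rewrite divr_ge0 ?ltW.
move=> hN.
have cz : (fun s => \sum_(i < N) x z i * ((B z i) - b s z i)) @ U --> \sum_(i < N) x z i * (B z i - B z i).
  by apply: cvg_sumC => i; apply: cvgM; [exact: cvg_cst | apply: cvgB; [exact: cvg_cst | exact: hB]].
have /cvgCP/(_ _ (@divr_gt0 _ e 4 e0 ltac:(lra))) := cz => hs.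
have [s [zs]] := filter_ex (filterI (Uz z) hs).
rewrite big1 => [|i _]; last by rewrite subrr mulr0.
rewrite sub0r rnormN => hs4.
have [us hus hf] := (hb s).2 z zs.
have usn : rnorm us <= 1.
  apply: rnorm_le_bound => // M; rewrite expr1n.
  by under eq_bigr do rewrite hus rnormJ; exact: bb.
rewrite (_ : _ - f z = hdot (tail N (x z)) (tail N (u - us)) +
    \sum_(i < N) x z i * ((u - us : E) i)^*); last by rewrite dot_tail subrK dotBr hf.
apply: le_trans (ler_rnormD _ _) _.
have -> : \sum_(i < N) x z i * ((u - us : E) i)^* = \sum_(i < N) x z i * (B z i - b s z i).
  by apply: eq_bigr => i _; rewrite coordB hus rmorphB /= !conjcK.
have t1 : rnorm (hdot (tail N (x z)) (tail N (u - us))) <= e / 4 * 2.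
  apply: le_trans (cauchy_schwarz _ _) _; apply: ler_pM; rewrite ?rnorm_ge0 //.
    exact: ltW.
  have : rnorm (tail N (u - us)) <= rnorm (u - us).
    rewrite -(@ler_pXn2r _ 2) ?nnegrE ?rnorm_ge0 // sqr_rnorm_tail lerBlDr lerDl.
    by apply: sumr_ge0 => i _; exact: sqr_ge0.
  have := ler_rnormD u (- us); rewrite rnormN; lra.
lra.
Qed.

End Leech.

(** * Completely contractive homomorphisms and point evaluations *)

Section KernelAlgebra.
Variables (R : realType).
Local Notation C := R[i].

Section OneKernel.
Variables (X : Type) (k : X -> X -> C).
Hypothesis pk : psd k.

Lemma bdd_cst (a : C) : bdd k (fun=> a).
Proof.
exists (rnorm a); apply: eq_psd (psdZ (lexx 0) pk) => z w.
by rewrite mul0r mulcJ subrr mul0r.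
Qed.

Lemma bdd_le1 (f : X -> C) : psd (fun z w => (1 - f z * (f w)^*) * k z w) -> bdd k f.
Proof. by move=> h; exists 1; rewrite expr1n. Qed.

Lemma bddM (f g : X -> C) : bdd k f -> bdd k g -> bdd k (f * g).
Proof.
move=> [M hM] [N hN]; exists (M * N).
have N0 : 0 <= (N ^+ 2)%:C :> C by rewrite lecR sqr_ge0.
apply: eq_psd (psdD (psdZ N0 hM) (psd_congr f hN)) => z w.
have -> v : (f * g) v = f v * g v by [].
rewrite conjcM exprMn rmorphM; ring.
Qed.

Lemma bddD (f g : X -> C) : bdd k f -> bdd k g -> bdd k (f + g).
Proof.
(* The parallelogram identity: twice the two given kernels exceed the required one by a congruence
   of [k] by [f - g], hence the bound [2 M^2 + 2 N^2]. *)
move=> [M hM] [N hN]; exists (Num.sqrt (2 * M ^+ 2 + 2 * N ^+ 2)).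
have S0 : 0 <= 2 * M ^+ 2 + 2 * N ^+ 2 by rewrite addr_ge0 // mulr_ge0 ?sqr_ge0.
have two : 0 <= 2 :> C by [].
apply: eq_psd (psdD (psdD (psdZ two hM) (psdZ two hN))
  (psd_congr (fun z => f z - g z) pk)) => z w.
have -> v : (f + g) v = f v + g v by [].
have e2 : (2 : R)%:C = 2 by rewrite -(rmorph_nat (real_complex R)).
have -> : (f w - g w)^* = (f w)^* - (g w)^* by rewrite rmorphB.
rewrite sqr_sqrtr // rmorphD !rmorphM /= e2 conjcD; ring.
Qed.

Lemma bddZ (a : C) (f : X -> C) : bdd k f -> bdd k (a *: f).
Proof. by move=> bf; exact: (bddM (bdd_cst a) bf). Qed.

Lemma bddB (f g : X -> C) : bdd k f -> bdd k g -> bdd k (f - g).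
Proof. by move=> bf bg; rewrite -scaleN1r; apply: bddD => //; exact: bddZ. Qed.

Lemma bdd0 : bdd k 0.
Proof. exact: bdd_cst. Qed.

Lemma bdd_sum n (f : nat -> X -> C) : (forall i, bdd k (f i)) ->
  bdd k (\sum_(i < n) f i).
Proof.
by move=> bf; elim/big_ind: _ => //; [exact: bdd0 | exact: bddD].
Qed.

Definition row_contr n (r : nat -> X -> C) :=
  psd (fun z w => (1 - \sum_(i < n) r i z * (r i w)^*) * k z w).

Lemma row_contr_bdd n r i : (i < n)%N -> row_contr n r -> bdd k (r i).
Proof.
move=> ilt h; apply: bdd_le1.
have p2 : psd (fun z w => (\sum_(j < n | j != Ordinal ilt) r j z * (r j w)^*) * k z w).
  apply: eq_psd (psd_sum [seq j <- index_enum 'I_n | j != Ordinal ilt]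
    (fun j : 'I_n => psd_congr (r j) pk)) => z w.
  by rewrite big_filter mulr_suml.
by apply: eq_psd (psdD h p2) => z w; rewrite (bigD1 (Ordinal ilt)) //=; ring.
Qed.

(** [contr] concerns square matrices, so rows and columns are padded by zeros; size [n.+1] provides
    the index [ord0]. *)
Definition row_mx_of n (r : nat -> X -> C) : 'M[X -> C]_n.+1 :=
  \matrix_(i, j) if i == ord0 then r j else 0.

Definition col_mx_of n (r : nat -> X -> C) : 'M[X -> C]_n.+1 :=
  \matrix_(i, j) if j == ord0 then r i else 0.

Lemma contr_row n (r : nat -> X -> C) : contr k (row_mx_of n r) <-> row_contr n.+1 r.
Proof.
split=> h.
  apply: eq_psd (psd_comp (fun z => (z, ord0)) h) => z w /=.
  by congr ((_ - _) * _); apply: eq_bigr => j _; rewrite !mxE eqxx.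
(* The row affects only the block at [ord0]; the other diagonal blocks are copies of [k]. *)
pose e i (p : X * 'I_n.+1) : C := (p.2 == i)%:R.
have p1 := psd_congr (e ord0) (psd_comp (@fst X 'I_n.+1) h).
have p2 := psd_sum [seq i <- index_enum 'I_n.+1 | i != ord0]
  (fun i => psd_congr (e i) (psd_comp (@fst X 'I_n.+1) pk)).
apply: eq_psd (psdD p1 p2) => p q.
rewrite big_filter -mulr_suml.
have e_nat i s : (e i s)^* = e i s by exact: conjc_nat.
have -> : (p.2 == q.2)%:R = e ord0 p * (e ord0 q)^* +
    \sum_(i < n.+1 | i != ord0) e i p * (e i q)^*.
  rewrite -sum_delta (bigD1 ord0) //= e_nat; congr (_ + _).
  by apply: eq_bigr => i _; rewrite e_nat.
have rE a c z : row_mx_of n r a c z = (a == ord0)%:R * r c z.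
  by rewrite mxE; case: eqP => _; rewrite ?mul1r ?mul0r.
have -> : \sum_c row_mx_of n r p.2 c p.1 * (row_mx_of n r q.2 c q.1)^* =
    e ord0 p * (e ord0 q)^* * \sum_(i < n.+1) r i p.1 * (r i q.1)^*.
  rewrite mulr_sumr; apply: eq_bigr => j _; rewrite !rE conjcM.
  by rewrite -/(e ord0 p) -/(e ord0 q); ring.
set u := \sum_(i < n.+1) _; set v := \sum_(i < n.+1 | _) _.
move: (e ord0 p * _) (k _ _) => a b; rewrite mulrBl; ring.
Qed.

Lemma contr_col n (r : nat -> X -> C) :
  contr k (col_mx_of n r) <-> psd (fun p q : X * 'I_n.+1 =>
  ((p.2 == q.2)%:R - r p.2 p.1 * (r q.2 q.1)^*) * k p.1 q.1).
Proof.
have E (p q : X * 'I_n.+1) :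
  ((p.2 == q.2)%:R - \sum_c col_mx_of n r p.2 c p.1 * (col_mx_of n r q.2 c q.1)^*) * k p.1 q.1
  = ((p.2 == q.2)%:R - r p.2 p.1 * (r q.2 q.1)^*) * k p.1 q.1.
  congr ((_ - _) * _); rewrite (bigD1 ord0) //= !mxE eqxx big1 ?addr0 // => j j0.
  by rewrite !mxE (negbTE j0) [(0 : X -> C) _]/(0 : C) mul0r.
by split; [exact: (eq_psd E) | exact: (eq_psd (fun p q => esym (E p q)))].
Qed.

End OneKernel.

(** Formulated through [bdd] and [contr] alone, so that it survives the rescaling of either kernel
    caused by an involution of the ball. *)
Record cc_hom (X Y : Type) (kX : X -> X -> C) (kY : Y -> Y -> C)
    (phi : (X -> C) -> (Y -> C)) : Prop := CCHom {
  cc_bdd : forall f, bdd kX f -> bdd kY (phi f);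
  cc_lin : forall (a : C) f g, bdd kX f -> bdd kX g ->
    phi (a *: f + g) = a *: phi f + phi g;
  cc_mul : forall f g, bdd kX f -> bdd kX g -> phi (f * g) = phi f * phi g;
  cc_one : phi (fun=> 1) = (fun=> 1);
  cc_contr : forall n (A : 'M[X -> C]_n), (forall i j, bdd kX (A i j)) ->
    contr kX A -> contr kY (map_mx phi A) }.

Section Hom.
Variables (X Y : Type) (kX : X -> X -> C) (kY : Y -> Y -> C).
Variable (phi : (X -> C) -> (Y -> C)).
Hypotheses (pX : psd kX) (pY : psd kY) (hphi : cc_hom kX kY phi).

Lemma cc0 : phi 0 = 0.
Proof.
have := cc_lin hphi (-1) (bdd0 pX) (bdd0 pX).
by rewrite !scaleN1r !addNr.
Qed.

Lemma ccD f g : bdd kX f -> bdd kX g -> phi (f + g) = phi f + phi g.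
Proof. by move=> bf bg; have := cc_lin hphi 1 bf bg; rewrite !scale1r. Qed.

Lemma ccZ (a : C) f : bdd kX f -> phi (a *: f) = a *: phi f.
Proof. by move=> bf; have := cc_lin hphi a bf (bdd0 pX); rewrite cc0 !addr0. Qed.

Lemma ccB f g : bdd kX f -> bdd kX g -> phi (f - g) = phi f - phi g.
Proof.
move=> bf bg; have := cc_lin hphi (-1) bg bf.
by rewrite !scaleN1r addrC [X in _ = X]addrC.
Qed.

Lemma cc_cst (a : C) : phi (fun=> a) = (fun=> a).
Proof.
have -> : (fun=> a) = a *: (fun=> 1) :> (X -> C).
  by apply/funext => z; exact: (esym (mulr1 a)).
rewrite ccZ; last exact: bdd_cst.
by rewrite (cc_one hphi); apply/funext => z; exact: (mulr1 a).
Qed.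

Lemma cc_sum n (f : nat -> X -> C) : (forall i, bdd kX (f i)) ->
  phi (\sum_(i < n) f i) = \sum_(i < n) phi (f i).
Proof.
move=> bf; elim: n => [|n IH]; first by rewrite !big_ord0 cc0.
by rewrite !big_ord_recr /= ccD ?IH //; exact: bdd_sum.
Qed.

Lemma cc_row n (r : nat -> X -> C) : row_contr kX n r -> row_contr kY n (fun i => phi (r i)).
Proof.
case: n => [|n] h.
  by apply: eq_psd pY => z w; rewrite big_ord0 subr0 mul1r.
apply/contr_row => //.
have -> : row_mx_of n (fun i => phi (r i)) = map_mx phi (row_mx_of n r).
  by apply/matrixP => i j; rewrite !mxE; case: eqP => // _; rewrite cc0.
apply: (cc_contr hphi); last by apply/contr_row.
move=> i j; rewrite mxE; case: eqP => // _; last exact: bdd0.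
by apply: row_contr_bdd h; [exact: pX|exact: ltn_ord].
Qed.

(** A positivity test meets finitely many indices, so it suffices to map finite sections of the
    infinite column. *)
Lemma cc_col (B : nat -> X -> C) : (forall i, bdd kX (B i)) ->
  psd (fun p q : X * nat => ((p.2 == q.2)%:R - B p.2 p.1 * (B q.2 q.1)^*) * kX p.1 q.1) ->
  psd (fun p q : Y * nat =>
    ((p.2 == q.2)%:R - phi (B p.2) p.1 * (phi (B q.2) q.1)^*) * kY p.1 q.1).
Proof.
move=> bB h J p c.
pose n := \max_j (p j).2.
have lt j : ((p j).2 < n.+1)%N by rewrite ltnS; exact: (leq_bigmax j).
have : contr kY (map_mx phi (col_mx_of n B)).
  apply: (cc_contr hphi) => [i j|].
    by rewrite mxE; case: eqP => // _; exact: bdd0.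
  by apply/contr_col; exact: (psd_comp (fun p : X * 'I_n.+1 => (p.1, p.2 : nat)) h).
have -> : map_mx phi (col_mx_of n B) = col_mx_of n (fun i => phi (B i)).
  by apply/matrixP => i j; rewrite !mxE; case: eqP => // _; rewrite cc0.
move=> /contr_col /(_ J (fun j => ((p j).1, Ordinal (lt j))) c).
by congr (_ <= _).
Qed.

Lemma row_le1 n (r : nat -> Y -> C) w : 0 < kY w w -> row_contr kY n r ->
  \sum_(i < n) rnorm (r i w) ^+ 2 <= 1.
Proof.
move=> k0 h; have := psd_diag_ge0 w h.
rewrite pmulr_lge0 // subr_ge0 -lecR rmorph_sum; congr (_ <= _).
by apply: eq_bigr => i _; rewrite mulcJ.
Qed.

End Hom.

End KernelAlgebra.

(** * The kernel of the ball and its coordinate multipliers *)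

Section BallKernel.
Variables (R : realType) (d : option nat).
Local Notation C := R[i].
Local Notation E := (cspace R d).
Local Notation ball := (unit_ball R d).

Lemma rnorm_ball (z : ball) : rnorm (z : E) < 1.
Proof. by rewrite -ltcR rnormE; exact: valP z. Qed.

Lemma rnorm_dot_ball (z w : ball) : rnorm (hdot (z : E) (w : E)) < 1.
Proof.
apply: le_lt_trans (cauchy_schwarz _ _) _.
have := rnorm_ball z; have := rnorm_ball w.
have := rnorm_ge0 (z : E); have := rnorm_ge0 (w : E); nra.
Qed.

Lemma dot_ball_neq1 (z w : ball) : 1 - hdot (z : E) (w : E) != 0.
Proof.
rewrite subr_eq0; apply/eqP => h; have := rnorm_dot_ball z w.
by rewrite -h rnorm1 ltxx.
Qed.

Lemma da_kernel1 (z w : ball) : da_kernel z w * (1 - hdot (z : E) (w : E)) = 1.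
Proof. by rewrite mulVf // dot_ball_neq1. Qed.

Lemma mk_ball (z : E) : rnorm z < 1 -> {b : ball | ball_pt b = z}.
Proof.
move=> h; have hb : `|z| < 1 by rewrite -rnormE ltcR.
by exists (UnitBall hb).
Qed.

Definition ball0 : ball := sval (@mk_ball 0 ltac:(by rewrite rnorm0)).

Lemma ball0E : ball_pt ball0 = 0.
Proof. exact: (svalP (mk_ball _)). Qed.

Lemma cvg_dot (x y : E) : (fun N => \sum_(i < N) x i * (y i)^*) @ \oo --> hdot x y.
Proof.
apply/cvgCP => e e0.
have q0 : 0 < 1 + rnorm y by have := rnorm_ge0 y; lra.
have /cvgrPdist_lt/(_ ((e / (1 + rnorm y)) ^+ 2)) := cvg_tail0 x.
move=> /(_ ltac:(by rewrite exprn_gt0 // divr_gt0)); apply: filterS => N.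
rewrite sub0r normrN ger0_norm ?sqr_ge0 // -dot_tail.
rewrite ltr_pXn2r ?nnegrE ?rnorm_ge0 ?divr_ge0 //; [|exact: ltW|exact: ltW].
rewrite ltr_pdivlMr // => lt; apply: le_lt_trans (cauchy_schwarz _ _) _.
have : rnorm (tail N y) <= rnorm y.
  rewrite -(@ler_pXn2r _ 2) ?nnegrE ?rnorm_ge0 // sqr_rnorm_tail lerBlDr lerDl.
  by apply: sumr_ge0 => i _; exact: sqr_ge0.
have := rnorm_ge0 (tail N x); have := rnorm_ge0 (tail N y); nra.
Qed.

Variable H : drury_arveson R d.

Section Map.
Variables (X : Type) (x : X -> ball).
Let Q z w := hdot (x z : E) (x w : E).

Definition kmap (z w : X) : C := da_kernel (x z) (x w).

Lemma psd_kmap : psd kmap.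
Proof. exact: (psd_comp x (psd_kernel H)). Qed.

Lemma kmap1 z w : kmap z w * (1 - Q z w) = 1.
Proof. exact: da_kernel1. Qed.

Lemma psd_one : psd (fun _ _ : X => 1 : C).
Proof. by apply: eq_psd (psd_rank1 (fun=> 1 : C)) => z w; rewrite conjc1 mulr1. Qed.

Lemma kmap_gt0 z : 0 < kmap z z.
Proof. exact: (kernel_diag_gt0 psd_kmap (kmap1 z z)). Qed.

Definition zcoord i (z : X) : C := (x z : E) i.

(** Subtracting the first [n] coordinates leaves the kernel [1 + <tail z, tail w> K], by [kmap1]. *)
Lemma row_contr_coords n : row_contr kmap n zcoord.
Proof.
apply: eq_psd (psdD psd_one (psdM (psd_gram (fun z => tail n (x z : E))) psd_kmap)) => z w.
rewrite dot_tail -[1 in LHS](kmap1 z w) /Q /zcoord; ring.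
Qed.

Lemma bdd_coord i : bdd kmap (zcoord i).
Proof.
by apply: (row_contr_bdd psd_kmap (ltnSn i)); exact: row_contr_coords.
Qed.

(* [m m^* K <= 1] has rank one, so [m] vanishes unless [X] is a single point. *)
Lemma rank_one_multiplier (m : X -> C) z1 z2 : x z1 <> x z2 ->
  psd (fun z w => 1 - m z * (m w)^* * kmap z w) -> m = 0.
Proof.
move=> n12 h.
pose k z := rkhs_kernel H (x z).
(* The coefficients [1, -1] annihilate the constant kernel 1 and leave minus a squared norm, so the
   vector [conj (m z) k_z] is the same for all [z]. *)
have eqk z w : (m z)^* *: k z = (m w)^* *: k w.
  apply/eqP; rewrite -subr_eq0; apply/eqP; apply: rnorm0_eq0; apply/eqP.
  rewrite -sqrf_eq0 eq_le sqr_ge0 andbT -oppr_ge0 -lecR rmorphN /= -dot_rnorm.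
  have := psd2 z w 1 (-1) h; congr (_ <= _).
  rewrite !dotBl !dotBr !dotZl !dotZr !conjcK /k -!kernel_dot /kmap conjcN conjc1; ring.
have ne0 z w : x z <> x w -> m z = 0.
  move=> nzw.
  have ev (u : ball) : (m z)^* * da_kernel u (x z) = (m w)^* * da_kernel u (x w).
    have := congr1 (fun g => hdot g (rkhs_kernel H u)) (eqk z w).
    by rewrite !dotZl -!kernel_dot.
  (* All kernel functions equal 1 at the origin. If the common value of [m] were nonzero, the kernel
     functions themselves, hence the points, would coincide. *)
  have mm : (m z)^* = (m w)^*.
    by have := ev ball0; rewrite /da_kernel ball0E !dot0l subr0 invr1 !mulr1.
  apply/eqP; rewrite -conjc_eq0; apply: contrapT => /negP mz; apply: nzw.
  have ev2 (u : ball) : hdot (u : E) (x z : E) = hdot (u : E) (x w : E).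
    have := ev u; rewrite -mm => /(mulfI mz)/invr_inj e.
    by rewrite -[LHS](subKr 1) e subKr.
  apply: val_inj; apply/eqP; rewrite -subr_eq0; apply/eqP; apply: dot_ext0 => u.
  set D := (_ - _).
  have q0 : 0 < 1 + rnorm u by have := rnorm_ge0 u; lra.
  have [|b bE] := @mk_ball ((1 + rnorm u)^-1%:C *: u).
    rewrite rnormZ rnorm_real ger0_norm ?invr_ge0; last exact: ltW.
    by rewrite mulrC ltr_pdivrMr // mul1r; lra.
  have : hdot (b : E) D = 0 by rewrite dotBr ev2 subrr.
  rewrite bE dotZl => /eqP; rewrite mulf_eq0 => /orP[|/eqP//].
  by rewrite fmorph_eq0 invr_eq0 gt_eqF.
apply/funext => z; have [e|/ne0//] := pselect (x z = x z1).
by apply: (@ne0 z z2); rewrite e.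
Qed.

End Map.

End BallKernel.

(** * Images of the coordinates and vanishing of factored multipliers *)

Section Evaluation.
Variables (R : realType) (d : option nat) (H : drury_arveson R d).
Local Notation C := R[i].
Local Notation E := (cspace R d).
Local Notation ball := (unit_ball R d).

Lemma mk_cspace (a : nat -> C) : (forall i, ~~ in_dim d i -> a i = 0) ->
  (forall N, \sum_(i < N) rnorm (a i) ^+ 2 <= 1) ->
  exists2 u : E, (forall i, u i = a i) & rnorm u <= 1.
Proof.
move=> a0 a1; have uP : a \in square_summable d.
  apply/asboolP; split=> //; apply: (@cvg_sqnorms _ _ 1) => N.
  by rewrite /sqnorms /series /= big_mkord.
by exists (CSpace uP) => //; apply: rnorm_le_bound => // N; rewrite expr1n.
Qed.

Lemma psd_push (X : Type) n (s : X -> nat -> C) (M : X * nat -> X * nat -> C) :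
  psd M -> psd (fun z w =>
    \sum_(a < n) \sum_(b < n) s z a * (s w b)^* * M (z, a : nat) (w, b : nat)).
Proof.
move=> h J x c.
have := h (J * 'I_n)%type (fun p => (x p.1, p.2 : nat)) (fun p => c p.1 * s (x p.1) p.2).
congr (_ <= _); rewrite -(pair_bigA _ (fun (j : J) (a : 'I_n) => \sum_(q : J * 'I_n)
  c j * s (x j) a * (c q.1 * s (x q.1) q.2)^* * M (x j, a : nat) (x q.1, q.2 : nat))) /=.
apply: eq_bigr => j _.
under [LHS]eq_bigr => a _ do rewrite -(pair_bigA _ (fun (k : J) (b : 'I_n) =>
  c j * s (x j) a * (c k * s (x k) b)^* * M (x j, a : nat) (x k, b : nat))) /=.
rewrite exchange_big; apply: eq_bigr => k _ /=.
rewrite mulr_sumr; apply: eq_bigr => a _; rewrite mulr_sumr; apply: eq_bigr => b _.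
rewrite conjcM; ring.
Qed.

(** A row [t] times a contractive column [B]: compressing the positive column kernel by partial sums
    of [t] ([psd_push]) and passing to the limit shows that the product is dominated by [t]. *)
Lemma psd_row_col (X : Type) (K : X -> X -> C) (B : X -> nat -> C) (u t : X -> E) :
  psd (fun p q : X * nat => ((p.2 == q.2)%:R - B p.1 p.2 * (B q.1 q.2)^*) * K p.1 q.1) ->
  (forall z i, u z i = (B z i)^*) ->
  psd (fun z w => (hdot (t z) (t w) - hdot (t z) (u z) * (hdot (t w) (u w))^*) * K z w).
Proof.
move=> hB hu.
have ct z : (fun n => \sum_(i < n) t z i * B z i) @ \oo --> hdot (t z) (u z).
  have := @cvg_dot R d (t z) (u z).
  by under [X in X @ _]eq_fun do under eq_bigr do rewrite hu conjcK.
apply: (@psd_cvg R nat \oo _ X (fun n z w => (\sum_(i < n) t z i * (t w i)^* -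
   (\sum_(i < n) t z i * B z i) * (\sum_(i < n) t w i * B w i)^*) * K z w)) => [z w|J x c].
  apply: cvgM; last exact: cvg_cst.
  apply: cvgB; first exact: cvg_dot.
  by apply: cvgM; [exact: ct | apply: cvg_conjc; exact: ct].
apply: nearW => n; move: J x c.
suff : psd (fun z w => (\sum_(i < n) t z i * (t w i)^* -
   (\sum_(i < n) t z i * B z i) * (\sum_(i < n) t w i * B w i)^*) * K z w) by [].
apply: eq_psd (psd_push n (fun z i => t z i) hB) => z w.
rewrite mulrBl [X in _ = X - _]mulr_suml [X in _ = _ - X]mulrC.
rewrite conjc_sum mulr_suml mulr_sumr -sumrB; apply: eq_bigr => a _.
transitivity (\sum_(b < n) (((a == b)%:R * (t z a * (t w b)^* * K z w)) -
   K z w * (t z a * B z a) * (t w b * B w b)^*)).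
  by apply: eq_bigr => b _; rewrite /= conjcM -val_eqE /=; ring.
rewrite sumrB; congr (_ - _); last by rewrite -mulr_sumr; ring.
rewrite (bigD1 a) //= eqxx mul1r big1 ?addr0 // => b ba.
by rewrite eq_sym (negbTE ba) mul0r.
Qed.

Variables (X : choiceType) (Y : Type) (x : X -> ball) (y : Y -> ball).
Local Notation kX := (kmap x).
Local Notation kY := (kmap y).
Variables (phi : (X -> C) -> (Y -> C)) (psi : (Y -> C) -> (X -> C)).
Hypotheses (hphi : cc_hom kX kY phi) (hpsi : cc_hom kY kX psi).
Hypothesis phiK : forall f, bdd kX f -> psi (phi f) = f.
Hypothesis psiK : forall f, bdd kY f -> phi (psi f) = f.
Variables (z1 z2 : X).
Hypothesis z12 : x z1 <> x z2.

Let pX := psd_kmap H x.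
Let pY := psd_kmap H y.

Lemma image_coords : exists2 F : Y -> E,
  (forall w i, F w i = phi (zcoord x i) w) & forall w, rnorm (F w) <= 1.
Proof.
have ex w : exists u : E, (forall i, u i = phi (zcoord x i) w) /\ rnorm u <= 1.
  have [i di|N|u hu u1] := @mk_cspace (fun i => phi (zcoord x i) w).
  - have -> : zcoord x i = 0 by apply/funext => z; exact: coord_out.
    by rewrite (cc0 pX hphi).
  - exact: (row_le1 (kmap_gt0 H y w) (cc_row pX pY hphi (row_contr_coords H x N))).
  by exists u.
have [F hF] := choice ex.
by exists F => [w i|w]; case: (hF w).
Qed.

(* Leech: [f = \sum_i x_i g_i] with a contractive column [g]. The images of the
   partial sums vanish at [w0]; the images of the remainders converge to a function
   extending the coordinate row to a longer contractive row, so its preimage [m]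
   satisfies [1 - m m^* K >= 0] and vanishes. *)
Lemma factor_vanish (f : X -> C) (w0 : Y) :
  psd (fun z w => (hdot (x z : E) (x w : E) - f z * (f w)^*) * kX z w) ->
  (forall i, phi (zcoord x i) w0 = 0) -> phi f w0 = 0.
Proof.
move=> pf Fw0.
have [B [hB hBu]] := leech (fun z => rnorm_ball (x z)) pX
  (fun z w => da_kernel1 (x z) (x w)) pf.
have ex z : exists u : E, (forall i, u i = (B z i)^*) /\ hdot (x z : E) u = f z.
  by have [u] := hBu z; exists u.
have [u hu] := choice ex.
pose Bi i z := B z i.
have hBi : psd (fun p q : X * nat =>
    ((p.2 == q.2)%:R - Bi p.2 p.1 * (Bi q.2 q.1)^*) * kX p.1 q.1) by exact: hB.
have bB i : bdd kX (Bi i).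
  apply: bdd_le1; apply: eq_psd (psd_comp (fun z => (z, i)) hBi) => z w.
  by rewrite eqxx.
have bf : bdd kX f.
have pone := @psd_one R X.
  have p2 := psdD pf pone.
  apply: bdd_le1; move: p2; apply: eq_psd => z w.
  rewrite -[1 in LHS](da_kernel1 (x z) (x w)) -/(kX z w); ring.
pose e N := f - \sum_(i < N) zcoord x i * Bi i.
have bZB i : bdd kX (zcoord x i * Bi i) by apply: bddM => //; exact: bdd_coord.
have bS N : bdd kX (\sum_(i < N) zcoord x i * Bi i).
  exact: (bdd_sum pX N bZB).
have be N : bdd kX (e N).
  by apply: bddB.
have eE N z : e N z = hdot (tail N (x z : E)) (u z).
  have [hu1 hu2] := hu z.
  rewrite /tail dotBl hu2 dot_suml /e.
  rewrite [LHS]/(f z - (\sum_(i < N) zcoord x i * Bi i) z) fct_sumE; congr (_ - _).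
  by apply: eq_bigr => i _; rewrite dotZl dot_cdeltal hu1 conjcK.
pose rr (T : Type) n (g : T -> C) (r : nat -> T -> C) i := if (i < n)%N then r i else g.
have rrE (T : Type) n (g : T -> C) (r : nat -> T -> C) z w :
    \sum_(i < n.+1) rr T n g r i z * (rr T n g r i w)^* =
    \sum_(i < n) r i z * (r i w)^* + g z * (g w)^*.
  rewrite big_ord_recr /= /rr ltnn; congr (_ + _).
  by apply: eq_bigr => i _; rewrite ltn_ord.
(* What remains is [1], plus [K] times the coordinates from [n] to [N], plus [K] times
   [<tail z, tail w>] minus the remainder; the last term is positive because the remainder is the
   row [tail N x] times the column [B]. *)
have row1 n N : (n <= N)%N -> row_contr kX n.+1 (rr X n (e N) (zcoord x)).
  move=> nN.
  have pt := psd_row_col (fun z => tail N (x z : E)) hB (fun z => (hu z).1).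
  have pm := psdM (psd_sum (index_iota n N)
     (fun i => psd_rank1 (fun z => (x z : E) i))) pX.
  apply: eq_psd (psdD (psdD pm pt) (@psd_one R X)) => z w.
  rewrite rrE !eE dot_tail -!(big_mkord xpredT (fun i => (x z : E) i * ((x w : E) i)^*)).
  have cat : \sum_(0 <= i < N) (x z : E) i * ((x w : E) i)^* =
      \sum_(0 <= i < n) (x z : E) i * ((x w : E) i)^* +
      \sum_(n <= i < N) (x z : E) i * ((x w : E) i)^* by exact: big_cat_nat.
  rewrite cat -[1 in LHS](da_kernel1 (x z) (x w)) -/(kX z w).
  rewrite /zcoord; ring.
have rphi (T T' : Type) (p : (T -> C) -> (T' -> C)) n g r :
    (fun i => p (rr T n g r i)) = rr T' n (p g) (fun i => p (r i)).
  by apply/funext => i; rewrite /rr; case: ifP.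
have row2 n N : (n <= N)%N ->
    row_contr kY n.+1 (rr Y n (phi (e N)) (fun i => phi (zcoord x i))).
  by move=> /row1 /(cc_row pX pY hphi); rewrite rphi.
have [F hF F1] := image_coords.
have col2 := cc_col pX hphi bB hBi.
have exg w : exists g : E, (forall i, g i = (phi (Bi i) w)^*) /\ rnorm g <= 1.
  have [i di|N|g hg g1] := @mk_cspace (fun i => (phi (Bi i) w)^*); last by exists g.
    have -> : Bi i = 0.
      apply/funext => z; have [/(_ i) + _] := hu z.
      by rewrite coord_out // => /esym/eqP; rewrite conjc_eq0 => /eqP.
    by rewrite (cc0 pX hphi) conjc0.
  under eq_bigr do rewrite rnormJ.
  apply: (@col_bound R (fun i => phi (Bi i) w) (kY w w) N (kmap_gt0 H y w)) => c.
  have := col2 'I_N (fun i => (w, i : nat)) c; congr (_ <= _).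
  by apply: eq_bigr => i _; apply: eq_bigr => j _; rewrite /= mulrA.
have [g hg] := choice exg.
(* [k] is the defect that weak-* continuity of [phi] would make 0. *)
pose k w := phi f w - hdot (F w) (g w).
have phie N w : phi (e N) w = phi f w - \sum_(i < N) F w i * (g w i)^*.
  rewrite (ccB hphi) // (cc_sum pX hphi N bZB).
  rewrite [LHS]/(phi f w - (\sum_(i < N) phi (zcoord x i * Bi i)) w) fct_sumE.
  congr (_ - _); apply: eq_bigr => i _.
  rewrite (cc_mul hphi) //; last exact: bdd_coord.
  by rewrite (hg w).1 conjcK hF.
have ck w : (fun N => phi (e N) w) @ \oo --> k w.
  under eq_fun do rewrite phie.
  by apply: cvgB; [exact: cvg_cst | exact: cvg_dot].
have row3 n : row_contr kY n.+1 (rr Y n k (fun i => phi (zcoord x i))).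
  apply: (@psd_cvg R nat \oo _ Y (fun N z w => (1 - (\sum_(i < n)
     phi (zcoord x i) z * (phi (zcoord x i) w)^* + phi (e N) z * (phi (e N) w)^*)) * kY z w)) => [z w|J p c].
    rewrite rrE; apply: cvgM; last exact: cvg_cst.
    apply: cvgB; first exact: cvg_cst.
    apply: cvgD; first exact: cvg_cst.
    by apply: cvgM; [exact: ck | apply: cvg_conjc; exact: ck].
  exists n => // N /= nN; have := row2 n N nN J p c; congr (_ <= _).
  by apply: eq_bigr => i _; apply: eq_bigr => j _; rewrite rrE.
have bk : bdd kY k.
  by have := row_contr_bdd pY (ltnSn 0) (row3 0%N).
pose m := psi k.
have row4 n : row_contr kX n.+1 (rr X n m (zcoord x)).
  have := cc_row pY pX hpsi (row3 n); rewrite rphi.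
  have -> : (fun i => psi (phi (zcoord x i))) = zcoord x.
    by apply/funext => i; rewrite phiK //; exact: bdd_coord.
  by [].
have m0 : m = 0.
  apply: (rank_one_multiplier H z12).
  have := @psd_cvg R nat \oo _ X (fun n z w => (1 - (\sum_(i < n)
     zcoord x i z * (zcoord x i w)^* + m z * (m w)^*)) * kX z w)
     (fun z w => 1 - m z * (m w)^* * kX z w).
  apply=> [z w|J p c].
    have -> : 1 - m z * (m w)^* * kX z w =
        (1 - (hdot (x z : E) (x w : E) + m z * (m w)^*)) * kX z w.
      rewrite -[1 in LHS](da_kernel1 (x z) (x w)) -/(kX z w); ring.
    apply: cvgM; last exact: cvg_cst.
    apply: cvgB; first exact: cvg_cst.
    by apply: cvgD; [exact: cvg_dot | exact: cvg_cst].
  apply: nearW => n; have := row4 n J p c; congr (_ <= _).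
  by apply: eq_bigr => i _; apply: eq_bigr => j _; rewrite rrE.
have k0 : k w0 = 0 by rewrite -(psiK bk) -/m m0 (cc0 pX hphi).
have F0 : F w0 = 0 by apply: cspaceP => i; rewrite hF Fw0.
by move/eqP: k0; rewrite subr_eq0 F0 dot0l => /eqP.
Qed.

End Evaluation.

(** * Involutions of the ball and rescaled kernels *)

Section BallInvolution.
Variables (R : realType) (d : option nat).
Local Notation C := R[i].
Local Notation E := (cspace R d).
Local Notation ball := (unit_ball R d).
Implicit Types (z w l : E).

Definition defect l : R := Num.sqrt (1 - rnorm l ^+ 2).

(* The involution of the ball exchanging [0] and [l]: with [P] the projection onto
   [C l] and [Q = 1 - P], the numerator is [l - P z - defect l *: Q z]. *)
Definition theta_vec l z : E :=
  (1 - hdot z l)^-1 *: (l - (defect l)%:C *: z -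
     (hdot z l / (1 + (defect l)%:C)) *: l).

Section Base.
Variable l : E.
Hypothesis l1 : rnorm l < 1.
Let s : C := (defect l)%:C.

Let d0 : 0 < defect l.
Proof.
rewrite sqrtr_gt0 subr_gt0 expr_lt1 ?rnorm_ge0 //.
Qed.

Lemma defect_neq0 : s != 0.
Proof. by rewrite fmorph_eq0 gt_eqF. Qed.

Lemma defect1_neq0 : 1 + s != 0.
Proof.
have -> : 1 + s = (1 + defect l)%:C by rewrite rmorphD.
by rewrite fmorph_eq0 gt_eqF // addr_gt0.
Qed.

Lemma dot_base : hdot l l = 1 - s ^+ 2.
Proof.
have dE : defect l ^+ 2 = 1 - rnorm l ^+ 2.
  by apply: sqr_sqrtr; rewrite subr_ge0 ltW // expr_lt1 ?rnorm_ge0.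
by rewrite dot_rnorm /s -rmorphXn dE rmorphB opprB addrC subrK.
Qed.

Lemma dot_base_neq1 z : rnorm z <= 1 -> 1 - hdot z l != 0.
Proof.
move=> z1; rewrite subr_eq0; apply/eqP => h.
have := cauchy_schwarz z l; rewrite -h rnorm1.
by apply/negP; rewrite -ltNge (le_lt_trans _ l1) // ler_piMl ?rnorm_ge0.
Qed.

Lemma dot_theta_vec z w : 1 - hdot z l != 0 -> 1 - hdot w l != 0 ->
  1 - hdot (theta_vec l z) (theta_vec l w) =
  s ^+ 2 * (1 - hdot z w) / ((1 - hdot z l) * (1 - hdot w l)^*).
Proof.
move=> z1 w1; have w1' : 1 - hdot l w != 0.
  by rewrite dotC -(conjc1 R) -conjcB conjc_eq0 w1.
rewrite /theta_vec dotZl dotZr !dotBl !dotBr !dotZl !dotZr dot_base.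
rewrite !conjcM !conjcV !conjcB !conjcD conjc1 conjc_real -/s -!(dotC l w).
have := defect1_neq0; have := w1'; have := z1.
move: (hdot z l) (hdot l w) (hdot z w) => a b q a1 b1 s1.
by field; rewrite a1 b1 s1.
Qed.

Lemma dot_theta_base z : 1 - hdot z l != 0 ->
  1 - hdot (theta_vec l z) l = s ^+ 2 / (1 - hdot z l).
Proof.
move=> z1; rewrite /theta_vec dotZl !dotBl !dotZl dot_base -/s.
have := defect1_neq0; have := z1.
by move: (hdot z l) => a a1 s1; field; rewrite a1 s1.
Qed.

Lemma theta_vecK z : 1 - hdot z l != 0 -> theta_vec l (theta_vec l z) = z.
Proof.
move=> z1; have s0 := defect_neq0; have s1 := defect1_neq0.
rewrite {1}/theta_vec dot_theta_base // -/s.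
have -> : hdot (theta_vec l z) l = 1 - s ^+ 2 / (1 - hdot z l).
  by rewrite -dot_theta_base // opprB addrC subrK.
apply: cspaceP => i; rewrite /theta_vec !(coordZ, coordB).
move: z1 s0 s1; rewrite -/s; move: (hdot z l) (z i) (l i) => a u v a1 s0 s1.
by field; rewrite a1 s0 s1.
Qed.

Lemma theta_vec_base : theta_vec l l = 0.
Proof.
have s0 := defect_neq0; have s1 := defect1_neq0.
apply: cspaceP => i; rewrite !(coordZ, coordB) dot_base -/s.
have -> : l i - s * l i - (1 - s ^+ 2) / (1 + s) * l i = 0 by field.
by rewrite mulr0.
Qed.

Lemma theta_vec_ball z : rnorm z < 1 -> rnorm (theta_vec l z) < 1.
Proof.
move=> z1; have n1 := dot_base_neq1 (ltW z1).
have e : 1 - rnorm (theta_vec l z) ^+ 2 =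
    defect l ^+ 2 * (1 - rnorm z ^+ 2) / rnorm (1 - hdot z l) ^+ 2.
  have e1 (w : E) : (1 - rnorm w ^+ 2)%:C = 1 - hdot w w by rewrite dot_rnorm rmorphB.
  have e2 (p q r : R) : (p * q / r)%:C = p%:C * q%:C / r%:C.
    by rewrite fmorph_div rmorphM.
  apply: complexI; rewrite e2 !e1 -mulcJ (dot_theta_vec n1 n1).
  by rewrite rmorphXn.
have : 0 < 1 - rnorm (theta_vec l z) ^+ 2.
  have p1 : 0 < 1 - rnorm z ^+ 2 by rewrite subr_gt0 expr_lt1 ?rnorm_ge0.
  have p2 : 0 < rnorm (1 - hdot z l).
    rewrite lt_neqAle eq_sym rnorm_ge0 andbT; apply: contra n1 => /eqP h.
    by apply/eqP; exact: rnorm0_eq0.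
  by rewrite e divr_gt0 ?mulr_gt0 ?exprn_gt0.
by rewrite subr_gt0 expr_lt1 ?rnorm_ge0.
Qed.

End Base.

Definition theta (l z : ball) : ball :=
  sval (mk_ball (theta_vec_ball (rnorm_ball l) (rnorm_ball z))).

Lemma thetaE (l z : ball) : ball_pt (theta l z) = theta_vec l z.
Proof. exact: (svalP (mk_ball _)). Qed.

Lemma thetaK (l : ball) : involutive (theta l).
Proof.
move=> z; apply: val_inj; rewrite /= !thetaE theta_vecK ?rnorm_ball //.
exact: dot_ball_neq1.
Qed.

Lemma theta_base (l : ball) : ball_pt (theta l l) = 0.
Proof. by rewrite thetaE theta_vec_base // rnorm_ball. Qed.

Lemma da_kernel_theta (l z w : ball) : da_kernel (theta l z) (theta l w) =
  ((1 - hdot (z : E) (l : E)) / (defect l)%:C) *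
  ((1 - hdot (w : E) (l : E)) / (defect l)%:C)^* * da_kernel z w.
Proof.
have z1 := dot_ball_neq1 z l; have w1 := dot_ball_neq1 w l.
have zw := dot_ball_neq1 z w.
rewrite /da_kernel !thetaE dot_theta_vec ?rnorm_ball //.
have := defect_neq0 (rnorm_ball l).
have : (1 - hdot (w : E) (l : E))^* != 0 by rewrite conjc_eq0.
rewrite conjcM conjcV conjc_real; move: z1 zw.
move: (1 - hdot (z : E) l) (1 - hdot (z : E) w) (_^*) (_%:C) => a q b s a0 q0 b0 s0.
by field; rewrite a0 q0 b0 s0.
Qed.

End BallInvolution.

Section KernelEquivalence.
Variables (R : realType) (X : Type) (k k' : X -> X -> R[i]) (t : X -> R[i]).
Local Notation C := R[i].
Hypothesis t0 : forall z, t z != 0.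
Hypothesis kk' : forall z w, k' z w = t z * (t w)^* * k z w.

Lemma psd_rescale (T : Type) (p : T -> X) (G : T -> T -> C) :
  psd (fun z w => G z w * k' (p z) (p w)) <-> psd (fun z w => G z w * k (p z) (p w)).
Proof.
split=> h.
  apply: eq_psd (psd_congr (fun z => (t (p z))^-1) h) => z w.
  have tz := t0 (p z); have tw : (t (p w))^* != 0 by rewrite conjc_eq0.
  by rewrite kk' conjcV; field; rewrite tz tw.
apply: eq_psd (psd_congr (fun z => t (p z)) h) => z w.
by rewrite kk'; ring.
Qed.

Lemma bdd_rescale f : bdd k' f <-> bdd k f.
Proof. by split=> -[M h]; exists M; apply/(psd_rescale id). Qed.

Lemma contr_rescale n (A : 'M[X -> C]_n) : contr k' A <-> contr k A.
Proof.
exact: (psd_rescale fst (fun p q : X * 'I_n =>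
  (p.2 == q.2)%:R - \sum_c A p.2 c p.1 * (A q.2 c q.1)^*)).
Qed.

Lemma cc_hom_rescalel (Y : Type) (kY : Y -> Y -> C) phi :
  cc_hom k kY phi -> cc_hom k' kY phi.
Proof.
case=> h1 h2 h3 h4 h5; split=> //.
- by move=> f /bdd_rescale; exact: h1.
- by move=> a f g /bdd_rescale bf /bdd_rescale bg; exact: h2.
- by move=> f g /bdd_rescale bf /bdd_rescale bg; exact: h3.
- by move=> n A bA /contr_rescale cA; apply: h5 => // i j; apply/bdd_rescale; exact: bA.
Qed.

Lemma cc_hom_rescaler (Y : Type) (kY : Y -> Y -> C) phi :
  cc_hom kY k phi -> cc_hom kY k' phi.
Proof.
case=> h1 h2 h3 h4 h5; split=> //.
- by move=> f /h1 bf; apply/bdd_rescale.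
- by move=> n A bA cA; apply/contr_rescale; exact: h5.
Qed.

End KernelEquivalence.

Section PointEvaluation.
Variables (R : realType) (d : option nat) (H : drury_arveson R d).
Local Notation C := R[i].
Local Notation E := (cspace R d).
Local Notation ball := (unit_ball R d).

Lemma psd_tr (X : Type) (L : X -> X -> C) : psd L -> psd (fun z w => L w z).
Proof.
move=> h J x c; have := h J x (fun j => (c j)^*); congr (_ <= _).
rewrite exchange_big; apply: eq_bigr => j _; apply: eq_bigr => k _.
by rewrite conjcK [(c k)^* * _]mulrC.
Qed.

(** This is [|m|^2] times the Schur complement of the Gram kernel at [m]. *)
Lemma psd_cauchy_schwarz (F : hilbertType R) (m : F) :
  psd (fun a b : F => hdot m m * hdot a b - hdot a m * hdot m b).
Proof.
have [->|m0] := eqVneq m 0.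
  apply: eq_psd (psdZ (lexx 0) (psd_gram (@id F))) => a b.
  by rewrite !(dot0l, dot0r) !mul0r subrr.
have mm : hdot m m != 0.
  rewrite hdot_norm expf_neq0 // normr_eq0 //.
have mp : 0 <= hdot m m by rewrite dot_rnorm lecR sqr_ge0.
apply: eq_psd (psdZ mp (psd_schur (psd_gram (@id F)) mm)) => a b.
by rewrite mulrBr; congr (_ - _); rewrite mulrC divfK.
Qed.

Variables (X : choiceType) (Y : Type) (x : X -> ball) (y : Y -> ball).
Local Notation kX := (kmap x).
Local Notation kY := (kmap y).
Variables (phi : (X -> C) -> (Y -> C)) (psi : (Y -> C) -> (X -> C)).
Hypotheses (hphi : cc_hom kX kY phi) (hpsi : cc_hom kY kX psi).
Hypothesis phiK : forall f, bdd kX f -> psi (phi f) = f.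
Hypothesis psiK : forall f, bdd kY f -> phi (psi f) = f.
Variables (z1 z2 : X).
Hypothesis z12 : x z1 <> x z2.

Let pX := psd_kmap H x.
Let pY := psd_kmap H y.

Lemma cc_norm (g : X -> C) (c : R) w : 0 < c ->
  psd (fun z w => ((c ^+ 2)%:C - g z * (g w)^*) * kX z w) -> rnorm (phi g w) <= c.
Proof.
move=> c0 h.
have bg : bdd kX g by exists c.
have hr : row_contr kX 1 (fun=> (c^-1)%:C *: g).
  have c2 : 0 <= (c^-1 ^+ 2)%:C by rewrite lecR sqr_ge0.
  apply: eq_psd (psdZ c2 h) => u v; rewrite big_ord1.
  have -> t : ((c^-1)%:C *: g) t = (c^-1)%:C * g t by [].
  have cc : (c^-1)%:C * c%:C = 1 by rewrite -rmorphM mulVf ?gt_eqF.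
  rewrite conjcM conjc_real !rmorphXn /= mulrA; congr (_ * _).
  rewrite mulrBr -exprMn cc expr1n; congr (_ - _); ring.
have := row_le1 (kmap_gt0 H y w) (cc_row pX pY hphi hr).
rewrite big_ord1 (ccZ pX hphi) // [(_ *: _) w]/((c^-1)%:C * phi g w).
rewrite rnormM rnorm_real ger0_norm ?invr_ge0; last exact: ltW.
rewrite expr_le1 ?mulr_ge0 ?rnorm_ge0 ?invr_ge0 //; last exact: ltW.
by rewrite mulrC ler_pdivrMr // mul1r.
Qed.

Definition lin_fun (m : E) (z : X) : C := hdot (x z : E) m.

(** Substituting [K = 1 + <z, w> K] in the part [|m|^2 K] reduces the claim to
    [psd_cauchy_schwarz]. *)
Lemma lin_fun_bound (m : E) (c : R) : rnorm m <= c ->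
  psd (fun z w => ((c ^+ 2)%:C - lin_fun m z * (lin_fun m w)^*) * kX z w).
Proof.
move=> mc; have c0 : 0 <= c := le_trans (rnorm_ge0 _) mc.
have mm : 0 <= hdot m m by rewrite dot_rnorm lecR sqr_ge0.
have cm : 0 <= (c ^+ 2 - rnorm m ^+ 2)%:C.
  by rewrite lecR subr_ge0 ler_pXn2r ?nnegrE ?rnorm_ge0.
have p1 := psdM (psd_comp (fun z => x z : E) (psd_cauchy_schwarz m)) pX.
apply: eq_psd (psdD (psdD (psdZ mm (@psd_one R X)) p1) (psdZ cm pX)) => z w.
have -> : (c ^+ 2 - rnorm m ^+ 2)%:C = (c ^+ 2)%:C - hdot m m.
  by rewrite dot_rnorm rmorphB.
rewrite /lin_fun -dotC.
rewrite -[1 in LHS](da_kernel1 (x z) (x w)) -/(kX z w); ring.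
Qed.

Lemma bdd_lin_fun m : bdd kX (lin_fun m).
Proof. by exists (rnorm m); exact: lin_fun_bound. Qed.

(** Here norm continuity suffices: the tail of [m] defines a multiplier of norm at most
    [|tail N m|], and [cc_norm] controls its image. *)
Lemma image_lin_fun (F : Y -> E) (m : E) w :
  (forall w i, F w i = phi (zcoord x i) w) -> phi (lin_fun m) w = hdot (F w) m.
Proof.
move=> hF.
have bs N : bdd kX (\sum_(i < N) (m i)^* *: zcoord x i).
  apply: (@bdd_sum R X kX pX N (fun i => (m i)^* *: zcoord x i)) => i.
  by apply: bddZ => //; exact: bdd_coord.
have split N : phi (lin_fun m) w = \sum_(i < N) F w i * (m i)^* + phi (lin_fun (tail N m)) w.
  have -> : lin_fun m = \sum_(i < N) (m i)^* *: zcoord x i + lin_fun (tail N m).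
    apply/funext => z; rewrite [RHS]/((\sum_(i < N) (m i)^* *: zcoord x i) z +
      lin_fun (tail N m) z) fct_sumE /lin_fun /tail dotBr dot_sumr.
    have -> : \sum_(i < N) ((m i)^* *: zcoord x i) z =
        \sum_(i < N) hdot (x z : E) (m i *: cdelta R d i).
      by apply: eq_bigr => i _; rewrite dotZr dot_cdelta.
    exact/esym/subrKC.
  rewrite (ccD hphi) //; last exact: bdd_lin_fun.
  rewrite [LHS]/(phi (\sum_(i < N) (m i)^* *: zcoord x i) w + _); congr (_ + _).
  rewrite (cc_sum pX hphi N (f := fun i => (m i)^* *: zcoord x i)) => [|i]; last first.
    by apply: bddZ => //; exact: bdd_coord.
  rewrite fct_sumE; apply: eq_bigr => i _.
  by rewrite (ccZ pX hphi) ?hF; [rewrite [LHS]/((m i)^* * _) mulrC | exact: bdd_coord].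
apply/eqP; rewrite -subr_eq0; apply/eqP; apply: rnorm0_eq0; apply/eqP.
rewrite eq_le rnorm_ge0 andbT; apply/ler_addgt0Pr => e e0; rewrite add0r.
have e3 : 0 < e / 2 by rewrite divr_gt0.
have e2 : 0 < (e / 2) ^+ 2 by rewrite exprn_gt0.
have /cvgrPdist_lt/(_ _ e2) h1 := cvg_tail0 m.
have /cvgCP/(_ _ e3) h2 := @cvg_dot R d (F w) m.
have [N [lt1 lt2]] := filter_ex (filterI h1 h2).
have lt1' : rnorm (tail N m) < e / 2.
  move: lt1; rewrite sub0r normrN ger0_norm ?sqr_ge0 //.
  by rewrite ltr_pXn2r ?nnegrE ?rnorm_ge0 //; exact: ltW.
have := cc_norm w e3 (lin_fun_bound (ltW lt1')).
rewrite (split N); move: lt2; set t := phi _ w; set S := \sum_(i < N) _ => lt2 le3.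
have -> : S + t - hdot (F w) m = t - (hdot (F w) m - S) by ring.
have := ler_rnormD t (- (hdot (F w) m - S)); rewrite rnormN; lra.
Qed.

(** The row only gives [|F w| <= 1]. Equality at one [w] would make a diagonal entry of the positive
    kernel vanish, so [<F v, F w> = 1] for all [v] and [F] is constant; then [psi] turns the
    coordinates on [X] back into constants, against [z12]. *)
Lemma image_in_ball : exists2 F : Y -> ball,
  (forall w i, (F w : E) i = phi (zcoord x i) w) &
  psd (fun z w => (1 - hdot (F z : E) (F w : E)) * kY z w).
Proof.
have [F hF F1] := image_coords H hphi.
have pF : psd (fun z w => (1 - hdot (F z) (F w)) * kY z w).
  apply: (@psd_cvg R nat \oo _ Y (fun n z w => (1 - \sum_(i < n)
     phi (zcoord x i) z * (phi (zcoord x i) w)^*) * kY z w)) => [z w|J p c].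
    apply: cvgM; last exact: cvg_cst.
    apply: cvgB; first exact: cvg_cst.
    by under eq_fun do under eq_bigr do rewrite -!hF; exact: cvg_dot.
  by apply: nearW => n; exact: (cc_row pX pY hphi (row_contr_coords H x n)).
have lt1 w : rnorm (F w) < 1.
  rewrite lt_neqAle F1 andbT; apply/eqP => n1.
  have Lw : (1 - hdot (F w) (F w)) * kY w w = 0.
    by rewrite dot_rnorm n1 expr1n subrr mul0r.
  have same v : F v = F w.
    have /eqP := psd_diag0 v pF Lw.
    have kn0 : kY w v != 0.
      by apply/eqP => h; have := kmap1 y w v; rewrite h mul0r => /esym/eqP; rewrite oner_eq0.
    rewrite mulf_eq0 (negbTE kn0) orbF subr_eq0 => /eqP e1.
    apply/eqP; rewrite -subr_eq0; apply/eqP; apply: rnorm0_eq0; apply/eqP.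
    rewrite -sqrf_eq0 eq_le sqr_ge0 andbT sqr_rnormB dotC -e1 conjc1 n1.
    have := F1 v; have := rnorm_ge0 (F v); rewrite /=; nra.
  have cst i : zcoord x i = (fun=> F w i).
    rewrite -[LHS](phiK (bdd_coord H x i)).
    have -> : phi (zcoord x i) = (fun=> F w i) by apply/funext => v; rewrite -hF same.
    by rewrite (cc_cst pY hpsi).
  apply: z12; apply: val_inj; apply: cspaceP => i.
  by rewrite -[LHS]/(zcoord x i z1) -[RHS]/(zcoord x i z2) cst.
exists (fun w => sval (mk_ball (lt1 w))) => [w i|].
  by rewrite (svalP (mk_ball (lt1 w))).
by apply: eq_psd pF => z w; rewrite !(svalP (mk_ball _)).
Qed.

Hypothesis zero_sep : forall l : ball, (forall z, x z <> l) ->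
  exists h : H, (forall z, rkhs_fun h (x z) = 0) /\ rkhs_fun h l <> 0.

(* A function of [H] vanishing on the range of [x] but not at [F w] would make some
   nonzero constant satisfy the hypothesis of [factor_vanish]. *)
Lemma point_evaluation (F : Y -> ball) (w : Y) :
  (forall w i, (F w : E) i = phi (zcoord x i) w) ->
  exists v : X, x v = F w /\ forall f, bdd kX f -> phi f w = f v.
Proof.
move=> hF; pose l := F w; pose x' z := theta l (x z).
pose s : C := (defect (l : E))%:C.
have s0 : s != 0 by apply: defect_neq0; exact: rnorm_ball.
pose t z : C := (1 - hdot (x z : E) (l : E)) / s.
have t0 z : t z != 0 by rewrite mulf_neq0 ?invr_eq0 // dot_ball_neq1.
have kk' z v : kmap x' z v = t z * (t v)^* * kX z v by exact: da_kernel_theta.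
have hphi' := cc_hom_rescalel t0 kk' hphi.
have hpsi' := cc_hom_rescaler t0 kk' hpsi.
have bdd' f : bdd (kmap x') f <-> bdd kX f := bdd_rescale t0 kk' f.
have phiK' f : bdd (kmap x') f -> psi (phi f) = f by move=> /bdd'; exact: phiK.
have z12' : x' z1 <> x' z2 by move/(can_inj (thetaK l)).
have kill (f : X -> C) :
    psd (fun z v => (hdot (x' z : E) (x' v : E) - f z * (f v)^*) * kmap x' z v) ->
    phi f w = 0.
  move=> pf; apply: (@factor_vanish R d H X Y x' y phi psi hphi' hpsi' phiK' psiK z1 z2 z12' f w pf) => i.
  (* Clearing the denominator of [theta] leaves linear functions, whose images at [w] are known. The
     right side then vanishes at [w], while the cleared factor is [1 - <l, l> = s^2], nonzero. *)
  have eqi : zcoord x' i * ((fun=> 1) - lin_fun l) =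
      (fun=> (l : E) i) - s *: zcoord x i - ((l : E) i / (1 + s)) *: lin_fun l.
    apply/funext => z.
    rewrite [LHS]/((x' z : E) i * (1 - hdot (x z : E) l)).
    rewrite [RHS]/((l : E) i - s * (x z : E) i - ((l : E) i / (1 + s)) * hdot (x z : E) l).
    rewrite /x' thetaE /theta_vec !(coordZ, coordB) -/s.
    have key (a u v q : C) : 1 - a != 0 -> 1 + q != 0 ->
        (1 - a)^-1 * (v - q * u - a / (1 + q) * v) * (1 - a) =
        v - q * u - v / (1 + q) * a.
      by move=> a1 q1; field; rewrite a1 q1.
    exact: (key _ _ _ _ (dot_ball_neq1 (x z) l) (defect1_neq0 (rnorm_ball l))).
  have bZ : bdd kX (zcoord x' i) by apply/bdd'; exact: bdd_coord.
  have bl := bdd_lin_fun l.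
  have b1 := bdd_cst pX (1 : C).
  have := congr1 (fun g => phi g w) eqi.
  rewrite (cc_mul hphi) //; last exact: bddB.
  rewrite (ccB hphi) // !(ccB hphi) //; last first.
  - by apply: bddZ.
  - by apply: bddB => //; [exact: bdd_cst | apply: bddZ => //; exact: bdd_coord].
  - by apply: bddZ => //; exact: bdd_coord.
  - exact: bdd_cst.
  rewrite !(ccZ pX hphi) //; last exact: bdd_coord.
  rewrite !(cc_cst pX hphi).
  rewrite [LHS]/(phi (zcoord x' i) w * (1 - phi (lin_fun l) w)).
  rewrite [RHS]/((l : E) i - s * phi (zcoord x i) w - ((l : E) i / (1 + s)) * phi (lin_fun l) w).
  rewrite (@image_lin_fun F) // -hF -/l (dot_base (rnorm_ball l)) -/s.
  have key (p u q : C) : q != 0 -> 1 + q != 0 ->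
      p * (1 - (1 - q ^+ 2)) = u - q * u - u / (1 + q) * (1 - q ^+ 2) -> p = 0.
    move=> q0 q1; have -> : u - q * u - u / (1 + q) * (1 - q ^+ 2) = 0 by field.
    have -> : 1 - (1 - q ^+ 2) = q ^+ 2 by ring.
    by move=> /eqP; rewrite mulf_eq0 expf_eq0 /= (negbTE q0) orbF => /eqP.
  exact: (key _ _ _ s0 (defect1_neq0 (rnorm_ball l))).
have [[v xv]|nv] := pselect (exists v, x v = l).
  exists v; split=> // f bf.
  have x'v : (x' v : E) = 0 by rewrite /x' xv theta_base.
  pose g := f - (fun=> f v).
  have bg : bdd kX g by apply: bddB => //; exact: bdd_cst.
  have [M hM] : bdd (kmap x') g by apply/bdd'.
  (* Scaling by [N^-1] makes the multiplier [g], which vanishes at [v], a contraction. *)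
  pose N := 1 + `|M|; have N0 : 0 < N by rewrite /N; have := normr_ge0 M; lra.
  pose g1 : X -> C := (N^-1)%:C *: g.
  have pg : psd (fun z u => (1 - g1 z * (g1 u)^*) * kmap x' z u).
    have c1 : 0 <= (N^-1 ^+ 2)%:C by rewrite lecR sqr_ge0.
    have c2 : 0 <= (1 - N^-1 ^+ 2 * M ^+ 2)%:C.
      rewrite lecR subr_ge0 exprVn mulrC ler_pdivrMr ?exprn_gt0 // mul1r.
      rewrite -(real_normK (num_real M)) ler_pXn2r ?nnegrE ?normr_ge0 ?(ltW N0) //.
      by rewrite /N; lra.
    apply: eq_psd (psdD (psdZ c1 hM) (psdZ c2 (psd_kmap H x'))) => z u.
    rewrite [g1 z]/((N^-1)%:C * g z) [g1 u]/((N^-1)%:C * g u) conjcM conjc_real.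
    have -> : (1 - N^-1 ^+ 2 * M ^+ 2)%:C = 1 - (N^-1)%:C ^+ 2 * (M ^+ 2)%:C.
      by rewrite rmorphB rmorphM rmorphXn.
    have -> : (N^-1 ^+ 2)%:C = (N^-1)%:C ^+ 2 by rewrite rmorphXn.
    have key (p q a b k : C) : p ^+ 2 * ((q - a * b) * k) + (1 - p ^+ 2 * q) * k =
        (1 - p * a * (p * b)) * k by ring.
    exact: key.
  have gv : g1 v = 0.
    have key (p a : C) : p * (a - a) = 0 by rewrite subrr mulr0.
    exact: key.
  have kv u : kmap x' v u = 1 by rewrite /kmap /da_kernel x'v dot0l subr0 invr1.
  have kv' u : kmap x' u v = 1 by rewrite /kmap /da_kernel x'v dot0r subr0 invr1.
  (* At [v] the moved kernel is 1 and [g1] is 0, so the Schur complement subtracts exactly 1, and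
     [K - 1 = <z, z'> K] yields the hypothesis of [kill]. *)
  have : phi g1 w = 0.
    apply: kill; apply: eq_psd (psd_schur (x0 := v) pg _) => [z u|]; last first.
      by rewrite gv mul0r subr0 mul1r kv oner_eq0.
    rewrite gv !kv kv' conjc0.
    have key (a b k q : C) : k * (1 - q) = 1 ->
        (1 - a * b) * k - (1 - a * 0) * 1 * ((1 - 0 * b) * 1) / ((1 - 0 * 0) * 1) =
        (q - a * b) * k.
      move=> h; rewrite !(mulr0, mul0r, subr0, mulr1, divr1) -[X in _ - X]h; ring.
    exact: key (da_kernel1 (x' z) (x' u)).
  rewrite (ccZ pX hphi) // (ccB hphi) //; last exact: bdd_cst.
  rewrite (cc_cst pX hphi) => h.
  have key (p a b : C) : p != 0 -> p * (a - b) = 0 -> a = b.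
    by move=> p0 /eqP; rewrite mulf_eq0 (negbTE p0) subr_eq0 => /eqP.
  by apply: key h; rewrite fmorph_eq0 invr_eq0 gt_eqF.
have [|h [hx hl]] := zero_sep (l := l); first by move=> z xz; apply: nv; exists z.
exfalso.
pose kl := rkhs_kernel H l.
have hh : rnorm h != 0.
  apply/eqP => h0; apply: hl.
  by rewrite rkhs_reproducing (rnorm0_eq0 h0) dot0l.
(* [g] is the component of [kl] orthogonal to [h]: it has the same values on the range of [x], but
   is strictly shorter because [h] does not vanish at [l]. *)
pose tau := hdot kl h / (rnorm h ^+ 2)%:C.
pose g := kl - tau *: h.
have gx z : hdot g (rkhs_kernel H (x z)) = hdot kl (rkhs_kernel H (x z)).
  by rewrite dotBl dotZl -[hdot h _]rkhs_reproducing hx mulr0 subr0.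
have nk : rnorm kl ^+ 2 = (defect (l : E) ^+ 2)^-1.
  apply: complexI; rewrite -dot_rnorm -kernel_dot /da_kernel dot_base ?rnorm_ball //.
  by rewrite fmorphV rmorphXn /= opprB addrC subrK.
have ng : rnorm g ^+ 2 = rnorm kl ^+ 2 - rnorm (hdot kl h) ^+ 2 / rnorm h ^+ 2.
  have hc : (rnorm h ^+ 2)%:C != 0 by rewrite fmorph_eq0 sqrf_eq0.
  apply: complexI; rewrite -dot_rnorm /g !dotBl !dotBr !dotZl !dotZr.
  have -> : (rnorm kl ^+ 2 - rnorm (hdot kl h) ^+ 2 / rnorm h ^+ 2)%:C =
      (rnorm kl ^+ 2)%:C - (rnorm (hdot kl h) ^+ 2)%:C / (rnorm h ^+ 2)%:C.
    by rewrite rmorphB fmorph_div.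
  rewrite -mulcJ !dot_rnorm [hdot h kl]dotC /tau conjcM conjcV conjc_real.
  move: hc; move: (_%:C) (_%:C) (hdot kl h) (_^*) => p q a b hp.
  by field.
pose rho := defect (l : E) ^+ 2 * rnorm g ^+ 2.
have d0 : 0 < defect (l : E) ^+ 2.
  by rewrite exprn_gt0 // sqrtr_gt0 subr_gt0 expr_lt1 ?rnorm_ge0 // rnorm_ball.
have rho1 : 0 < 1 - rho.
  rewrite /rho ng nk mulrBr mulfV ?gt_eqF // opprB addrC subrK mulr_gt0 //.
  have klh : rnorm (hdot kl h) != 0.
    apply/eqP => /rnorm0_eq0 e; apply: hl.
    by rewrite rkhs_reproducing dotC e conjc0.
  by rewrite divr_gt0 // exprn_gt0 // lt_neqAle eq_sym ?hh ?klh rnorm_ge0.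
(* [rho] is [|g|^2 / |kl|^2], hence below 1. Cauchy-Schwarz for [g], rescaled by [t], is precisely
   the hypothesis of [kill] for the constant [c], whereas [phi] fixes constants. *)
pose c := Num.sqrt (1 - rho).
have c0 : 0 < c by rewrite sqrtr_gt0.
have : phi (fun=> c%:C) w = 0.
  have cc : c%:C * (c%:C)^* = (1 - rho)%:C.
    by rewrite conjc_real -rmorphM -expr2 sqr_sqrtr //; exact: ltW.
  apply: kill.
  have pg := psd_tr (psd_comp (fun z => rkhs_kernel H (x z)) (psd_cauchy_schwarz g)).
  have d1 : 0 <= (defect (l : E) ^+ 2)%:C by rewrite lecR ltW.
  have := psdZ d1 pg.
  move=> /(psd_congr t); apply: eq_psd => z u.
  rewrite cc [hdot (rkhs_kernel H (x u)) g]dotC !gx -dotC -!kernel_dot.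
  have dE : (defect (l : E) ^+ 2)%:C = s ^+ 2 by rewrite rmorphXn.
  have rE : (1 - rho)%:C = 1 - s ^+ 2 * hdot g g.
    by rewrite dot_rnorm -dE -rmorphM rmorphB.
  have e1 v : t v * da_kernel (x v) l = s^-1.
    by rewrite /t mulrAC [_ * da_kernel _ _]mulrC da_kernel1 mul1r.
  have e2 : (t u)^* * da_kernel l (x u) = s^-1.
    rewrite (kernel_dot H l (x u)) [hdot _ _]dotC -kernel_dot -conjcM e1.
    by rewrite conjcV conjc_real.
  rewrite rE dE kk' -/(kX z u).
  have k1 := da_kernel1 (x' z) (x' u); rewrite -[da_kernel _ _]/(kmap x' z u) kk' in k1.
  have key (a b k q p A B r : C) : r != 0 -> a * A = r^-1 -> b * B = r^-1 ->
      a * b * k * (1 - q) = 1 ->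
      a * b * (r ^+ 2 * (p * k - B * A)) = (q - (1 - r ^+ 2 * p)) * (a * b * k).
    move=> r0 aA bB h1.
    have -> : a * b * (r ^+ 2 * (p * k - B * A)) =
        r ^+ 2 * p * (a * b * k) - r ^+ 2 * ((a * A) * (b * B)) by ring.
    have -> : (q - (1 - r ^+ 2 * p)) * (a * b * k) =
        r ^+ 2 * p * (a * b * k) - a * b * k * (1 - q) by ring.
    by rewrite aA bB h1; field.
  exact: key s0 (e1 z) e2 k1.
rewrite (cc_cst pX hphi) => /eqP; rewrite fmorph_eq0 gt_eqF //.
Qed.

End PointEvaluation.

(** * The point map is isometric *)

Section Isometry.
Variables (R : realType) (d : option nat) (H : drury_arveson R d).
Local Notation C := R[i].
Local Notation E := (cspace R d).
Local Notation ball := (unit_ball R d).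

Section OneSided.
Variables (X : choiceType) (Y : Type) (x : X -> ball) (y : Y -> ball).
Variables (phi : (X -> C) -> (Y -> C)) (psi : (Y -> C) -> (X -> C)).
Hypotheses (hphi : cc_hom (kmap x) (kmap y) phi) (hpsi : cc_hom (kmap y) (kmap x) psi).
Hypothesis phiK : forall f, bdd (kmap x) f -> psi (phi f) = f.
Variables (z1 z2 : X).
Hypothesis z12 : x z1 <> x z2.
Variable Phi : Y -> X.
Hypothesis PhiE : forall f w, bdd (kmap x) f -> phi f w = f (Phi w).

(* Schur complement at a common zero, where both kernels are 1. *)
Lemma psd_dot_point_map w0 : ball_pt (x (Phi w0)) = 0 -> ball_pt (y w0) = 0 ->
  psd (fun z w => (hdot (y z : E) (y w : E) -
    hdot (x (Phi z) : E) (x (Phi w) : E)) * kmap y z w).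
Proof.
move=> x0 y0.
have [F hF pF] := image_in_ball H hphi hpsi phiK z12.
have FE w : ball_pt (F w) = ball_pt (x (Phi w)).
  by apply: cspaceP => i; rewrite hF PhiE //; exact: bdd_coord.
have kl z : kmap y z w0 = 1 by rewrite /kmap /da_kernel y0 dot0r subr0 invr1.
have kr z : kmap y w0 z = 1 by rewrite /kmap /da_kernel y0 dot0l subr0 invr1.
have L0 : (1 - hdot (F w0 : E) (F w0 : E)) * kmap y w0 w0 != 0.
  by rewrite kl FE x0 dot0l subr0 mulr1 oner_eq0.
apply: eq_psd (psd_schur pF L0) => z w.
rewrite !kl kr !FE x0 !(dot0l, dot0r).
have key (p q k : C) : k * (1 - q) = 1 ->
    (1 - p) * k - (1 - 0) * 1 * ((1 - 0) * 1) / ((1 - 0) * 1) = (q - p) * k.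
  move=> h; rewrite !(subr0, mulr1, divr1) -[X in _ - X]h; ring.
exact: key (da_kernel1 (y z) (y w)).
Qed.

End OneSided.

Variables (X Y : choiceType) (x : X -> ball) (y : Y -> ball).
Hypotheses (x_inj : injective x) (y_inj : injective y).
Variables (phi : (X -> C) -> (Y -> C)) (psi : (Y -> C) -> (X -> C)).
Hypotheses (hphi : cc_hom (kmap x) (kmap y) phi) (hpsi : cc_hom (kmap y) (kmap x) psi).
Hypothesis phiK : forall f, bdd (kmap x) f -> psi (phi f) = f.
Hypothesis psiK : forall f, bdd (kmap y) f -> phi (psi f) = f.
Variables (z1 z2 : X).
Hypothesis z12 : x z1 <> x z2.
Hypothesis zero_sepX : forall l : ball, (forall z, x z <> l) ->
  exists h : H, (forall z, rkhs_fun h (x z) = 0) /\ rkhs_fun h l <> 0.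
Hypothesis zero_sepY : forall l : ball, (forall z, y z <> l) ->
  exists h : H, (forall z, rkhs_fun h (y z) = 0) /\ rkhs_fun h l <> 0.

Let pX := psd_kmap H x.
Let pY := psd_kmap H y.

Lemma cc_separates : exists w1 w2 : Y, y w1 <> y w2.
Proof.
apply: contrapT => nw; apply: z12; apply: val_inj; apply: cspaceP => i.
have bz := bdd_coord H x i.
have [c e] : exists c, phi (zcoord x i) = (fun=> c).
  have [[w]|ne] := pselect (inhabited Y); last by exists 0; apply/funext => w; case: ne.
  exists (phi (zcoord x i) w); apply/funext => w'; congr (phi _ _).
  by apply: y_inj; apply: contrapT => h; apply: nw; exists w', w.
have := congr1 psi e; rewrite phiK // (cc_cst pY hpsi) => e'.
exact: etrans (congr1 (@^~ z1) e') (esym (congr1 (@^~ z2) e')).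
Qed.

Lemma point_map : exists (Phi : Y -> X) (Psi : X -> Y),
  [/\ cancel Phi Psi, cancel Psi Phi,
      forall f w, bdd (kmap x) f -> phi f w = f (Phi w) &
      forall g v, bdd (kmap y) g -> psi g v = g (Psi v)].
Proof.
have [w1 [w2 w12]] := cc_separates.
have [F hF _] := image_in_ball H hphi hpsi phiK z12.
have [G hG _] := image_in_ball H hpsi hphi psiK w12.
have ex1 w : exists v, forall f, bdd (kmap x) f -> phi f w = f v.
  have [v [_ h]] := point_evaluation hphi hpsi phiK psiK z12 zero_sepX w hF.
  by exists v.
have ex2 v : exists w, forall g, bdd (kmap y) g -> psi g v = g w.
  have [w [_ h]] := point_evaluation hpsi hphi psiK phiK w12 zero_sepY v hG.
  by exists w.
have [[Phi hPhi] [Psi hPsi]] := (choice ex1, choice ex2).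
exists Phi, Psi; split=> //.
- move=> w; apply: y_inj; apply: val_inj; apply: cspaceP => i.
  have bc := bdd_coord H y i.
  have := congr1 (@^~ w) (psiK bc).
  by rewrite hPhi ?hPsi //; exact: (cc_bdd hpsi).
- move=> v; apply: x_inj; apply: val_inj; apply: cspaceP => i.
  have bc := bdd_coord H x i.
  have := congr1 (@^~ v) (phiK bc).
  by rewrite hPsi ?hPhi //; exact: (cc_bdd hphi).
- by move=> f w; exact: hPhi.
- by move=> g v; exact: hPsi.
Qed.

Lemma point_map_isometry (Phi : Y -> X) (Psi : X -> Y) :
  cancel Phi Psi -> cancel Psi Phi ->
  (forall f w, bdd (kmap x) f -> phi f w = f (Phi w)) ->
  (forall g v, bdd (kmap y) g -> psi g v = g (Psi v)) ->
  forall w0 z w,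
    hdot (theta (x (Phi w0)) (x (Phi z)) : E) (theta (x (Phi w0)) (x (Phi w)) : E) =
    hdot (theta (y w0) (y z) : E) (theta (y w0) (y w) : E).
Proof.
move=> PhiK PsiK hPhi hPsi w0.
have [w1 [w2 w12]] := cc_separates.
pose sc (T : Type) (u : T -> ball) (l : ball) z : C :=
  (1 - hdot (u z : E) (l : E)) / (defect (l : E))%:C.
have sc0 (T : Type) (u : T -> ball) l z : sc T u l z != 0.
  by rewrite mulf_neq0 ?invr_eq0 ?dot_ball_neq1 // defect_neq0 // rnorm_ball.
have scE (T : Type) (u : T -> ball) l z w :
    kmap (fun v => theta l (u v)) z w = sc T u l z * (sc T u l w)^* * kmap u z w.
  exact: da_kernel_theta.
pose lx := x (Phi w0); pose ly := y w0.
pose x' z := theta lx (x z); pose y' z := theta ly (y z).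
have hphi' := cc_hom_rescaler (sc0 _ y ly) (scE _ y ly)
  (cc_hom_rescalel (sc0 _ x lx) (scE _ x lx) hphi).
have hpsi' := cc_hom_rescaler (sc0 _ x lx) (scE _ x lx)
  (cc_hom_rescalel (sc0 _ y ly) (scE _ y ly) hpsi).
have bx f : bdd (kmap x') f <-> bdd (kmap x) f := bdd_rescale (sc0 _ x lx) (scE _ x lx) f.
have by' f : bdd (kmap y') f <-> bdd (kmap y) f := bdd_rescale (sc0 _ y ly) (scE _ y ly) f.
have phiK' f : bdd (kmap x') f -> psi (phi f) = f by move=> /bx; exact: phiK.
have psiK' f : bdd (kmap y') f -> phi (psi f) = f by move=> /by'; exact: psiK.
have hPhi' f w : bdd (kmap x') f -> phi f w = f (Phi w) by move=> /bx; exact: hPhi.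
have hPsi' f w : bdd (kmap y') f -> psi f w = f (Psi w) by move=> /by'; exact: hPsi.
have z12' : x' z1 <> x' z2 by move/(can_inj (thetaK lx)).
have w12' : y' w1 <> y' w2 by move/(can_inj (thetaK ly)).
have x0 : ball_pt (x' (Phi w0)) = 0 by exact: theta_base.
have y0 : ball_pt (y' w0) = 0 by exact: theta_base.
have p1 := psd_dot_point_map hphi' hpsi' phiK' z12' hPhi' x0 y0.
have y0' : ball_pt (y' (Psi (Phi w0))) = 0 by rewrite PhiK.
have p2 := psd_dot_point_map hpsi' hphi' psiK' w12' hPsi' y0' x0.
(* The positivity statements for [phi] and [psi] compare the diagonals in opposite directions; once
   the diagonal is 0, [psd_diag0] removes every other entry. *)
have diag z : hdot (y' z : E) (y' z : E) - hdot (x' (Phi z) : E) (x' (Phi z) : E) = 0.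
  apply/eqP; rewrite eq_le; apply/andP; split; last first.
    by have := psd_diag_ge0 z p1; rewrite pmulr_lge0 // (kmap_gt0 H).
  have := psd_diag_ge0 (Phi z) p2; rewrite PhiK pmulr_lge0 ?(kmap_gt0 H) //.
  by rewrite subr_ge0 subr_le0.
move=> z w.
have D0 : (hdot (y' z : E) (y' z : E) - hdot (x' (Phi z) : E) (x' (Phi z) : E)) *
    kmap y' z z = 0 by rewrite diag mul0r.
have /eqP := psd_diag0 w p1 D0.
have kn0 : kmap y' z w != 0.
  by apply/eqP => h; have := kmap1 y' z w; rewrite h mul0r => /esym/eqP; rewrite oner_eq0.
by rewrite mulf_eq0 (negbTE kn0) orbF subr_eq0 => /eqP ->.
Qed.

End Isometry.

(** * Unitary extension *)

Section PartialIsometry.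
Variables (R : realType) (E : hilbertType R) (J : Type).
Local Notation C := R[i].
Implicit Types (p q : J -> E) (x y : E).

Lemma rnorm_sum_gram p q : (forall i j, hdot (p i) (p j) = hdot (q i) (q j)) ->
  forall n (c : 'I_n -> C) (a : 'I_n -> J),
    rnorm (\sum_i c i *: p (a i)) = rnorm (\sum_i c i *: q (a i)).
Proof.
move=> gram n c a; apply/eqP; rewrite -(@eqrXn2 _ 2) ?rnorm_ge0 //; apply/eqP.
apply: complexI; rewrite -!dot_rnorm !dot_suml; apply: eq_bigr => i _.
rewrite !dot_sumr; apply: eq_bigr => j _.
by rewrite !(dotZl, dotZr) gram.
Qed.

Lemma rnorm_closure_le (S : set E) (M : R) y : 0 <= M -> closure S y ->
  (forall z, S z -> rnorm (hdot z y) <= M * rnorm z) -> rnorm y <= M.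
Proof.
move=> M0 cy h; rewrite leNgt; apply/negP => My.
have y0 : 0 < rnorm y := le_lt_trans M0 My.
(* Approximating [y] within [e] gives [|y| (|y| - M) <= e (|y| + M)]; this [e] makes the right side
   half of the left. *)
pose e := rnorm y * (rnorm y - M) / (2 * (rnorm y + M)).
have s0 : 0 < rnorm y + M by lra.
have e0 : 0 < e by rewrite divr_gt0 ?mulr_gt0 ?subr_gt0.
have [z Sz zy] := (closure_rnormP _ _).1 cy e e0.
have ne : e * (rnorm y + M) = rnorm y * (rnorm y - M) / 2 by rewrite /e; field; lra.
have hz := h z Sz.
have z1 : rnorm z <= rnorm y + e.
  have := ler_rnormB z y 0; rewrite !subr0 rnormB; lra.
have := ler_rnormD (hdot (y - z) y) (hdot z y).
rewrite -dotDl subrK dot_rnorm rnorm_real ger0_norm ?sqr_ge0 // => h1.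
have h2 : rnorm (hdot (y - z) y) <= e * rnorm y.
  apply: le_trans (cauchy_schwarz _ _) _.
  by apply: ler_wpM2r; [exact: rnorm_ge0 | exact: ltW].
have h3 : M * rnorm z <= M * (rnorm y + e) by exact: ler_wpM2l.
have yp : 0 < rnorm y * (rnorm y - M) by rewrite mulr_gt0 ?subr_gt0.
nra.
Qed.

(** [U x] represents the functional sending a combination of the [q j] to the pairing of the same
    combination of the [p j] with [x]. The last clause says that the adjoint of [U] sends [q j] to
    [p j]. *)
Lemma partial_isometry p q : (forall i j, hdot (p i) (p j) = hdot (q i) (q j)) ->
  exists U : E -> E, [/\ linear U, forall x, rnorm (U x) <= rnorm x,
    forall j, U (p j) = q j, forall x, closure (lspan (range q)) (U x) &
    forall j x, hdot (q j) (U x) = hdot (p j) x].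
Proof.
move=> gram; have subq := subspace_lspan (range q).
have ex x : exists y, [/\ closure (lspan (range q)) y, rnorm y <= rnorm x &
    forall j, hdot (q j) y = hdot (p j) x].
  pose P z u := exists n (c : 'I_n -> C) (a : 'I_n -> J),
    z = \sum_i c i *: q (a i) /\ u = hdot (\sum_i c i *: p (a i)) x.
  have bP z u : P z u -> rnorm u <= rnorm x * rnorm z.
    case=> n [c [a [-> ->]]]; rewrite -(rnorm_sum_gram gram) mulrC.
    exact: cauchy_schwarz.
  have [||y cy hy] := riesz _ _ bP.
  - have a0 : 'I_0 -> J by case.
    by exists 0%N, (fun=> 0), a0; rewrite !big_ord0 dot0l.
  - move=> b _ _ _ _ [n [c [a [-> ->]]]] [m [c' [a' [-> ->]]]].
    exists (n + m)%N, (fun i => match fintype.split i with inl i => b * c i | inr i => c' i end),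
      (fun i => match fintype.split i with inl i => a i | inr i => a' i end).
    have spl (f : J -> E) : \sum_(i < n + m)
        match fintype.split i with inl i => b * c i | inr i => c' i end *:
        f (match fintype.split i with inl i => a i | inr i => a' i end) =
        b *: \sum_i c i *: f (a i) + \sum_i c' i *: f (a' i).
      rewrite big_split_ord scaler_sumr /=; congr (_ + _); apply: eq_bigr => i _.
        by rewrite (unsplitK (inl i)) scalerA.
      by rewrite (unsplitK (inr i)).
    by rewrite !spl dotDl dotZl.
  have nz z u (Pz : P z u) : rnorm (hdot z y) <= rnorm x * rnorm z.
    by rewrite (hy z u Pz); exact: bP.
  have cq : closure (lspan (range q)) y.
    apply: closure_subspace_sub cy => z [u [n [c [a [-> _]]]]].
    apply: sub_closure_rnorm; exists n, c, (fun i => q (a i)); split=> //.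
  exists y; split=> // [|j]; last first.
    rewrite (hy (q j) (hdot (p j) x)) //; exists 1%N, (fun=> 1), (fun=> j).
    by rewrite !big_ord1 !scale1r.
  by apply: (rnorm_closure_le (rnorm_ge0 x) cy) => z [u]; exact: nz.
have [U hU] := choice ex.
have ext y z : closure (lspan (range q)) y -> closure (lspan (range q)) z ->
    (forall j, hdot (q j) y = hdot (q j) z) -> y = z.
  move=> cy cz h; apply: (closure_ext subq cy cz) => x lx.
  apply/eqP; rewrite -subr_eq0 -dotBr; apply/eqP; apply: dot_lspan0 lx => _ [j _ <-].
  by rewrite dotBr h subrr.
have clq := subspace_closure subq.
exists U; split=> //.
- move=> b x y; have [[cx _ hx] [cy _ hy] [cz _ hz]] := And3 (hU x) (hU y) (hU (b *: x + y)).
  apply: ext => //; first exact: clq.2.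
  by move=> j; rewrite hz !dotDr !dotZr hx hy.
- by move=> x; have [] := hU x.
- move=> j; have [c _ h] := hU (p j); apply: ext => // [|i]; last by rewrite h gram.
  by apply: sub_closure_rnorm; apply: sub_lspan; exists j.
- by move=> x; have [] := hU x.
- by move=> j x; have [] := hU x.
Qed.

End PartialIsometry.

Section Unitary.
Variables (R : realType) (E : hilbertType R) (J : Type).
Local Notation C := R[i].
Implicit Types (p q : J -> E) (x y : E).

Definition total_family p := forall x, (forall j, hdot (p j) x = 0) -> x = 0.

Lemma isometry_dot (U : E -> E) : linear U -> (forall x, rnorm (U x) = rnorm x) ->
  forall x y, hdot (U x) (U y) = hdot x y.
Proof.
move=> linU isoU.
have UD x y : U (x + y) = U x + U y by have := linU 1 x y; rewrite !scale1r.
have U0 : U 0 = 0.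
  by have := linU (-1) 0 0; rewrite !scaleN1r !oppr0 !addr0 addNr.
have UZ a x : U (a *: x) = a *: U x by have := linU a x 0; rewrite U0 !addr0.
have Re_dot x y : complex.Re (hdot (U x) (U y)) = complex.Re (hdot x y).
  have := sqr_rnormD (U x) (U y); rewrite -UD !isoU sqr_rnormD; lra.
move=> x y; apply/eqP; rewrite -subr_eq0; apply/eqP.
apply: (@Re_lin_ge0_eq0 _ _ 0) => t.
rewrite mulr0 addr0 mulrBr -!dotZl -UZ ReD ReN Re_dot; lra.
Qed.

(** The contraction built with [p] and [q] exchanged is a left inverse of [U], so [U] cannot shrink
    norms. *)
Lemma isometry_of_total p q : (forall i j, hdot (p i) (p j) = hdot (q i) (q j)) ->
  total_family p ->
  exists U : E -> E, [/\ linear U, forall x y, hdot (U x) (U y) = hdot x y,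
    forall j, U (p j) = q j & forall x, closure (lspan (range q)) (U x)].
Proof.
move=> gram tp.
have [U [linU leU Up cU dU]] := partial_isometry gram.
have [U' [_ leU' _ _ dU']] := partial_isometry (fun i j => esym (gram i j)).
have UK x : U' (U x) = x.
  apply/eqP; rewrite -subr_eq0; apply/eqP; apply: tp => j.
  by rewrite dotBr dU' dU subrr.
exists U; split=> //; apply: isometry_dot => // x.
by apply/eqP; rewrite eq_le leU /= -{1}(UK x) leU'.
Qed.

Lemma unitary_of_total p q : (forall i j, hdot (p i) (p j) = hdot (q i) (q j)) ->
  total_family p -> total_family q ->
  exists U U' : E -> E, [/\ linear U, linear U', cancel U U', cancel U' U &
    [/\ forall x, rnorm (U x) <= rnorm x, forall x, rnorm (U' x) <= rnorm x &
     forall j, U (p j) = q j]].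
Proof.
move=> gram tp tq.
have [U [linU leU Up _ dU]] := partial_isometry gram.
have [U' [linU' leU' _ _ dU']] := partial_isometry (fun i j => esym (gram i j)).
exists U, U'; split=> // x; apply/eqP; rewrite -subr_eq0; apply/eqP.
  by apply: tp => j; rewrite dotBr dU' dU subrr.
by apply: tq => j; rewrite dotBr dU dU' subrr.
Qed.

End Unitary.

(** * Codimension counted by orthonormal complements *)

Section QuotientDimension.
Variables (R : realType) (E : hilbertType R).
Local Notation C := R[i].
Implicit Types (M A : set E).

(** The coordinates of the [w i] modulo [M] form a matrix with more rows than columns, which has a
    nonzero left kernel. *)
Lemma quotient_dim_dependent M n m (w : 'I_m -> E) : subspace M ->
  quotient_dim M n -> (n < m)%N ->
  exists2 a : 'rV[C]_m, a != 0 & M (\sum_i a 0 i *: w i).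
Proof.
move=> sM [e he] nm.
have ex i : exists c : 'rV[C]_n, M (w i - \sum_j c 0 j *: e j).
  by have [c [hc _]] := he (w i); exists c.
have [c hc] := choice ex.
pose A := \matrix_(i < m, j < n) c i 0 j.
have kA : kermx A != 0.
  rewrite kermx_eq0 /row_free; apply/eqP => rA.
  by have := rank_leq_col A; rewrite rA leqNgt nm.
have /rowV0Pn[a /sub_kermxP aA a0] := kA.
exists a => //.
have -> : \sum_i a 0 i *: w i = \sum_i a 0 i *: (w i - \sum_j c i 0 j *: e j).
  have z : \sum_i a 0 i *: (\sum_j c i 0 j *: e j) = 0.
    under eq_bigr do rewrite scaler_sumr; rewrite exchange_big big1 //= => j _.
    have aj : \sum_i a 0 i * c i 0 j = 0.
      have /matrixP/(_ 0 j) := aA; rewrite !mxE => h; rewrite -[RHS]h.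
      by apply: eq_bigr => i _; rewrite mxE.
    by under eq_bigr do rewrite scalerA; rewrite -scaler_suml aj scale0r.
  rewrite -[LHS]subr0 -[X in _ - X]z -sumrB.
  by apply: eq_bigr => i _; rewrite scalerBr.
by apply: subspace_sum => // i _; apply: subspaceZ.
Qed.

Definition orthonormal_family n (w : 'I_n -> E) :=
  forall i j, hdot (w i) (w j) = (i == j)%:R.

Lemma orthonormal_le_quotient_dim M n m (w : 'I_m -> E) : subspace M ->
  quotient_dim M n -> orthonormal_family w ->
  (forall i x, M x -> hdot x (w i) = 0) -> (m <= n)%N.
Proof.
move=> sM qM ow Mw; rewrite leqNgt; apply/negP => nm.
have [a /negP a0 aM] := quotient_dim_dependent w sM qM nm.
apply: a0; apply/eqP/rowP => k; rewrite !mxE.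
have := Mw k _ aM; rewrite dot_suml (bigD1 k) //= big1 => [|i ik].
  by rewrite dotZl ow eqxx mulr1 addr0.
by rewrite dotZl ow (negbTE ik) mulr0.
Qed.

Lemma quotient_dim_le M n m : subspace M ->
  quotient_dim M n -> quotient_dim M m -> (m <= n)%N.
Proof.
move=> sM qn [e he]; rewrite leqNgt; apply/negP => nm.
have [a /negP a0 aM] := quotient_dim_dependent e sM qn nm; apply: a0; apply/eqP.
have [c [_ uc]] := he 0.
have M0 : M (0 - \sum_i (0 : 'rV[C]_m) 0 i *: e i).
  by rewrite big1 ?subr0 => [|i _]; [exact: sM.1 | rewrite mxE scale0r].
have Ma : M (0 - \sum_i (- a) 0 i *: e i).
  rewrite sub0r -sumrN (eq_bigr (fun i => a 0 i *: e i)) // => i _.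
  by rewrite mxE scaleNr opprK.
by apply/eqP; rewrite -oppr_eq0 -(uc _ Ma) (uc _ M0).
Qed.

Lemma quotient_dim_uniq M n m : subspace M ->
  quotient_dim M n -> quotient_dim M m -> n = m.
Proof. by move=> sM qn qm; apply/eqP; rewrite eqn_leq !(quotient_dim_le sM). Qed.

Lemma orthonormal_quotient_dim A n (w : 'I_n -> E) : orthonormal_family w ->
  (forall i x, A x -> hdot x (w i) = 0) ->
  (forall x, (forall a, A a -> hdot a x = 0) -> (forall i, hdot (w i) x = 0) -> x = 0) ->
  quotient_dim (closure (lspan A)) n.
Proof.
move=> ow Aw tw; exists w => x.
have Mw i y : closure (lspan A) y -> hdot y (w i) = 0.
  by apply: dot_closure0 => z; apply: dot_lspan0 => a; exact: Aw.
have dw (c : 'rV[C]_n) k : hdot (\sum_i c 0 i *: w i) (w k) = c 0 k.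
  rewrite dot_suml (bigD1 k) //= big1 => [|i ik].
    by rewrite dotZl ow eqxx mulr1 addr0.
  by rewrite dotZl ow (negbTE ik) mulr0.
exists (\row_i hdot x (w i)); split=> [|c /(Mw _) h]; last first.
  apply/rowP => k; rewrite mxE; have := h k.
  by rewrite dotBl dw => /eqP; rewrite subr_eq0 => /eqP.
set y := x - _.
have [g cg hg] := projection_rest A y.
suff -> : y = g by [].
apply/eqP; rewrite -subr_eq0; apply/eqP; apply: tw => // i.
rewrite dotC dotBl (Mw i g cg) subr0 dotBl dw mxE subrr; exact: conjc0.
Qed.

End QuotientDimension.

Section Complement.
Variables (R : realType) (d : option nat).
Local Notation C := R[i].
Local Notation E := (cspace R d).
Implicit Types (A : set E) (x : E).

(* Gram-Schmidt applied to the standard basis modulo [A]; null residuals stay 0. *)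
Lemma complement_basis A : exists u : nat -> E,
  [/\ forall n a, A a -> hdot a (u n) = 0,
      forall m n, u n != 0 -> hdot (u m) (u n) = (m == n)%:R,
      forall n, ~~ in_dim d n -> u n = 0 &
      forall x, (forall a, A a -> hdot a x = 0) ->
        (forall n, hdot (u n) x = 0) -> x = 0].
Proof.
pose B n := A `|` [set cdelta R d k | k in `I_n].
have ex n : exists r : E, (forall x, B n x -> hdot x r = 0) /\
    closure (lspan (B n)) (cdelta R d n - r).
  have [g cg hg] := projection_rest (B n) (cdelta R d n).
  exists (cdelta R d n - g); split; [exact: hg | rewrite subKr; exact: cg].
have [r hr] := choice ex.
pose u n := (rnorm (r n))^-1%:C *: r n.
have rB n x : closure (lspan (B n)) x -> hdot x (r n) = 0.
  by apply: dot_closure0 => y; apply: dot_lspan0; exact: (hr n).1.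
(* A residual lies in the closed span of everything treated up to its own index, so later residuals
   are orthogonal to it. *)
have incl m n : (m < n)%N -> closure (lspan (B n)) (r m).
  move=> mn; have sB := subspace_closure (subspace_lspan (B n)).
  rewrite -[r m](subKr (cdelta R d m)); apply: (subspaceB sB).
    by apply: sub_closure_rnorm; apply: sub_lspan; right; exists m.
  apply: closure_subset (hr m).2; apply: lspan_sub; first exact: subspace_lspan.
  move=> x [Ax|[k /= km <-]]; apply: sub_lspan; [by left|right].
  by exists k => //=; exact: ltn_trans km mn.
have orth m n : m != n -> hdot (r m) (r n) = 0.
  rewrite neq_ltn => /orP[mn|nm]; first exact/rB/incl.
  by rewrite dotC rB ?conjc0 //; exact: incl.
exists u; split.
- by move=> n a Aa; rewrite dotZr rB ?mulr0 //; apply: sub_closure_rnorm; apply: sub_lspan; left.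
- move=> m n; have [->|mn] := eqVneq m n; last by rewrite dotZl dotZr orth ?mulr0.
  have [rn|rn0] := eqVneq (r n) 0; first by rewrite /u rn scaler0 eqxx.
  move=> _; rewrite /u dotZl dotZr conjc_real dot_rnorm -!rmorphM.
  have n0 : rnorm (r n) != 0 by apply: contra rn0 => /eqP/rnorm0_eq0 ->.
  have -> : (rnorm (r n))^-1 * ((rnorm (r n))^-1 * rnorm (r n) ^+ 2) = 1 by field.
  by [].
- move=> n nd; have e0 : cdelta R d n = 0.
    by apply: cspaceP => k; rewrite cdeltaE (negbTE nd).
  suff rn : r n = 0 by rewrite /u rn scaler0.
  have := rB n _ (hr n).2; rewrite e0 sub0r dotNl dot_rnorm => /eqP.
  rewrite oppr_eq0 fmorph_eq0 sqrf_eq0 => /eqP; exact: rnorm0_eq0.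
- move=> x Ax ux; have rx n : hdot (r n) x = 0.
    have [->|rn0] := eqVneq (r n) 0; first by rewrite dot0l.
    have := ux n; rewrite /u dotZl => /eqP.
    rewrite mulf_eq0 fmorph_eq0 invr_eq0 => /orP[/eqP h|/eqP //].
    by move: rn0; rewrite (rnorm0_eq0 h) eqxx.
  have dx n : hdot (cdelta R d n) x = 0.
    elim/ltn_ind: n => n IH; rewrite -[cdelta R d n](subrK (r n)) dotDl rx addr0.
    apply: dot_closure0 (hr n).2 => y; apply: dot_lspan0 => z [Az|[k /= kn <-]].
      exact: Ax.
    exact: IH.
  apply: cspaceP => n; have := dx n; rewrite dot_cdeltal => h.
  by rewrite -[LHS]conjcK h conjc0.
Qed.

Lemma quotient_dim_cspace m : d = Some m -> quotient_dim [set 0 : E] m.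
Proof.
move=> dm; exists (fun i : 'I_m => cdelta R d i) => x.
have sumE (c : 'rV[C]_m) k : (\sum_i c 0 i *: cdelta R d i : E) (nat_of_ord k) = c 0 k.
  rewrite coord_sum (bigD1 k) // big1 => [|i ik].
    by rewrite [LHS]addr0 coordZ cdeltaE dm /= ltn_ord eqxx mulr1.
  have e : (k == i :> nat) = false by rewrite eq_sym; exact: negbTE ik.
  by rewrite coordZ cdeltaE e andbF mulr0.
exists (\row_i x (nat_of_ord i)); split=> [|c /eqP]; last first.
  rewrite subr_eq0 => /eqP ->; apply/rowP => k; rewrite mxE; exact: sumE.
apply/eqP; rewrite subr_eq0; apply/eqP; apply: cspaceP => n.
have [nm|nm] := ltnP n m; last by rewrite !coord_out // dm /= -leqNgt.
by rewrite -[n]/(nat_of_ord (Ordinal nm)) sumE mxE.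
Qed.

Section Index.
Variables (A : set E) (u : nat -> E).
Hypothesis Au : forall n a, A a -> hdot a (u n) = 0.
Hypothesis ou : forall m n, u n != 0 -> hdot (u m) (u n) = (m == n)%:R.
Hypothesis tu : forall x, (forall a, A a -> hdot a x = 0) ->
  (forall n, hdot (u n) x = 0) -> x = 0.

Local Open Scope card_scope.
Local Notation I := [set n | u n != 0].

Lemma orthonormal_subfamily n (f : nat -> nat) :
  {in `I_n &, injective f} -> (forall i, (i < n)%N -> u (f i) != 0) ->
  orthonormal_family (fun i : 'I_n => u (f i)).
Proof.
move=> fi fI i j; rewrite ou ?fI //; congr (_%:R); congr nat_of_bool.
apply/eqP/eqP => [e|-> //]; apply: val_inj; apply: fi => //; apply/mem_set => /=; exact: ltn_ord.
Qed.

Lemma finite_index_quotient_dim n : I #= `I_n -> quotient_dim (closure (lspan A)) n.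
Proof.
rewrite card_eq_sym => /card_set_bijP[f [fI fi fs]].
apply: (@orthonormal_quotient_dim _ _ _ _ (fun i : 'I_n => u (f i))).
- by apply: orthonormal_subfamily => // i; exact: fI.
- by move=> i x; exact: Au.
- move=> x Ax fx; apply: tu => // m; have [->|um] := eqVneq (u m) 0; first by rewrite dot0l.
  by have [i /= ilt <-] := fs m um; have := fx (Ordinal ilt).
Qed.

Definition codim_index (k : option nat) : set nat := if k is Some n then `I_n else setT.

(** If finitely many [u n] are nonzero, they give a basis modulo the closed span, and the dimension
    is unique. If infinitely many are, [n.+1] of them exceed any finite dimension [n]. *)
Lemma card_index k :
  (if k is Some n then quotient_dim (closure (lspan A)) n
   else forall n, ~ quotient_dim (closure (lspan A)) n) ->
  I #= codim_index k.
Proof.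
move=> hk; have sM := subspace_closure (subspace_lspan A).
have [/finite_setP[m Im]|infI] := pselect (finite_set I).
  have qm := finite_index_quotient_dim Im.
  case: k hk => [n|] hk; last by case: (hk m).
  by rewrite /= (quotient_dim_uniq sM hk qm).
case: k hk => [n|] hk /=; last first.
  by apply/card_eqPle; split; [exact: countableP | exact/infiniteP].
have /infiniteP/pcard_leP[f] := infI.
have fI i : u (f i) != 0 by have : I (f i) by apply: funS.
have ow : orthonormal_family (fun i : 'I_n.+1 => u (f i)).
  apply: orthonormal_subfamily => [i j _ _|i _]; last exact: fI.
  by apply: (inj (f := f)); rewrite in_setT.
have := orthonormal_le_quotient_dim sM hk ow (fun i x => _).
by move=> /(_ ltac:(by move=> i; apply: dot_closure0 => z; apply: dot_lspan0 => a; exact: Au)); rewrite ltnn.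
Qed.

End Index.
End Complement.

Section UnitaryExtension.
Variables (R : realType) (d : option nat) (J : Type).
Local Notation C := R[i].
Local Notation E := (cspace R d).
Local Open Scope card_scope.
Variables (p q : J -> E).
Hypothesis gram : forall i j, hdot (p i) (p j) = hdot (q i) (q j).

Section Complements.
Variables (u v : nat -> E).
Hypothesis pu : forall n j, hdot (p j) (u n) = 0.
Hypothesis qv : forall n j, hdot (q j) (v n) = 0.
Hypothesis ou : forall m n, u n != 0 -> hdot (u m) (u n) = (m == n)%:R.
Hypothesis ov : forall m n, v n != 0 -> hdot (v m) (v n) = (m == n)%:R.

Definition join_family (T : Type) (f : J -> E) (g : T -> E) (i : J + T) : E :=
  match i with inl j => f j | inr n => g n end.

Lemma join_gram (T : eqType) (f g : T -> nat) : injective f -> injective g ->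
  (forall t, u (f t) != 0) -> (forall t, v (g t) != 0) ->
  forall i j, hdot (join_family p (u \o f) i) (join_family p (u \o f) j) =
    hdot (join_family q (v \o g) i) (join_family q (v \o g) j).
Proof.
move=> fi gi fu gv [i|s] [j|t] /=.
- exact: gram.
- by rewrite pu qv.
- by rewrite dotC pu [RHS]dotC qv.
- by rewrite ou // ov // (inj_eq fi) (inj_eq gi).
Qed.

End Complements.

(** If [b < a], matching all nonzero [v] with [b] of the nonzero [u] gives an isometry of the whole
    space whose range is orthogonal to a further [u]: the image of the basis and that vector are
    [m.+1] orthonormal vectors in dimension [m]. *)
Lemma finite_complement_le (u v : nat -> E) m a b :
  (forall n j, hdot (p j) (u n) = 0) -> (forall n j, hdot (q j) (v n) = 0) ->
  (forall m n, u n != 0 -> hdot (u m) (u n) = (m == n)%:R) ->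
  (forall m n, v n != 0 -> hdot (v m) (v n) = (m == n)%:R) ->
  (forall x, (forall j, hdot (q j) x = 0) -> (forall n, hdot (v n) x = 0) -> x = 0) ->
  d = Some m -> [set n | u n != 0] #= `I_a -> [set n | v n != 0] #= `I_b ->
  (a <= b)%N.
Proof.
move=> pu qv ou ov tv dm; rewrite card_eq_sym => /card_set_bijP[f [fI fi _]].
rewrite card_eq_sym => /card_set_bijP[g [gI gi gs]].
rewrite leqNgt; apply/negP => ba.
have inI n (i : 'I_n) : (i : nat) \in `I_n by apply/mem_set => /=.
pose f' (i : 'I_b) := f i; pose g' (i : 'I_b) := g i.
have f'i : injective f'.
  move=> i j h; apply: val_inj; apply: fi => //; apply/mem_set => /=;
    exact: ltn_trans (ltn_ord _) ba.
have g'i : injective g'.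
  by move=> i j h; apply: val_inj; apply: gi => //; exact: inI.
have f'u i : u (f' i) != 0 by apply: fI => /=; exact: ltn_trans (ltn_ord i) ba.
have g'v i : v (g' i) != 0 by apply: gI => /=.
have jg := join_gram pu qv ou ov f'i g'i f'u g'v.
have tot : total_family (join_family q (v \o g')).
  move=> x hx; apply: tv => [j|n]; first exact: (hx (inl j)).
  have [->|vn] := eqVneq (v n) 0; first by rewrite dot0l.
  by have [i /= ib <-] := gs n vn; exact: (hx (inr (Ordinal ib))).
have [U [_ isoU _ clU]] := isometry_of_total (fun i j => esym (jg i j)) tot.
have fb : u (f b) != 0 by apply: fI.
have Ub x : hdot (U x) (u (f b)) = 0.
  apply: dot_closure0 (clU x) => y; apply: dot_lspan0 => _ [[j|i] _ <-] /=; first exact: pu.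
  rewrite ou //; have -> : (f' i == f b) = false; last by [].
  apply/negbTE/eqP => /fi h.
  have : (i : nat) = b.
    by apply: h; apply/mem_set => //=; exact: ltn_trans (ltn_ord i) ba.
  by move=> e; have := ltn_ord i; rewrite e ltnn.
pose w (i : 'I_m.+1) := if unlift ord_max i is Some k then U (cdelta R d k) else u (f b).
have sub0 : subspace [set 0 : E].
  by split=> // c x y -> ->; rewrite scaler0 addr0.
have ow : orthonormal_family w.
  have dd (k l : 'I_m) : hdot (U (cdelta R d k)) (U (cdelta R d l)) = (k == l)%:R.
    by rewrite isoU dot_cdelta cdeltaE dm /= ltn_ord /= eq_sym.
  move=> i j; rewrite /w; case: unliftP => [k ->|->]; case: unliftP => [l ->|->].
  - by rewrite dd (inj_eq lift_inj).
  - by rewrite Ub eq_sym (negbTE (neq_lift _ _)).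
  - by rewrite dotC Ub conjc0 (negbTE (neq_lift _ _)).
  - by rewrite ou // !eqxx.
have := orthonormal_le_quotient_dim sub0 (quotient_dim_cspace R dm) ow.
by move=> /(_ (fun i x x0 => etrans (congr1 (fun t => hdot t (w i)) x0) (dot0l _))); rewrite ltnn.
Qed.

End UnitaryExtension.

Section UnitaryExtensionExists.
Variables (R : realType) (d : option nat) (J : Type).
Local Notation E := (cspace R d).
Local Open Scope card_scope.

Definition has_codim (M : set E) (k : option nat) :=
  if k is Some n then quotient_dim M n else forall n, ~ quotient_dim M n.

Lemma unitary_extension (p q : J -> E) :
  (forall i j, hdot (p i) (p j) = hdot (q i) (q j)) ->
  (exists k, has_codim (closure (lspan (range p))) k /\
             has_codim (closure (lspan (range q))) k) \/ d <> None ->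
  exists U U' : E -> E, [/\ linear U, linear U', cancel U U', cancel U' U &
    [/\ forall x, rnorm (U x) <= rnorm x, forall x, rnorm (U' x) <= rnorm x &
     forall j, U (p j) = q j]].
Proof.
move=> gram hd.
have [u [pu ou du tu]] := complement_basis (range p).
have [v [qv ov dv tv]] := complement_basis (range q).
have pu' n j : hdot (p j) (u n) = 0 by apply: pu; exists j.
have qv' n j : hdot (q j) (v n) = 0 by apply: qv; exists j.
have tu' x : (forall j, hdot (p j) x = 0) -> (forall n, hdot (u n) x = 0) -> x = 0.
  by move=> h; apply: tu => _ [j _ <-].
have tv' x : (forall j, hdot (q j) x = 0) -> (forall n, hdot (v n) x = 0) -> x = 0.
  by move=> h; apply: tv => _ [j _ <-].
have : [set n | u n != 0] #= [set n | v n != 0].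
  case: hd => [[k [kp kq]]|].
    have c1 := card_index pu ou tu kp; have c2 := card_index qv ov tv kq.
    by apply: card_eq_trans c1 _; rewrite card_eq_sym.
  move=> dN; have [m dm] : exists m, d = Some m by case: (d) dN => // m _; exists m.
  have fin (t : nat -> E) : (forall n, ~~ in_dim d n -> t n = 0) -> finite_set [set n | t n != 0].
    move=> dt; apply: sub_finite_set (finite_II m) => n /= tn.
    by apply: contraNT tn => nm; rewrite dt // dm.
  have [/finite_setP[a ha] /finite_setP[b hb]] := (fin u du, fin v dv).
  have ab : a = b.
    apply/eqP; rewrite eqn_leq (finite_complement_le gram pu' qv' ou ov tv' dm ha hb).
    exact: (finite_complement_le (fun i j => esym (gram i j)) qv' pu' ov ou tu' dm hb ha).
  by rewrite ab in ha; apply: card_eq_trans ha _; rewrite card_eq_sym.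
move=> /card_set_bijP[s [sI si ss]].
pose T := {n | u n != 0}.
pose f (t : T) := sval t; pose g (t : T) := s (sval t).
have fi : injective f by exact: val_inj.
have gi : injective g.
  by move=> [i hi] [j hj] /si h; apply: val_inj => /=; apply: h; exact/mem_set.
have fu t : u (f t) != 0 by exact: svalP t.
have gv t : v (g t) != 0 by apply: sI; exact: svalP t.
have jg := join_gram gram pu' qv' ou ov fi gi fu gv.
have [||U [U' [linU linU' K K' [n1 n2 Up]]]] := unitary_of_total jg.
- move=> x hx; apply: tu' => [j|n]; first exact: (hx (inl j)).
  have [->|un] := eqVneq (u n) 0; first by rewrite dot0l.
  exact: (hx (inr (exist _ n un))).
- move=> x hx; apply: tv' => [j|n]; first exact: (hx (inl j)).
  have [->|vn] := eqVneq (v n) 0; first by rewrite dot0l.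
  by have [i /= iu <-] := ss n vn; exact: (hx (inr (exist _ i iu))).
exists U, U'; split=> //; split=> // j; exact: (Up (inl j)).
Qed.

End UnitaryExtensionExists.

(** * Automorphisms of the ball *)

Section Differentiability.
Variables (R : realType).
Local Notation C := R[i].

Lemma near_rnormP (F : normedModType C) (x : F) (P : F -> Prop) :
  (\forall y \near x, P y) <->
  exists2 r : R, 0 < r & forall y, rnorm (y - x) < r -> P y.
Proof.
split.
  move=> /nbhs_ballP[e /= e0]; rewrite -ball_normE => h.
  exists (complex.Re e); first by rewrite -ltcR ge0_ReK ?ltW.
  move=> y yx; apply: h => /=.
  by rewrite -(ge0_ReK (ltW e0)) -rnormE ltcR rnormB.
move=> [r r0 h]; apply/nbhs_ballP; exists r%:C; first by rewrite /= ltcR.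
by rewrite -ball_normE => y /=; rewrite -rnormE ltcR rnormB; exact: h.
Qed.

Lemma linear_rnorm_continuous (F G : normedModType C) (L : {linear F -> G}) (K : R) :
  (forall x, rnorm (L x) <= K * rnorm x) -> continuous L.
Proof.
move=> hL x; apply/cvgrPdist_lt => e e0.
have r0 : 0 < complex.Re e by rewrite -ltcR ge0_ReK ?ltW.
apply/near_rnormP; exists (complex.Re e / (1 + `|K|)).
  by rewrite divr_gt0 // ltr_pwDl.
move=> y; rewrite rnormB -(ge0_ReK (ltW e0)) -rnormE ltcR -linearB ltr_pdivlMr ?ltr_pwDl //.
move=> yx; apply: le_lt_trans (hL _) (le_lt_trans _ yx); rewrite mulrC.
by apply: ler_wpM2l; [exact: rnorm_ge0 | have := ler_norm K; lra].
Qed.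

Lemma differentiable_rnormP (F G : normedModType C) (f : F -> G) (x : F) :
  differentiable f x <-> exists2 L : {linear F -> G}, continuous L &
    forall e : R, 0 < e -> exists2 r : R, 0 < r & forall h, rnorm h < r ->
      rnorm (f (h + x) - f x - L h) <= e * rnorm h.
Proof.
have littleP (L : {linear F -> G}) : f \o shift x = cst (f x) + L +o_ 0 id <->
    forall e : R, 0 < e -> exists2 r : R, 0 < r & forall h, rnorm h < r ->
      rnorm (f (h + x) - f x - L h) <= e * rnorm h.
  have fE y : (f \o shift x - (cst (f x) + L)) y = f (y + x) - f x - L y.
    by rewrite -[RHS]addrA -opprD.
  split=> [/eqaddoP h e e0|h].
    have /h/near_rnormP[r r0 hr] : 0 < e%:C by rewrite ltcR.
    exists r => // y yr; have := hr y; rewrite subr0 => /(_ yr).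
    have -> : e%:C * `|y| = (e * rnorm y)%:C by rewrite -rnormE rmorphM.
    by rewrite fE -rnormE lecR.
  apply/eqaddoP => e e0; have r0 : 0 < complex.Re e by rewrite -ltcR ge0_ReK ?ltW.
  have [r rp hr] := h _ r0; apply/near_rnormP; exists r => // y; rewrite subr0 => /hr hy.
  have -> : e * `|y| = (complex.Re e * rnorm y)%:C.
    by rewrite -rnormE -{1}(ge0_ReK (ltW e0)) rmorphM.
  by rewrite fE -rnormE lecR.
split=> [/diff_locallyP[cd h]|[L cL /littleP h]].
  by exists ('d f x) => //; apply/littleP.
by apply/diff_locallyP; rewrite (diff_unique cL h).
Qed.

Lemma near_eq_differentiable (F G : normedModType C) (f g : F -> G) (x : F) :
  (\forall y \near x, f y = g y) -> differentiable f x -> differentiable g x.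
Proof.
move=> /near_rnormP[s s0 fg] /differentiable_rnormP[L cL hL].
apply/differentiable_rnormP; exists L => // e /hL[r r0 hr].
exists (Num.min r s) => [|h]; first by rewrite lt_min r0.
rewrite lt_min => /andP[hr1 hs]; rewrite -!fg ?subrr ?rnorm0 ?addrK //; exact: hr.
Qed.

End Differentiability.

Section BallMaps.
Variables (R : realType) (d : option nat).
Local Notation C := R[i].
Local Notation E := (cspace R d).
Local Notation ball := (unit_ball R d).

Lemma ball_extensionE (F : ball -> ball) (z : ball) : ball_extension F z = F z :> E.
Proof. by rewrite /ball_extension valK. Qed.

Lemma near_ball (z : ball) (P : E -> Prop) :
  (forall y : ball, P y) -> \forall y \near (z : E), P y.
Proof.
move=> h; apply/near_rnormP; exists (1 - rnorm (z : E)).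
  by rewrite subr_gt0 rnorm_ball.
move=> y yz; have y1 : rnorm y < 1 by have := ler_rnormB y z 0; rewrite !subr0; lra.
by have [b <-] := mk_ball y1.
Qed.

Lemma holomorphic_comp (F G : ball -> ball) :
  holomorphic F -> holomorphic G -> holomorphic (F \o G).
Proof.
move=> hF hG z.
apply: (@near_eq_differentiable R _ _ (ball_extension F \o ball_extension G)).
  by apply: near_ball => y /=; rewrite !ball_extensionE.
by apply: differentiable_comp; [exact: hG | rewrite ball_extensionE; exact: hF].
Qed.

Lemma automorphism_comp (F G : ball -> ball) :
  ball_automorphism F -> ball_automorphism G -> ball_automorphism (F \o G).
Proof.
move=> [F' [FK F'K hF hF']] [G' [GK G'K hG hG']].
exists (G' \o F'); split; [exact: can_comp | exact: can_comp | |];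
  exact: holomorphic_comp.
Qed.

Lemma holomorphic_local (F : ball -> ball) (f : E -> E) :
  (forall z : ball, F z = f z :> E) ->
  (forall z : ball, differentiable f (z : E)) -> holomorphic F.
Proof.
move=> Ff df z; apply: near_eq_differentiable (df z).
by apply: near_ball => y; rewrite ball_extensionE Ff.
Qed.

Lemma linear_automorphism (U U' : E -> E) : linear U -> linear U' ->
  cancel U U' -> cancel U' U -> (forall x, rnorm (U x) <= rnorm x) ->
  (forall x, rnorm (U' x) <= rnorm x) ->
  exists2 F : ball -> ball, ball_automorphism F & forall z : ball, F z = U z :> E.
Proof.
move=> linU linU' K K' n n'.
have ballU (T : E -> E) (nT : forall x, rnorm (T x) <= rnorm x) (z : ball) :
  rnorm (T z) < 1 by apply: le_lt_trans (nT _) (rnorm_ball z).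
pose F z := sval (mk_ball (ballU U n z)); pose F' z := sval (mk_ball (ballU U' n' z)).
have FE z : F z = U z :> E by exact: svalP (mk_ball _).
have F'E z : F' z = U' z :> E by exact: svalP (mk_ball _).
have hol (T : E -> E) (G : ball -> ball) : linear T ->
    (forall x, rnorm (T x) <= rnorm x) -> (forall z, G z = T z :> E) -> holomorphic G.
  move=> linT nT GE; pose TL : {linear E -> E} := HB.pack T (GRing.isLinear.Build _ _ _ _ _ linT).
  apply: (@holomorphic_local _ TL) => // z; apply: linear_differentiable.
  by apply: (@linear_rnorm_continuous R _ _ TL 1) => x; rewrite mul1r; exact: nT.
exists F => //; exists F'; split.
- by move=> z; apply: val_inj; rewrite /= F'E FE K.
- by move=> z; apply: val_inj; rewrite /= FE F'E K'.
- exact: hol linU n FE.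
- exact: hol linU' n' F'E.
Qed.

(** The derivative of [theta_vec l] at [z] in the direction [h], by the quotient rule. *)
Definition theta_diff (l z h : E) : E :=
  (1 - hdot z l)^-1 *: (hdot h l *: theta_vec l z - (defect l)%:C *: h -
    (hdot h l / (1 + (defect l)%:C)) *: l).

Lemma linear_theta_diff (l z : E) : linear (theta_diff l z).
Proof.
move=> a h k; rewrite /theta_diff dotDl dotZl; move: (theta_vec l z) => m; apply: cspaceP => i.
rewrite !(coordB, coordD, coordZ); ring.
Qed.

Lemma theta_diff_error (l z h : E) : 1 - hdot z l != 0 -> 1 - hdot (h + z) l != 0 ->
  1 + (defect l)%:C != 0 ->
  theta_vec l (h + z) - theta_vec l z - theta_diff l z h =
  ((1 - hdot (h + z) l)^-1 * hdot h l) *: theta_diff l z h.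
Proof.
rewrite dotDl => z1 h1 s1; apply: cspaceP => i.
rewrite /theta_diff /theta_vec !(coordB, coordD, coordZ) dotDl.
move: z1 h1 s1; move: (hdot z l) (hdot h l) (_%:C) (z i) (h i) (l i) => a b s u v w z1 h1 s1.
by field; rewrite z1 h1 s1.
Qed.

Lemma theta_diff_bound (l z : E) : exists K : R, 0 <= K /\
  forall h, rnorm (theta_diff l z h) <= K * rnorm h.
Proof.
rewrite /theta_diff; move: (theta_vec l z) => m.
pose k := rnorm ((1 - hdot z l)^-1).
pose c := rnorm ((1 + (defect l)%:C)^-1).
exists (k * (rnorm l * rnorm (m) + defect l + rnorm l * c * rnorm l)).
have d0 : 0 <= defect l by exact: sqrtr_ge0.
have n0 (F : normedModType C) (x : F) := rnorm_ge0 x.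
split; first by rewrite !(mulr_ge0, addr_ge0) ?n0.
move=> h; rewrite rnormZ -/k -mulrA; apply: ler_wpM2l; first exact: n0.
have cs := cauchy_schwarz h l.
have h1 := ler_rnormD (hdot h l *: m - (defect l)%:C *: h)
  (- ((hdot h l / (1 + (defect l)%:C)) *: l)).
have h2 := ler_rnormD (hdot h l *: m) (- ((defect l)%:C *: h)).
rewrite !rnormN !rnormZ ?rnormM rnorm_real (ger0_norm d0) -/c in h1 h2.
apply: le_trans h1 _.
have e1 : rnorm (hdot h l) * rnorm (m) <=
    rnorm h * rnorm l * rnorm (m) by apply: ler_wpM2r; rewrite ?n0.
have e2 : rnorm (hdot h l) * c * rnorm l <= rnorm h * rnorm l * c * rnorm l.
  by apply: ler_wpM2r; rewrite ?n0 //; apply: ler_wpM2r; rewrite ?n0.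
lra.
Qed.

Lemma differentiable_theta (l z : ball) : differentiable (theta_vec (l : E)) (z : E).
Proof.
have [K [K0 hK]] := theta_diff_bound l z.
pose L : {linear E -> E} :=
  HB.pack (theta_diff l z) (GRing.isLinear.Build _ _ _ _ _ (linear_theta_diff l z)).
apply/differentiable_rnormP; exists L; first exact: (@linear_rnorm_continuous R _ _ L K).
move=> e e0; pose q := 1 - rnorm (l : E).
have q0 : 0 < q by rewrite subr_gt0 rnorm_ball.
(* The first bound keeps [h + z] in the closed ball, where the denominator has modulus at least [q];
   the second makes the error factor [q^-1 |h| K] at most [e]. *)
exists (Num.min (1 - rnorm (z : E)) (e * q / (1 + K))).
  have K1 : 0 < 1 + K by lra.
  by rewrite lt_min subr_gt0 rnorm_ball divr_gt0 // mulr_gt0.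
move=> h; rewrite lt_min => /andP[h1 h2].
have hz1 : rnorm (h + z) <= 1 by have := ler_rnormD h z; lra.
have n1 := dot_base_neq1 (rnorm_ball l) hz1.
rewrite (theta_diff_error (dot_ball_neq1 z l) n1 (defect1_neq0 (rnorm_ball l))).
rewrite rnormZ rnormM.
have hL := hK h.
have kq : rnorm ((1 - hdot (h + z) (l : E))^-1) <= q^-1.
  have qn : q <= rnorm (1 - hdot (h + z) (l : E)).
    have := ler_rnormD (1 - hdot (h + z) (l : E)) (hdot (h + z) (l : E)).
    rewrite subrK rnorm1; have := cauchy_schwarz (h + z) (l : E).
    have := ler_wpM2r (rnorm_ge0 (l : E)) hz1; rewrite mul1r /q.
    by move=> a1 a2 a3; rewrite lerBlDr (le_trans a3) // lerD2l (le_trans a2).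
  have p0 := lt_le_trans q0 qn.
  have -> : rnorm ((1 - hdot (h + z) (l : E))^-1) = (rnorm (1 - hdot (h + z) (l : E)))^-1.
    apply: (mulfI (lt0r_neq0 p0)); rewrite -rnormM !mulfV ?rnorm1 //; exact: lt0r_neq0.
  by rewrite lef_pV2.
have hl : rnorm (hdot h (l : E)) <= rnorm h.
  apply: le_trans (cauchy_schwarz _ _) _.
  by rewrite ler_piMr ?rnorm_ge0 // ltW // rnorm_ball.
have i0 : 0 <= q^-1 by rewrite invr_ge0 ltW.
have s1 : rnorm ((1 - hdot (h + z) (l : E))^-1) * rnorm (hdot h (l : E)) <= q^-1 * rnorm h.
  by apply: ler_pM; rewrite ?rnorm_ge0.
apply: le_trans (ler_pM _ _ s1 hL) _; rewrite ?mulr_ge0 ?rnorm_ge0 //.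
rewrite mulrA; apply: ler_wpM2r; first exact: rnorm_ge0.
rewrite -mulrA mulrC ler_pdivrMr //; apply: le_trans (ltW _); last first.
  by move: h2; rewrite ltr_pdivlMr ?ltr_pwDl //; exact.
by apply: ler_wpM2l; [exact: rnorm_ge0 | rewrite lerDr].
Qed.

Lemma theta_automorphism (l : ball) : ball_automorphism (theta l).
Proof.
have hol : holomorphic (theta l).
  apply: (@holomorphic_local _ (theta_vec (l : E))) => z; first exact: thetaE.
  exact: differentiable_theta.
by exists (theta l); split=> //; exact: thetaK.
Qed.

Lemma automorphism_id : ball_automorphism (@id ball).
Proof.
exists id; split=> //; apply: (@holomorphic_local _ id) => // z;
  exact: differentiable_id.
Qed.

End BallMaps.

(** * Affine codimension under the involutions *)

Section AffineCodimension.
Variables (R : realType).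
Local Notation C := R[i].

Section Linear.
Variables (E F : hilbertType R).

Lemma linear_fun_sum (U : E -> F) : linear U -> forall n (c : 'I_n -> C) (e : 'I_n -> E),
  U (\sum_i c i *: e i) = \sum_i c i *: U (e i).
Proof.
move=> linU n c e; pose UL : {linear E -> F} :=
  HB.pack U (GRing.isLinear.Build _ _ _ _ _ linU).
by rewrite -[U]/(UL : E -> F) linear_sum; apply: eq_bigr => i _; rewrite linearZ.
Qed.

Lemma linear_fun_sub (U : E -> F) : linear U -> forall x y, U (x - y) = U x - U y.
Proof. by move=> linU x y; rewrite addrC -scaleN1r linU scaleN1r addrC. Qed.

Lemma linear_fun_scale (U : E -> F) : linear U -> forall a x, U (a *: x) = a *: U x.
Proof.
move=> linU a x; have := linear_fun_sum linU (fun=> a) (fun _ : 'I_1 => x).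
by rewrite !big_ord1.
Qed.

Lemma lspan_linear (U : E -> F) (A : set E) (B : set F) : linear U ->
  (forall a, A a -> lspan B (U a)) -> forall y, lspan A y -> lspan B (U y).
Proof.
move=> linU AB y [n [c [a [Aa ->]]]]; rewrite linear_fun_sum //.
have sB := subspace_lspan B.
by apply: subspace_sum => // i _; apply: subspaceZ => //; exact: AB.
Qed.

Lemma closure_linear (U : E -> F) (K : R) (D : set E) (D' : set F) : linear U ->
  (forall x, rnorm (U x) <= K * rnorm x) ->
  (forall y, D y -> D' (U y)) -> forall y, closure D y -> closure D' (U y).
Proof.
move=> linU nU DD' y /closure_rnormP cy; apply/closure_rnormP => e e0.
have [|a Da ya] := cy (e / (1 + `|K|)); first by rewrite divr_gt0 // ltr_pwDl.
exists (U a); first exact: DD'.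
rewrite -linear_fun_sub //; apply: le_lt_trans (nU _) _.
move: ya; rewrite ltr_pdivlMr ?ltr_pwDl // => /(le_lt_trans _); apply.
by rewrite mulrC; apply: ler_wpM2l; [exact: rnorm_ge0 | have := ler_norm K; lra].
Qed.

Lemma quotient_dim_linear (U : E -> F) (U' : F -> E) (D : set E) (D' : set F) n :
  linear U -> cancel U' U -> (forall y, D' (U y) <-> D y) ->
  quotient_dim D n -> quotient_dim D' n.
Proof.
move=> linU K DD' [e he]; exists (U \o e) => x.
have [c [hc uc]] := he (U' x).
have key (a : 'rV[C]_n) : x - \sum_i a 0 i *: (U \o e) i =
    U (U' x - \sum_i a 0 i *: e i).
  by rewrite linear_fun_sub // K linear_fun_sum.
exists c; split=> [|a]; first by rewrite key; apply/DD'.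
by rewrite key => /DD'; exact: uc.
Qed.

End Linear.

Variable d : option nat.
Local Notation E := (cspace R d).
Local Notation ball := (unit_ball R d).

Lemma aff_sub (S : set E) l : S l ->
  [set x - l | x in aff S] = lspan [set s - l | s in S].
Proof.
move=> Sl; have sB := subspace_lspan [set s - l | s in S].
apply/seteqP; split=> [_ [_ [l' [u [Sl' su ->]] <-]]|y ly]; last first.
  by exists (l + y); [exists l, y | rewrite addrC addKr].
have inB s : S s -> lspan [set s - l | s in S] (s - l).
  by move=> Ss; apply: sub_lspan; exists s.
rewrite addrAC; apply: (subspaceD sB); first exact: inB.
apply: lspan_sub su => // _ [s Ss <-].
have -> : s - l' = (s - l) - (l' - l) by rewrite opprB addrA subrK.
by apply: (subspaceB sB); exact: inB.
Qed.

(* [theta l z] is a multiple of [base_map l (z - l)], where [base_map l] is the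
   identity on [C l] and multiplication by [defect l] on its complement. *)
Definition base_map (l y : E) : E :=
  (defect l)%:C *: y + (hdot y l / (1 + (defect l)%:C)) *: l.

Definition base_inv (l y : E) : E :=
  (defect l)%:C^-1 *: y - (hdot y l / ((defect l)%:C * (1 + (defect l)%:C))) *: l.

Lemma linear_base_map l : linear (base_map l).
Proof.
move=> a x y; rewrite /base_map dotDl dotZl; apply: cspaceP => i.
rewrite !(coordD, coordZ); ring.
Qed.

Lemma linear_base_inv l : linear (base_inv l).
Proof.
move=> a x y; rewrite /base_inv dotDl dotZl; apply: cspaceP => i.
rewrite !(coordB, coordD, coordZ); ring.
Qed.

Lemma rnorm_scale_rank1 (a b : C) (l y : E) :
  rnorm (a *: y + (hdot y l * b) *: l) <= (rnorm a + rnorm l * rnorm b * rnorm l) * rnorm y.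
Proof.
apply: le_trans (ler_rnormD _ _) _; rewrite !rnormZ mulrDl lerD2l.
have h := ler_wpM2r (mulr_ge0 (rnorm_ge0 b) (rnorm_ge0 l)) (cauchy_schwarz y l).
by rewrite -mulrA (le_trans h) // le_eqVlt; apply/orP; left; apply/eqP; ring.
Qed.

Section BaseMap.
Variable l : E.
Hypothesis l1 : rnorm l < 1.

Lemma base_invK : cancel (base_inv l) (base_map l).
Proof.
move=> y; have s0 := defect_neq0 l1; have s1 := defect1_neq0 l1.
rewrite /base_map /base_inv dotBl !dotZl dot_base //.
apply: cspaceP => i; rewrite !(coordB, coordD, coordZ).
move: s0 s1; move: (hdot y l) (_%:C) (y i) (l i) => a s u v s0 s1.
by field; rewrite s0 s1.
Qed.

Lemma base_mapK : cancel (base_map l) (base_inv l).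
Proof.
move=> y; have s0 := defect_neq0 l1; have s1 := defect1_neq0 l1.
rewrite /base_map /base_inv dotDl !dotZl dot_base //.
apply: cspaceP => i; rewrite !(coordB, coordD, coordZ).
move: s0 s1; move: (hdot y l) (_%:C) (y i) (l i) => a s u v s0 s1.
by field; rewrite s0 s1.
Qed.

Lemma theta_vec_base_map z : 1 - hdot z l != 0 ->
  base_map l (z - l) = - (1 - hdot z l) *: theta_vec l z.
Proof.
move=> z1; have s1 := defect1_neq0 l1.
rewrite /base_map /theta_vec dotBl dot_base //.
apply: cspaceP => i; rewrite !(coordB, coordD, coordZ).
move: z1 s1; move: (hdot z l) (_%:C) (z i) (l i) => a s u v a1 s1.
by field; rewrite a1 s1.
Qed.

End BaseMap.

(** [base_map l] and its inverse are bounded, so they match the closures of the two spans as well;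
    the scalar factors depending on the point are absorbed by the span. *)
Lemma theta_codim (J : Type) (x : J -> ball) (j0 : J) k :
  affine_codim (range (fun j => x j : E)) k ->
  has_codim (closure (lspan (range (fun j => theta (x j0) (x j) : E)))) k.
Proof.
pose l : E := x j0; pose S := range (fun j => x j : E).
have Sl : S l by exists j0.
have l1 : rnorm l < 1 by exact: rnorm_ball.
have affl : aff S l.
  exists l, 0; split=> //; last by rewrite addr0.
  exact: (subspace_lspan _).1.
move=> /(_ l affl); rewrite (aff_sub Sl) /=.
set D := lspan _; set D' := lspan _.
have th j : theta_vec l (x j : E) = theta (x j0) (x j) by rewrite thetaE.
have n1 j : 1 - hdot (x j : E) l != 0 by exact: dot_ball_neq1.
have fw y : D y -> D' (base_map l y).
  apply: lspan_linear; first exact: linear_base_map.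
  move=> _ [_ [j _ <-] <-]; rewrite theta_vec_base_map // th.
  by apply: subspaceZ; [exact: subspace_lspan | apply: sub_lspan; exists j].
have bw y : D' y -> D (base_inv l y).
  apply: lspan_linear; first exact: linear_base_inv.
  move=> _ [j _ <-].
  have -> : ball_pt (theta (x j0) (x j)) =
      base_map l ((- (1 - hdot (x j : E) l))^-1 *: ((x j : E) - l)).
    rewrite (linear_fun_scale (linear_base_map l)).
    by rewrite theta_vec_base_map // scalerA mulVf ?oppr_eq0 // scale1r th.
  rewrite base_mapK //; apply: subspaceZ; first exact: subspace_lspan.
  by apply: sub_lspan; exists (x j : E) => //; exists j.
have DD' y : closure D' (base_map l y) <-> closure D y.
  split=> [h|].
    rewrite -(base_mapK l1 y); apply: closure_linear h => //.
    - exact: linear_base_inv.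
    - by move=> z; rewrite /base_inv -scaleNr -mulrN; exact: rnorm_scale_rank1.
  apply: closure_linear => //; first exact: linear_base_map.
  by move=> z; exact: rnorm_scale_rank1.
have DD y : closure D (base_inv l y) <-> closure D' y.
  by rewrite -DD' base_invK.
case: k => [n|] /= hk.
  exact: (quotient_dim_linear (linear_base_map l) (base_invK l1) DD' hk).
move=> n hn; apply: (hk n).
exact: (quotient_dim_linear (linear_base_inv l) (base_mapK l1) DD hn).
Qed.

End AffineCodimension.

(** * The inverse isomorphism and the conclusion *)

Section MultiplierIsomorphism.
Variables (R : realType) (d : option nat) (H : drury_arveson R d).
Local Notation C := R[i].
Local Notation E := (cspace R d).
Local Notation ball := (unit_ball R d).
Local Notation pts V := (fun v : V => val v : ball).

Lemma multiplierP (V : set ball) (f : V -> C) : multiplier H V f <-> bdd (kmap (pts V)) f.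
Proof. by split; [exact: multiplier_bdd | exact: bdd_multiplier]. Qed.

Lemma variety_separates (V : set ball) : variety H V ->
  forall l : ball, (forall z : V, val z <> l) ->
  exists h : H, (forall z : V, rkhs_fun h (val z) = 0) /\ rkhs_fun h l <> 0.
Proof.
move=> [S VS] l nl; apply: contrapT => no.
have Vl : V l.
  rewrite VS => h Sh; apply: contrapT => hl; apply: no; exists h; split=> // z.
  by have := set_valP z; rewrite {1}VS; exact.
exact: (nl (exist _ l (mem_set Vl))).
Qed.

Variables (V W : set ball) (phi : (V -> C) -> (W -> C)).
Hypotheses (phi_iso : algebra_isomorphism H phi) (phi_ci : completely_isometric H phi).

Lemma isomorphism_cc_hom : exists psi : (W -> C) -> (V -> C),
  [/\ cc_hom (kmap (pts V)) (kmap (pts W)) phi,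
      cc_hom (kmap (pts W)) (kmap (pts V)) psi,
      forall f, bdd (kmap (pts V)) f -> psi (phi f) = f &
      forall g, bdd (kmap (pts W)) g -> phi (psi g) = g].
Proof.
have [[phi_fun phi_inj phi_surj] phi_lin phi_mul] := phi_iso.
pose pV := psd_kmap H (pts V); pose pW := psd_kmap H (pts W).
(* Surjectivity concerns multipliers only; elsewhere [psi] takes an arbitrary value. *)
have ex g : exists f, multiplier H W g -> multiplier H V f /\ phi f = g.
  have [Mg|nMg] := pselect (multiplier H W g); last by exists 0.
  by have [f Mf <-] := phi_surj g Mg; exists f.
have [psi hpsi] := choice ex.
have MM f : multiplier H V f -> multiplier H W (phi f) by exact: phi_fun.
have psiM g : multiplier H W g -> multiplier H V (psi g) by move=> /hpsi[].
have psiK g : multiplier H W g -> phi (psi g) = g by move=> /hpsi[].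
have inj f g : multiplier H V f -> multiplier H V g -> phi f = phi g -> f = g.
  by move=> Mf Mg; apply: phi_inj; exact: mem_set.
have phiK f : multiplier H V f -> psi (phi f) = f.
  by move=> Mf; apply: inj; rewrite ?psiK //; [apply: psiM|]; exact: MM.
have V1 : multiplier H V (fun=> 1) by apply/multiplierP; exact: (bdd_cst pV).
have W1 : multiplier H W (fun=> 1) by apply/multiplierP; exact: (bdd_cst pW).
(* Unitality follows from surjectivity: [phi 1] multiplied by [phi (psi 1) = 1] is again 1. *)
have phi1 : phi (fun=> 1) = (fun=> 1).
  have e : (fun=> 1 : C) * psi (fun=> 1) = psi (fun=> 1).
    by apply/funext => v; exact: mul1r.
  have := phi_mul _ _ V1 (psiM _ W1); rewrite e psiK // => h.
  by apply/funext => w; exact: esym (etrans (congr1 (@^~ w) h) (mulr1 _)).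
have MD (a : C) f g : multiplier H W f -> multiplier H W g -> multiplier H W (a *: f + g).
  move=> /multiplierP bf /multiplierP bg; apply/multiplierP.
  by apply: (bddD pW) => //; exact: (bddZ pW).
have MDV (a : C) f g : multiplier H V f -> multiplier H V g -> multiplier H V (a *: f + g).
  move=> /multiplierP bf /multiplierP bg; apply/multiplierP.
  by apply: (bddD pV) => //; exact: (bddZ pV).
have Mm f g : multiplier H W f -> multiplier H W g -> multiplier H W (f * g).
  by move=> /multiplierP bf /multiplierP bg; apply/multiplierP; exact: bddM.
have MmV f g : multiplier H V f -> multiplier H V g -> multiplier H V (f * g).
  by move=> /multiplierP bf /multiplierP bg; apply/multiplierP; exact: bddM.
exists psi; split.
- split=> //.
  + by move=> f /multiplierP Mf; apply/multiplierP; exact: MM.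
  + by move=> a f g /multiplierP Mf /multiplierP Mg; exact: phi_lin.
  + by move=> f g /multiplierP Mf /multiplierP Mg; exact: phi_mul.
  + move=> n A bA cA; have MA i j : multiplier H V (A i j) by apply/multiplierP.
    apply/(@mult_norm_le1P _ _ _ H W) => [i j|]; first by rewrite mxE; exact: MM.
    by rewrite phi_ci //; apply/mult_norm_le1P.
- split.
  + by move=> f /multiplierP Mf; apply/multiplierP; exact: psiM.
  + move=> a f g /multiplierP Mf /multiplierP Mg.
    have [Pf Pg] := (psiM _ Mf, psiM _ Mg).
    apply: inj; [exact/psiM/MD | exact: MDV |].
    by rewrite phi_lin // !psiK //; exact: MD.
  + move=> f g /multiplierP Mf /multiplierP Mg.
    have [Pf Pg] := (psiM _ Mf, psiM _ Mg).
    apply: inj; [exact/psiM/Mm | exact: MmV |].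
    by rewrite phi_mul // !psiK //; exact: Mm.
  + by rewrite -phi1 phiK.
  + move=> n A bA cA; have MA i j : multiplier H W (A i j) by apply/multiplierP.
    (* As [phi_ci] is an equality of norms, it also shows that the inverse is completely
       contractive. *)
    have Mp i j : multiplier H V (map_mx psi A i j) by rewrite mxE; exact: psiM.
    apply/(@mult_norm_le1P _ _ _ H V) => //; rewrite -phi_ci //.
    have -> : map_mx phi (map_mx psi A) = A.
      by apply/matrixP => i j; rewrite !mxE psiK.
    by apply/mult_norm_le1P.
- by move=> f /multiplierP; exact: phiK.
- by move=> g /multiplierP; exact: psiK.
Qed.

End MultiplierIsomorphism.

(** On an empty type the constants 0 and 1 coincide, and [phi] preserves both. *)
Lemma cc_hom_inhabited (R : realType) (X Y : Type) (kX : X -> X -> R[i])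
    (kY : Y -> Y -> R[i]) (phi : (X -> R[i]) -> (Y -> R[i])) :
  psd kX -> cc_hom kX kY phi -> inhabited Y -> inhabited X.
Proof.
move=> pX hphi [y]; apply: contrapT => nX.
have e : (fun=> 0) = (fun=> 1) :> (X -> R[i]).
  by apply/funext => v; case: nX.
have := congr1 (phi^~ y) e; rewrite !(cc_cst pX hphi) => /eqP.
by rewrite eq_sym oner_eq0.
Qed.

Theorem proposition4p3 (R : realType) (d : option nat) (d_pos : d <> Some 0%N)
    (H : drury_arveson R d) (V W : set (unit_ball R d))
    (varV : variety H V) (varW : variety H W)
    (codimVW : same_affine_codim (@ball_pt R d @` V) (@ball_pt R d @` W) \/ d <> None)
    (phi : (V -> R[i]) -> (W -> R[i]))
    (phi_iso : algebra_isomorphism H phi)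
    (phi_ci : completely_isometric H phi) :
  exists F : unit_ball R d -> unit_ball R d,
    [/\ ball_automorphism F, F @` W = V &
        forall f, multiplier H V f ->
          forall (w : W) (v : V), val v = F (val w) -> phi f w = f v].
Proof.
have [psi [hphi hpsi phiK psiK]] := isomorphism_cc_hom phi_iso phi_ci.
have pV := psd_kmap H (fun v : V => val v : unit_ball R d).
have pW := psd_kmap H (fun w : W => val w : unit_ball R d).
have sepV := variety_separates varV; have sepW := variety_separates varW.
have Vi : injective (fun v : V => val v : unit_ball R d) by exact: val_inj.
have Wi : injective (fun w : W => val w : unit_ball R d) by exact: val_inj.
have [[z1 [z2 z12]]|one] := pselect (exists z1 z2 : V, val z1 <> val z2).
  have [Phi [Psi [PhiK PsiK hPhi hPsi]]] :=
    point_map Vi Wi hphi hpsi phiK psiK z12 sepV sepW.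
  pose w0 := Psi z1; pose v0 := Phi w0.
  have gram z w : hdot (theta (val w0) (val z) : cspace R d) (theta (val w0) (val w) : cspace R d) =
      hdot (theta (val v0) (val (Phi z)) : cspace R d) (theta (val v0) (val (Phi w)) : cspace R d).
    exact: esym (point_map_isometry H Wi hphi hpsi phiK psiK z12 PhiK PsiK hPhi hPsi w0 z w).
  have rW : range (fun w : W => val w : cspace R d) = @ball_pt R d @` W.
    apply/seteqP; split=> [_ [w _ <-]|_ [b Wb <-]]; first by exists (val w) => //; exact: set_valP.
    by exists (exist _ b (mem_set Wb)).
  have rV : range (fun w : W => val (Phi w) : cspace R d) = @ball_pt R d @` V.
    apply/seteqP; split=> [_ [w _ <-]|_ [b Vb <-]].
      by exists (val (Phi w)) => //; exact: set_valP.
    by exists (Psi (exist _ b (mem_set Vb))); rewrite ?PsiK.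
  have hd : (exists k,
      has_codim (closure (lspan (range (fun w : W => theta (val w0) (val w) : cspace R d)))) k /\
      has_codim (closure (lspan (range (fun w : W => theta (val v0) (val (Phi w)) : cspace R d)))) k)
      \/ d <> None.
    case: codimVW => [[k [kV kW]]|]; [left; exists k; split|by right].
    - by apply: (@theta_codim R d W (fun w => val w) w0); rewrite rW.
    - by apply: (@theta_codim R d W (fun w => val (Phi w)) w0); rewrite rV.
  have [U [U' [linU linU' K K' [n n' Up]]]] := unitary_extension gram hd.
  have [F0 autF0 F0E] := linear_automorphism linU linU' K K' n n'.
  pose F := theta (val v0) \o F0 \o theta (val w0).
  have FW w : F (val w) = val (Phi w).
    rewrite -[RHS](thetaK (val v0)) /F /=; congr (theta _ _).
    by apply: val_inj; rewrite /= F0E Up.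
  exists F; split.
  - apply: automorphism_comp; last exact: theta_automorphism.
    by apply: automorphism_comp => //; exact: theta_automorphism.
  - apply/seteqP; split=> [_ [b Wb <-]|b Vb].
      by rewrite -[b]/(val (exist _ b (mem_set Wb) : W)) FW; exact: set_valP.
    exists (val (Psi (exist _ b (mem_set Vb)))); first exact: set_valP.
    by rewrite FW PsiK.
  - move=> f /multiplierP bf w v vF; rewrite hPhi //; congr f.
    by apply: val_inj; rewrite /= vF FW.
(* From here on [V] has at most one point, and all functions on it are constant. *)
have sub (v v' : V) : v = v'.
  by apply: val_inj; apply: contrapT => h; apply: one; exists v, v'.
have [[v0]|nV] := pselect (inhabited V); last first.
  have nW : ~ inhabited W by move/(cc_hom_inhabited pV hphi).
  (* Both varieties are empty, and any automorphism serves. *)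
  exists id; split; first exact: automorphism_id.
    apply/seteqP; split=> [_ [b Wb <-]|b Vb]; exfalso.
      by apply: nW; exists; exact: (exist _ b (mem_set Wb)).
    by apply: nV; exists; exact: (exist _ b (mem_set Vb)).
  by move=> f _ w; case: nW.
have [w0] : inhabited W by apply: (cc_hom_inhabited pW hpsi); exists.
have subW (w w' : W) : w = w'.
  apply: val_inj; apply: contrapT => h.
  by have [v [v' []]] := cc_separates H Vi hphi psiK h; rewrite (sub v v').
(* Two single points are matched by passing through the origin. *)
pose F := theta (val v0) \o theta (val w0).
have Fw : F (val w0) = val v0.
  rewrite -[RHS](thetaK (val v0)) /F /=; congr (theta _ _).
  by apply: val_inj; rewrite /= !theta_base.
exists F; split.
- by apply: automorphism_comp; exact: theta_automorphism.
- apply/seteqP; split=> [_ [b Wb <-]|b Vb].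
    rewrite -[b]/(val (exist _ b (mem_set Wb) : W)) (subW (exist _ b _) w0) Fw.
    exact: set_valP.
  exists (val w0); first exact: set_valP.
  by rewrite Fw (sub v0 (exist _ b (mem_set Vb))).
- move=> f Mf w v _.
  have -> : f = (fun=> f v) by apply/funext => v'; rewrite (sub v' v).
  by rewrite (cc_cst pV hphi).
Qed.
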